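(* Let $0<\tau\le 1$ be fixed. Under the sine-process, for $N\in\mathbb N$, $N\ge2$, let $$\xi^N_t=\frac{\#_{[0,tN]}-\mathbf E\,\#_{[0,tN]}}{\pi^{-1}\sqrt{\ln N}},\quad 0\le t\le 1,\qquad \eta^N:=\frac1\tau\int_0^\tau\xi^N_s\,ds,$$ and let $\eta\sim\mathcal N(0,1/2)$. Then the cumulants $(A^N_k)_{k\ge1}$ of $\eta^N$ and $(A_k)_{k\ge1}$ of $\eta$ satisfy $A^N_1=A_1=0$, $|A_2^N-A_2|\le C_2(\ln N)^{-1}$ and $$|A^N_k-A_k|\le\frac{C_k}{(\ln N)^{k/2-1}}\quad\text{for all }k\ge3,$$ with some constants $C_k$ independent of $N$.
   Context: The sine-process is the determinantal point process on $\mathbb R$ (a probability measure on the space of locally finite configurations of particles in $\mathbb R$) with $n$-point correlation functions $\rho_n(x_1,\dots,x_n)=\det(\mathcal K(x_i,x_j))_{1\le i,j\le n}$, where $\mathcal K(x,y)=\frac{\sin(x-y)}{\pi(x-y)}$ for $x\ne y$ and $\mathcal K(x,x)=\frac1\pi$. $\#_B$ is the number of particles of the random configuration in $B$. The cumulants $(J_k)_{k\ge1}$ of a real random variable $\nu$ are defined by $\ln\mathbf E e^{iy\nu}=\sum_{k\ge1}J_k\frac{(iy)^k}{k!}$ for sufficiently small $y\in\mathbb R$. *)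

(* Defs.v *)
From HB Require Import structures.
From mathcomp Require Import all_boot all_order all_algebra.
From mathcomp Require Import complex.
From mathcomp Require Import all_classical all_reals all_analysis.

Set Implicit Arguments.
Unset Strict Implicit.
Unset Printing Implicit Defensive.

Import Order.TTheory GRing.Theory Num.Theory.
Import numFieldNormedType.Exports.

Local Open Scope classical_set_scope.
Local Open Scope ring_scope.

(* A configuration is encoded by its multiplicity function: [w x] is the number
   of particles of [w] at the point [x], so multiple points are allowed. *)
Record config (R : realType) := Config {
  multiplicity :> R -> nat;
  config_locally_finite : forall a b : R,
    finite_set [set x | a <= x <= b /\ multiplicity x != 0%N] }.

Definition empty_config (R : realType) : config R.
Proof.
exists (fun=> 0%N) => a b.
by rewrite (_ : [set _ | _] = set0)//; apply/seteqP; split => // x [].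
Defined.

HB.instance Definition _ (R : realType) := gen_eqMixin (config R).
HB.instance Definition _ (R : realType) := gen_choiceMixin (config R).
HB.instance Definition _ (R : realType) :=
  isPointed.Build (config R) (empty_config R).

(* The number #_B of particles in B. It is meant for bounded B only: the
   finitely supported sum is 0 by convention if B holds infinitely many
   points of the configuration. *)
Definition particles (R : realType) (B : set R) (w : config R) : nat :=
  \big[addn/0%N]_(x \in B) w x.

Definition cylinders (R : realType) : set (set (config R)) :=
  [set C | exists (B : set R) (n : nat),
    [/\ measurable B, bounded_set B & C = [set w | particles B w = n]]].

Definition config_space (R : realType) := g_sigma_algebraType (@cylinders R).

(* The integral over the box B_1 x ... x B_n, as an iterated integral. *)
Fixpoint box_integral (R : realType) (Bs : seq (set R))
    (f : seq R -> \bar R) : \bar R :=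
  if Bs is B :: Bs' then
    (\int[lebesgue_measure]_(x in B) box_integral Bs' (fun s => f (x :: s)))%E
  else f [::].

(* [rho] lists all correlation functions: [rho [:: x_1; ...; x_n]] is
   rho_n (x_1, ..., x_n). The defining identity is
   E prod_i #_(B_i)! / (#_(B_i) - k_i)!
     = int_(B_1^k_1 x ... x B_m^k_m) rho_(k_1 + ... + k_m)
   for disjoint bounded Borel sets B_1, ..., B_m. *)
Definition has_correlation_functions (R : realType)
    (P : probability (config_space R) R) (rho : seq R -> R) : Prop :=
  forall (m : nat) (B : 'I_m -> set R) (k : 'I_m -> nat),
    (forall i, measurable (B i)) -> (forall i, bounded_set (B i)) ->
    trivIset setT B ->
    ('E_P[fun w => (\prod_(i < m) particles (B i) w ^_ k i)%N%:R] =
     box_integral (flatten [seq nseq (k i) (B i) | i <- enum 'I_m])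
       (fun s => (rho s)%:E))%E.

Definition sine_kernel (R : realType) (x y : R) : R :=
  if x == y then pi^-1 else sin (x - y) / (pi * (x - y)).

Definition is_sine_process (R : realType)
    (P : probability (config_space R) R) : Prop :=
  has_correlation_functions P (fun s =>
    \det (\matrix_(i < size s, j < size s) sine_kernel s`_i s`_j)).

(* E e^(iyX) *)
Definition charfun d (T : measurableType d) (R : realType)
    (P : probability T R) (X : T -> R) (y : R) : R[i] :=
  Complex (fine 'E_P[fun w => cos (y * X w)])
          (fine 'E_P[fun w => sin (y * X w)]).

(* The principal logarithm, with imaginary part in ]-pi, pi]. *)
Definition Cln (R : realType) (z : R[i]) : R[i] :=
  let: Complex a b := z in
  let r := Num.sqrt (a ^+ 2 + b ^+ 2) in
  Complex (ln r) (if 0 <= b then acos (a / r) else - acos (a / r)).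

(* [J k] is the k-th cumulant of X for k >= 1; [J 0] is irrelevant.
   These values are determined by X: two power series with the same sum near 0
   have the same coefficients. *)
Definition is_cumulants d (T : measurableType d) (R : realType)
    (P : probability T R) (X : T -> R) (J : nat -> R) : Prop :=
  measurable_fun [set: T] X /\
  \forall y \near (0 : R),
    (fun n => \sum_(1 <= k < n)
       Complex (J k) 0 * Complex 0 y ^+ k / k`!%:R : (R[i] : numFieldType))
    @ \oo --> (Cln (charfun P X y) : (R[i] : numFieldType)).

Definition xi (R : realType) (P : probability (config_space R) R)
    (N : nat) (t : R) (w : config R) : R :=
  let B := `[0, t * N%:R]%classic in
  ((particles B w)%:R - fine 'E_P[fun w' => (particles B w')%:R]) /
  (pi^-1 * Num.sqrt (ln N%:R)).

Definition eta_avg (R : realType) (P : probability (config_space R) R)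
    (tau : R) (N : nat) (w : config R) : R :=
  tau^-1 * \int[lebesgue_measure]_(s in `[0, tau]) xi P N s w.

(* Main.v *)
Require Import Defs.
From HB Require Import structures.
From mathcomp Require Import all_boot all_order all_fingroup all_algebra.
From mathcomp Require Import complex finmap ring lra zify.
From mathcomp Require Import all_classical all_reals all_analysis measurable_realfun.

(** The averaged count is an affine function of a linear statistic. Exchanging
    the integral over s with the sum over particles gives
    [eta_avg = s (S - X / (2 pi))] with X = tau N, s = pi / sqrt (ln N) and S the
    sum of 1 - x / X over the particles x of [0, X] ([eta_avgE]), so everything
    rests on the cumulants of S.

    For a determinantal process whose kernel K is an orthogonal projection and
    a statistic sum of phi (x) with 0 <= phi <= 1, the cumulant of order k + 1 is
    a signed sum of k! traces of words in phi K and phi (1 - K)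
    ([moment_cumul]). For k >= 1 each word contains (1 - K) phi K, and the rest
    of it contracts the Hilbert-Schmidt norm, so its trace is at most the squared
    norm of K phi (1 - K), which is the variance ([cumul_le]). Here the variance
    is ln X / (2 pi^2) + O(1) ([grid_variance_log]). Hence the cumulants of S of
    order k >= 2 are O(ln N); multiplied by s^k they become 1 / 2 + O(1 / ln N)
    for k = 2 and O((ln N)^(1 - k / 2)) for k >= 3.

    The word formula comes from reweighting the law by exp (t S): this keeps the
    process determinantal and moves the kernel in the direction (1 - K) phi K.
    To first order in t the statement is a polynomial identity between
    determinants ([corr_flow]), which iterates to a recursion between moments
    and cumulants.

    The algebra is done for matrices only. The interval is cut into n cells of
    length X / n, and K is replaced by a Dirichlet kernel on a discrete circle,
    an exact projection matrix close to the sine kernel ([circle_mx_idem],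
    [kernel_approx]). The factorial moments of the cell counts are integrals over
    boxes of a Lipschitz function, so the moments of S are the limits of those of
    the grid ([linear_moment_approx]), and the recursion and the inequalities pass
    to the limit ([linear_cumulants]).

    It remains to recognise the numbers defined by the recursion as cumulants in
    the sense of the logarithm of the characteristic function. The recursion is
    the coefficient form of F' = G' F for the generating functions of moments and
    cumulants; with cumulants of order k bounded by A (k - 1)! the truncated
    series satisfy F = exp G up to a geometrically small error near 0
    ([exp_poly_approx], [cumulants_affine]). The same criterion applies to the
    Gaussian variable, whose moments obey a two-term recursion by integration by
    parts ([gaussian_parts], [gaussian_cumulants]). *)

Set Implicit Arguments.
Unset Strict Implicit.
Unset Printing Implicit Defensive.

Import Order.TTheory GRing.Theory Num.Theory.
Import numFieldNormedType.Exports.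

Local Open Scope classical_set_scope.
Local Open Scope ring_scope.

(** * Moments of a linear statistic of a finite determinantal process *)

Section determinants.
Variable R : comNzRingType.

(** A Schur complement expansion that holds for singular [N] as well: it is
    proved for X + N, whose determinant is monic and hence regular, and then
    specialised at X = 0. *)
Lemma det_bordered n (a : R) (r : 'rV[R]_n) (c : 'cV[R]_n) (N : 'M[R]_n) :
  \det (block_mx a%:M r c N) = a * \det N - (r *m \adj N *m c) 0 0.
Proof.
pose lift m1 m2 := @map_mx R {poly R} (@polyC R) m1 m2.
(* char_poly_mx (- N) is X + N *)
pose Nx := char_poly_mx (- N).
have regN : GRing.rreg (\det Nx).
  by apply: monic_rreg; exact: char_poly_monic.
pose B := block_mx (a%:P)%:M (lift _ _ r) (lift _ _ c) Nx.
suff E : \det B = a%:P * \det Nx - (lift _ _ r *m \adj Nx *m lift _ _ c) 0 0.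
  have ev0N : map_mx (horner_eval 0) Nx = N.
    apply/matrixP => i j; rewrite !mxE /horner_eval !hornerE.
    by rewrite hornerMn hornerX mul0rn sub0r opprK.
  have ev0 m1 m2 (A : 'M[R]_(m1, m2)) : map_mx (horner_eval 0) (lift _ _ A) = A.
    by apply/matrixP => i j; rewrite !mxE /horner_eval hornerE.
  have := congr1 (horner_eval 0) E.
  rewrite -det_map_mx map_block_mx ev0N !ev0 map_scalar_mx.
  rewrite rmorphB rmorphM -det_map_mx ev0N /= /horner_eval hornerC => ->.
  congr (_ - _).
  have -> : forall (A : 'M[{poly R}]_1), (A 0 0).[0] = (map_mx (horner_eval 0) A) 0 0.
    by move=> A; rewrite mxE.
  by rewrite !map_mxM map_mx_adj ev0N !ev0.
apply: regN.
pose C : 'M[{poly R}]_(1 + n) :=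
  block_mx (\det Nx)%:M 0 (- (\adj Nx *m lift _ _ c)) 1%:M.
have detC : \det C = \det Nx by rewrite det_lblock det1 mulr1 det_scalar1.
rewrite -{1}detC -det_mulmx mulmx_block !mulmx0 !mulmx1 !add0r.
rewrite !mulmxN !mulmxA mul_mx_adj !mul_mx_scalar mul_scalar_mx subrr.
rewrite det_ublock; congr (_ * _).
rewrite [X in \det X]mx11_scalar det_scalar1 !mxE eqxx mulr1n mulrC.
by [].
Qed.

Lemma coef1_prod (I : finType) (a b : I -> R) :
  (\prod_i ((a i)%:P + 'X * (b i)%:P))`_1 =
  \sum_i b i * \prod_(k | k != i) a k.
Proof.
have coef1E (p : {poly R}) : p`_1 = p^`().[0].
  by rewrite horner_coef0 coef_deriv.
rewrite coef1E.
have der (s : seq I) (F : I -> {poly R}) : uniq s ->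
    (\prod_(i <- s) F i)^`() = \sum_(i <- s) (F i)^`() * \prod_(k <- s | k != i) F k.
  elim: s => [|x s IH] /=; first by rewrite !big_nil derivC.
  case/andP => xs us; rewrite !big_cons eqxx /= derivM IH //; congr (_ + _).
    congr (_ * _); rewrite [RHS]big_seq_cond [LHS]big_seq.
    apply: eq_bigl => i; case: eqP => [->|]; rewrite ?andbT ?andbF //.
    by rewrite (negbTE xs).
  rewrite mulr_sumr big_seq [RHS]big_seq; apply: eq_bigr => i si.
  rewrite big_cons; case: eqP => [xi|_]; last by rewrite mulrCA.
  by rewrite xi si in xs.
rewrite der ?index_enum_uniq //.
rewrite -[LHS]/(horner_eval 0 _) rmorph_sum /=; apply: eq_bigr => i _.
rewrite rmorphM rmorph_prod /= /horner_eval !poly.derivE !hornerE; congr (_ * _).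
by apply: eq_bigr => k _; rewrite !hornerE.
Qed.

(** Jacobi's formula for the derivative of a determinant, in coefficient form so
    that it makes sense over every commutative ring. *)
Lemma coef1_det n (N B : 'M[R]_n) :
  (\det (map_mx polyC N + 'X *: map_mx polyC B))`_1 = \tr (\adj N *m B).
Proof.
rewrite /determinant coef_sum.
transitivity (\sum_(s : 'S_n) \sum_i
   (-1) ^+ s * (B i (s i) * \prod_(k | k != i) N k (s k))).
  apply: eq_bigr => s _; rewrite -mulr_sumr.
  rewrite -(coef1_prod (fun i => N i (s i)) (fun i => B i (s i))).
  under eq_bigr => i _ do rewrite !mxE.
  by rewrite !mulr_sign; case: ifP => _; rewrite ?coefN.
rewrite exchange_big mxtrace_mulC /mxtrace /=; apply: eq_bigr => i _.
pose Ni := \matrix_(k, j) (if k == i then B i j else N k j).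
have -> : (B *m \adj N) i i = \det Ni.
  rewrite mxE (expand_det_row _ i); apply: eq_bigr => j _.
  rewrite !mxE eqxx; congr (_ * _); congr (_ * \det _).
  by apply/matrixP => k l; rewrite !mxE eq_sym (negbTE (neq_lift _ _)).
rewrite /determinant; apply: eq_bigr => s _; congr (_ * _).
rewrite [RHS](bigD1 i) //= [in RHS]mxE eqxx; congr (_ * _).
by apply: eq_bigr => k /negbTE ki; rewrite mxE ki.
Qed.
End determinants.

Section tilting.
Variables (R : comNzRingType) (n : nat).
Implicit Types (phi : 'rV[R]_n) (D : 'M[R]_n) (s : seq 'I_n).

(** Correlation weight of the points [s] in the finite determinantal process of
    kernel [D]. Repeated points give equal rows, so that no two particles share
    a point. *)
Definition corr D s : R :=
  \det (\matrix_(i < size s, j < size s)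
          D (tnth (in_tuple s) i) (tnth (in_tuple s) j)).

(** The effect on factorial moments of multiplying by sum phi_j N_j, where N_j is
    the number of particles at j: N_j times the falling factorial of order k of
    N_j is the one of order k + 1 plus k times the one of order k. *)
Definition add_particle phi (f : seq 'I_n -> R) s : R :=
  \sum_j phi 0 j * f (j :: s) + (\sum_(i <- s) phi 0 i) * f s.

(** First-order change of the kernel when the law of the process is reweighted
    by exp (t sum phi_j N_j). *)
Definition tilt phi D : 'M[R]_n := (1%:M - D) *m diag_mx phi *m D.

Lemma tiltE phi D a b :
  tilt phi D a b = phi 0 a * D a b - \sum_j phi 0 j * (D a j * D j b).
Proof.
rewrite /tilt mulmxBl mul1mx mulmxBl mul_diag_mx mxE mxE [in X in _ + X = _]mxE.
congr (_ - _); rewrite mxE; apply: eq_bigr => j _.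
by rewrite mul_mx_diag mxE mulrCA mulrA.
Qed.

Lemma corr_nil D : corr D [::] = 1.
Proof. by rewrite /corr det_mx00. Qed.

Lemma corr_cons D j s :
  let N := \matrix_(i < size s, k < size s)
          D (tnth (in_tuple s) i) (tnth (in_tuple s) k) in
  corr D (j :: s) = D j j * corr D s -
    ((\row_k D j (tnth (in_tuple s) k)) *m \adj N *m
     (\col_k D (tnth (in_tuple s) k) j)) 0 0.
Proof.
move=> N; rewrite -det_bordered /corr; congr (\det _).
have tnth0 : tnth (in_tuple (j :: s)) ord0 = j by [].
have tnthS i : tnth (in_tuple (j :: s)) (rshift 1 i) = tnth (in_tuple s) i.
  rewrite !(tnth_nth j) /=.
  by [].
have E0 (i : 'I_1) : lshift (size s) i = ord0 by apply/val_inj; rewrite /= ord1.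
apply/matrixP => a b; rewrite mxE -[a](@splitK 1 (size s) a) -[b](@splitK 1 (size s) b).
case: (@fintype.split 1 (size s) a) => a'; case: (@fintype.split 1 (size s) b) => b' /=.
- apply: etrans (esym (block_mxEul _ _ _ _ a' b')).
  by rewrite !E0 !ord1 mxE eqxx mulr1n.
- apply: etrans (esym (block_mxEur _ _ _ _ a' b')).
  by rewrite mxE -tnthS E0.
- apply: etrans (esym (block_mxEdl _ _ _ _ a' b')).
  by rewrite mxE -tnthS E0.
- apply: etrans (esym (block_mxEdr _ _ _ _ a' b')).
  by rewrite mxE -!tnthS.
Qed.

Definition flow phi D : 'M[{poly R}]_n :=
  map_mx polyC D + 'X *: map_mx polyC (tilt phi D).

End tilting.

(** Multiplying by the centred statistic acts on the correlations of a
    determinantal process as the derivation that moves [D] along [tilt phi D].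
    Expanding the determinant of a list [j :: s] along its first row produces the
    same rank-one terms as Jacobi's formula for the derivative. *)
Lemma corr_flow (R : comNzRingType) n (phi : 'rV[R]_n) D s :
  (corr (flow phi D) s)`_1 =
  add_particle phi (corr D) s - \tr (diag_mx phi *m D) * corr D s.
Proof.
pose t := tnth (in_tuple s).
pose N := \matrix_(i < size s, j < size s) D (t i) (t j).
pose B := \matrix_(i < size s, j < size s) tilt phi D (t i) (t j).
pose r j := \row_k D j (t k); pose c j := \col_k D (t k) j.
have -> : corr (flow phi D) s = \det (map_mx polyC N + 'X *: map_mx polyC B).
  by congr (\det _); apply/matrixP => i j; rewrite !mxE.
rewrite coef1_det.
have -> : B = diag_mx (\row_i phi 0 (t i)) *m N - \sum_j phi 0 j *: (c j *m r j).
  apply/matrixP => a b; rewrite mxE tiltE mul_diag_mx !mxE; congr (_ - _).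
  rewrite summxE; apply: eq_bigr => j _.
  by rewrite !mxE big_ord_recl big_ord0 addr0 !mxE.
rewrite mulmxBr linearB /= mulmxA.
rewrite mxtrace_mulC mulmxA mul_mx_adj mul_scalar_mx linearZ /= mxtrace_diag.
have -> : \sum_i (\row_i0 phi 0 (t i0)) 0 i = \sum_(i <- s) phi 0 i.
  rewrite (big_tnth _ _ s) /=; apply: eq_bigr => i _.
  by rewrite mxE.
have -> : add_particle phi (corr D) s =
    \tr (diag_mx phi *m D) * corr D s + (\sum_(i <- s) phi 0 i) * corr D s -
    \sum_j phi 0 j * (r j *m \adj N *m c j) 0 0.
  rewrite /add_particle addrAC; congr (_ + _).
  under eq_bigr => j _ do rewrite corr_cons mulrBr mulrA.
  rewrite big_split /= sumrN -mulr_suml; congr (_ * _ - _).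
  by rewrite /mxtrace; apply: eq_bigr => j _; rewrite mul_diag_mx mxE.
rewrite addrAC (addrAC (\tr _ * _)) subrr add0r mulrC; congr (_ - _).
rewrite mulmx_sumr linear_sum; apply: eq_bigr => j _ /=.
rewrite -scalemxAr linearZ /=; congr (_ * _).
by rewrite mulmxA mxtrace_mulC mulmxA /mxtrace big_ord_recl big_ord0 addr0.
Qed.

(** * Cumulants as signed sums over words *)

(** The Leibniz rule on words, where the letter [true] stands for D and [false]
    for 1 - D. Tilting replaces D by (1 - D) phi D and 1 - D by the opposite; the
    boolean paired with a word records this sign. *)
Fixpoint expand (w : seq bool) : seq (bool * seq bool) :=
  if w is b :: w' then
    (~~ b, [:: false, true & w']) :: [seq (x.1, b :: x.2) | x <- expand w']
  else [::].

(** The terms of the cumulant of order k + 1: those obtained from the one-letter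
    word D, which gives the mean, by k derivations. *)
Fixpoint signed_words k : seq (bool * seq bool) :=
  if k is k'.+1 then
    flatten [seq [seq (x.1 (+) y.1, y.2) | y <- expand x.2] | x <- signed_words k']
  else [:: (false, [:: true])].

Section cumulants.
Variables (R : comNzRingType) (n : nat).
Implicit Types (phi : 'rV[R]_n) (D : 'M[R]_n) (s : seq 'I_n).

(** At [s = [::]] this is the moment of order p of the statistic; the other lists
    make the recursion closed. *)
Definition joint_moment phi D p s : R := iter p (add_particle phi) (corr D) s.

Lemma joint_momentS phi D p s :
  joint_moment phi D p.+1 s = add_particle phi (joint_moment phi D p) s.
Proof. by []. Qed.

Definition wordmx phi D (w : seq bool) : 'M[R]_n :=
  foldr (fun b A => diag_mx phi *m (if b then D else 1%:M - D) *m A) 1%:M w.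

(** The cumulant of order k + 1: [cumul phi D 0] is the mean and
    [cumul phi D 1] the variance. *)
Definition cumul phi D k : R :=
  \sum_(x <- signed_words k) (-1) ^+ (x : bool * seq bool).1 * \tr (wordmx phi D x.2).
End cumulants.

Arguments joint_moment : simpl never.
Arguments cumul : simpl never.

Section derivation.
Variables (R : comNzRingType) (n : nat).
Variables (phi : 'rV[R]_n) (D : 'M[R]_n).
Let phiX : 'rV[{poly R}]_n := map_mx polyC phi.

Let coef0M (p q : {poly R}) : (p * q)`_0 = p`_0 * q`_0.
Proof. by rewrite -!horner_coef0 hornerM. Qed.

Let coef1M (p q : {poly R}) : (p * q)`_1 = p`_1 * q`_0 + p`_0 * q`_1.
Proof. by rewrite coefM !big_ord_recl big_ord0 addr0 /= addrC. Qed.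

Let coefC0 (a : R) : (a%:P)`_0 = a.
Proof. by rewrite coefC. Qed.

Let coefC1 (a : R) : (a%:P)`_1 = 0.
Proof. by rewrite coefC. Qed.

(** Derivations are realised over polynomials: for an expression in
    [flow phi D], the coefficient 1 is the derivative along [tilt phi D], and the
    coefficient 0 gives back the expression in [D]. *)
Lemma coef0_flow : map_mx (coefp 0) (flow phi D) = D.
Proof.
by apply/matrixP => i j; rewrite !mxE /coefp coefD coefC0 coefXM addr0.
Qed.

Lemma coef1_flow : map_mx (coefp 1) (flow phi D) = tilt phi D.
Proof.
by apply/matrixP => i j; rewrite !mxE /coefp coefD coefC1 coefXM coefC0 add0r.
Qed.

Lemma coef0_corr s : (corr (flow phi D) s)`_0 = corr D s.
Proof.
rewrite -horner_coef0 -[LHS]/(horner_eval 0 _) -det_map_mx; congr (\det _).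
apply/matrixP => i j; rewrite !mxE /= /horner_eval horner_coef0 coefD coefC0 coefXM.
by rewrite addr0.
Qed.

Lemma coef0_joint_moment p s : (joint_moment phiX (flow phi D) p s)`_0 = joint_moment phi D p s.
Proof.
elim: p s => [|p IH] s; first exact: coef0_corr.
rewrite /joint_moment !iterS /add_particle coefD coef0M !coef_sum -/(joint_moment _ _ _ _).
congr (_ + _ * _); last exact: IH.
  by apply: eq_bigr => j _; rewrite coef0M mxE coefC0 IH.
by apply: eq_bigr => j _; rewrite mxE coefC0.
Qed.

(** Multiplication by the statistic commutes with the derivation, so that
    [corr_flow] propagates from correlations to all joint moments. *)
Lemma coef1_joint_moment p s :
  (joint_moment phiX (flow phi D) p s)`_1 =
  joint_moment phi D p.+1 s - \tr (diag_mx phi *m D) * joint_moment phi D p s.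
Proof.
elim: p s => [|p IH] s; first exact: corr_flow.
rewrite [in LHS]joint_momentS /add_particle coefD coef1M !coef_sum.
rewrite coef0_joint_moment [X in _ + (X * _ + _)]big1 ?mul0r ?add0r; last first.
  by move=> i _; rewrite mxE coefC1.
rewrite IH; under eq_bigr => j _ do rewrite coef1M mxE coefC1 mul0r add0r IH coefC0.
under [X in X * _]eq_bigr => i _ do rewrite mxE coefC0.
under eq_bigr => j _ do rewrite mulrBr mulrCA.
rewrite sumrB -mulr_sumr [joint_moment _ _ p.+2 s]joint_momentS /add_particle.
rewrite [joint_moment _ _ p.+1 s]joint_momentS /add_particle; ring.
Qed.

Let c0M m1 m2 m3 (A : 'M[{poly R}]_(m1, m2)) (B : 'M[{poly R}]_(m2, m3)) :
  map_mx (coefp 0) (A *m B) = map_mx (coefp 0) A *m map_mx (coefp 0) B.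
Proof.
apply/matrixP => i j; rewrite !mxE /coefp coef_sum; apply: eq_bigr => k _.
by rewrite coef0M !mxE.
Qed.

Let c1M m1 m2 m3 (A : 'M[{poly R}]_(m1, m2)) (B : 'M[{poly R}]_(m2, m3)) :
  map_mx (coefp 1) (A *m B) =
  map_mx (coefp 1) A *m map_mx (coefp 0) B +
  map_mx (coefp 0) A *m map_mx (coefp 1) B.
Proof.
apply/matrixP => i j; rewrite !mxE /coefp coef_sum -big_split.
by apply: eq_bigr => k _; rewrite coef1M !mxE.
Qed.

Let c0C m1 m2 (A : 'M[R]_(m1, m2)) : map_mx (coefp 0) (map_mx polyC A) = A.
Proof. by apply/matrixP => i j; rewrite !mxE /coefp coefC0. Qed.

Let c1C m1 m2 (A : 'M[R]_(m1, m2)) : map_mx (coefp 1) (map_mx polyC A) = 0.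
Proof. by apply/matrixP => i j; rewrite !mxE /coefp coefC1. Qed.

Let phiXE : diag_mx phiX = map_mx polyC (diag_mx phi).
Proof. by rewrite map_diag_mx. Qed.

Let oneE : (1%:M : 'M[{poly R}]_n) = map_mx polyC 1%:M.
Proof. by rewrite map_mx1. Qed.

Let coef0_letter (b : bool) :
  map_mx (coefp 0) (if b then flow phi D else 1%:M - flow phi D) =
  if b then D else 1%:M - D.
Proof.
case: b; first exact: coef0_flow.
by rewrite raddfB /= oneE c0C coef0_flow.
Qed.

Let coef1_letter (b : bool) :
  map_mx (coefp 1) (if b then flow phi D else 1%:M - flow phi D) =
  (-1) ^+ (~~ b) *: tilt phi D.
Proof.
case: b; first by rewrite coef1_flow scale1r.
by rewrite raddfB /= oneE c1C coef1_flow sub0r scaleN1r.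
Qed.

Lemma coef0_wordmx w :
  map_mx (coefp 0) (wordmx phiX (flow phi D) w) = wordmx phi D w.
Proof.
elim: w => [|b w IH] /=; first by rewrite oneE c0C.
by rewrite !c0M IH coef0_letter phiXE c0C.
Qed.

Lemma coef1_wordmx w :
  map_mx (coefp 1) (wordmx phiX (flow phi D) w) =
  \sum_(x <- expand w) (-1) ^+ x.1 *: wordmx phi D x.2.
Proof.
elim: w => [|b w IH] /=; first by rewrite oneE c1C big_nil.
rewrite c1M IH coef0_wordmx c1M c0M coef1_letter coef0_letter phiXE c0C c1C.
rewrite mul0mx add0r big_cons big_map /= mulmx_sumr; congr (_ + _).
  rewrite -scalemxAr -scalemxAl /tilt; congr (_ *: _).
  by rewrite !mulmxA.
by apply: eq_bigr => x _; rewrite -scalemxAr.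
Qed.

Let signC (b : bool) : ((-1) ^+ b : {poly R}) = ((-1) ^+ b)%:P.
Proof. by case: b; rewrite ?expr0 ?expr1 ?polyCN. Qed.

Lemma coef0_cumul k : (cumul phiX (flow phi D) k)`_0 = cumul phi D k.
Proof.
rewrite /cumul coef_sum; apply: eq_bigr => x _.
rewrite signC coefCM -(coef0_wordmx x.2); congr (_ * _).
by rewrite /mxtrace coef_sum; apply: eq_bigr => i _; rewrite [RHS]mxE.
Qed.

Lemma coef1_cumul k : (cumul phiX (flow phi D) k)`_1 = cumul phi D k.+1.
Proof.
rewrite /cumul /= big_flatten big_map coef_sum; apply: eq_bigr => x _.
rewrite big_map /=.
rewrite signC coefCM.
have -> : (\tr (wordmx phiX (flow phi D) x.2))`_1 =
          \tr (map_mx (coefp 1) (wordmx phiX (flow phi D) x.2)).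
  by rewrite /mxtrace coef_sum; apply: eq_bigr => i _; rewrite [RHS]mxE.
rewrite coef1_wordmx linear_sum mulr_sumr; apply: eq_bigr => y _ /=.
by rewrite linearZ /= mulrA signr_addb.
Qed.

End derivation.

(** The induction is over all rings at once. The case p, applied over
    polynomials to the kernel [flow phi D], yields by its coefficient 1 a Leibniz
    rule that is the case p + 1 once Pascal's rule has merged the binomials. *)
Lemma moment_cumul p (R : comNzRingType) n (phi : 'rV[R]_n) D :
  joint_moment phi D p.+1 [::] =
  \sum_(j < p.+1) 'C(p, j)%:R * cumul phi D j * joint_moment phi D (p - j) [::].
Proof.
have cumul0 (A : comNzRingType) (f : 'rV[A]_n) (E : 'M[A]_n) :
    cumul f E 0 = \tr (diag_mx f *m E).
  by rewrite /cumul big_cons big_nil addr0 expr0 mul1r /= mulmx1.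
elim: p R phi D => [|p IH] R phi D.
  rewrite big_ord_recl big_ord0 addr0 bin0 mul1r subn0 cumul0.
  rewrite /joint_moment /= /add_particle big_nil mul0r addr0 corr_nil mulr1.
  rewrite /mxtrace; apply: eq_bigr => j _.
  by rewrite corr_cons corr_nil mulr1 mxE big_ord0 subr0 mul_diag_mx mxE.
have := congr1 (fun q : {poly R} => q`_1) (IH _ (map_mx polyC phi) (flow phi D)).
rewrite /= coef1_joint_moment => /eqP; rewrite subr_eq => /eqP ->.
rewrite coef_sum IH mulr_sumr -big_split /=.
rewrite (eq_bigr (fun j : 'I_p.+1 =>
   'C(p, j)%:R * cumul phi D j.+1 * joint_moment phi D (p - j) [::] +
   'C(p, j)%:R * cumul phi D j * joint_moment phi D (p.+1 - j) [::])); last first.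
  move=> j _; rewrite -[_%:R * _ * _]mulrA -[(_)%:R in LHS]polyC_natr coefCM.
  rewrite coefM !big_ord_recl big_ord0 /= addr0.
  rewrite !coef0_cumul coef1_cumul coef0_joint_moment coef1_joint_moment.
  rewrite (subSn (leq_ord j)); ring.
rewrite big_split /= [RHS]big_ord_recl /= bin0 mul1r subn0.
rewrite [X in _ + X = _]big_ord_recl /= bin0 mul1r subn0 addrCA; congr (_ + _); rewrite addrC.
under [RHS]eq_bigr => j _ do
  rewrite /bump /= add1n binS natrD mulrDl mulrDl subSS.
rewrite big_split /=; congr (_ + _).
rewrite [RHS]big_ord_recr /= bin_small // !mul0r addr0.
by apply: eq_bigr => j _; rewrite /bump /= add1n subSS.
Qed.

(** * Cumulants are controlled by the variance *)

(** Whatever letter is differentiated, a factor (1 - D) phi D is left behind. *)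
Lemma expand_transition w x : x \in expand w ->
  exists u v, x.2 = u ++ [:: false, true & v].
Proof.
elim: w x => // b w IH x /=; rewrite inE => /orP[/eqP->|].
  by exists [::], w.
case/mapP => y /IH[u [v E]] -> /=.
by exists (b :: u), v; rewrite E.
Qed.

Lemma signed_words_transition k x : x \in signed_words k.+1 ->
  exists u v, x.2 = u ++ [:: false, true & v].
Proof. by case/flattenP => s /mapP[y _ ->] /mapP[z /expand_transition zP ->]. Qed.

Lemma size_expand w : size (expand w) = size w.
Proof. by elim: w => //= b w IH; rewrite size_map IH. Qed.

Lemma size_expand_word w x : x \in expand w -> size x.2 = (size w).+1.
Proof.
elim: w x => // b w IH x /=; rewrite inE => /orP[/eqP->//|].
by case/mapP => y /IH E -> /=; rewrite E.
Qed.

Lemma size_signed_words_word k x : x \in signed_words k -> size x.2 = k.+1.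
Proof.
elim: k x => [|k IH] x; first by rewrite inE => /eqP->.
case/flattenP => s /mapP[y /IH yk ->] /mapP[z /size_expand_word zy ->] /=.
by rewrite zy yk.
Qed.

(** A word with l letters has l derivatives, each of length l + 1; hence the
    factorial. *)
Lemma size_signed_words k : size (signed_words k) = k`!.
Proof.
elim: k => // k IH; rewrite [signed_words _]/= size_flatten /shape -map_comp.
have -> : [seq (size \o (fun x => [seq (x.1 (+) y.1, y.2) | y <- expand x.2])) x
    | x <- signed_words k] = [seq k.+1 | x <- signed_words k].
  by apply/eq_in_map => x xk /=; rewrite size_map size_expand (size_signed_words_word xk).
rewrite factS -IH; elim: (signed_words k) => [|a s E] /=; first by rewrite muln0.
by rewrite E mulnS.
Qed.

Section frobenius.
Variable R : realDomainType.

Definition frob2 m n (A : 'M[R]_(m, n)) : R := \sum_i \sum_j A i j ^+ 2.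

Lemma frob2_ge0 m n (A : 'M[R]_(m, n)) : 0 <= frob2 A.
Proof. by apply: sumr_ge0 => i _; apply: sumr_ge0 => j _; exact: sqr_ge0. Qed.

Lemma frob2_tr m n (A : 'M[R]_(m, n)) : frob2 A^T = frob2 A.
Proof.
rewrite /frob2 exchange_big; apply: eq_bigr => i _; apply: eq_bigr => j _.
by rewrite mxE.
Qed.

Lemma frob2E m n (A : 'M[R]_(m, n)) : frob2 A = \tr (A *m A^T).
Proof.
apply: eq_bigr => i _; rewrite mxE; apply: eq_bigr => j _.
by rewrite mxE expr2.
Qed.

(** Cauchy-Schwarz with the arithmetic mean instead of the geometric one, which
    loses nothing when both factors have the same bound. *)
Lemma normr_tr_le n (A B : 'M[R]_n) : 2 * `|\tr (A *m B)| <= frob2 A + frob2 B.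
Proof.
rewrite /mxtrace -[frob2 B]frob2_tr -big_split /=.
apply: le_trans (ler_wpM2l _ (ler_norm_sum _ _ _)) _ => //.
rewrite mulr_sumr; apply: ler_sum => i _; rewrite mxE -big_split /=.
apply: le_trans (ler_wpM2l _ (ler_norm_sum _ _ _)) _ => //.
rewrite mulr_sumr; apply: ler_sum => j _; rewrite mxE normrM.
rewrite -(real_normK (num_real (A i j))) -(real_normK (num_real (B j i))).
by have := sqr_ge0 (`|A i j| - `|B j i|); nra.
Qed.

Variables (n : nat) (phi : 'rV[R]_n) (D : 'M[R]_n).
Hypotheses (D2 : D *m D = D) (DT : D^T = D).
Hypothesis phi01 : forall i, 0 <= phi 0 i <= 1.

Let F := diag_mx phi.
Let Q := 1%:M - D.
Let Q2 : Q *m Q = Q.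
Proof. by rewrite /Q mulmxBl mul1mx mulmxBr mulmx1 D2 subrr subr0. Qed.
Let QT : Q^T = Q. Proof. by rewrite /Q raddfB /= trmx1 DT. Qed.
Let FT : F^T = F. Proof. exact: tr_diag_mx. Qed.

Let contract_proj (E A : 'M[R]_n) : E *m E = E -> E^T = E ->
  frob2 (A *m E) <= frob2 A.
Proof.
have projE (P : 'M[R]_n) : P *m P = P -> P^T = P ->
    frob2 (A *m P) = \tr (A *m P *m A^T).
  by move=> P2 PT; rewrite frob2E trmx_mul PT mulmxA -(mulmxA A) P2.
move=> E2 ET; rewrite -subr_ge0.
suff -> : frob2 A - frob2 (A *m E) = frob2 (A *m (1%:M - E)) by exact: frob2_ge0.
rewrite projE // projE.
- by rewrite mulmxBr mulmxBl mulmx1 mxtraceD raddfN -frob2E.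
- by rewrite mulmxBl mul1mx mulmxBr mulmx1 E2 subrr subr0.
- by rewrite raddfB /= trmx1 ET.
Qed.

Definition letter (b : bool) := if b then D else 1%:M - D.

Lemma contract_letter b (A : 'M[R]_n) : frob2 (A *m letter b) <= frob2 A.
Proof. by case: b; apply: contract_proj. Qed.

Lemma contract_diag (A : 'M[R]_n) : frob2 (A *m diag_mx phi) <= frob2 A.
Proof.
apply: ler_sum => i _; apply: ler_sum => j _; rewrite mul_mx_diag mxE exprMn.
have /andP[p0 p1] := phi01 j.
by rewrite ler_piMr ?sqr_ge0 // expr_le1.
Qed.

Lemma contract_wordmx w (A : 'M[R]_n) : frob2 (A *m wordmx phi D w) <= frob2 A.
Proof.
elim: w A => [|b w IH] A /=; first by rewrite mulmx1.
rewrite !mulmxA; apply: le_trans (IH _) _.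
exact: le_trans (contract_letter b _) (contract_diag _).
Qed.

(** Read the word from the left. A leading D is absorbed because D F is a
    contraction. A leading 1 - D exhibits the factor D F (1 - D), and what follows
    is a contraction. *)
Lemma frob2_word_le w :
  frob2 (D *m (wordmx phi D w *m F) *m Q) <= frob2 (D *m F *m Q).
Proof.
elim: w => [|[] w IH]; first by rewrite mul1mx.
- have -> : D *m (wordmx phi D (true :: w) *m F) *m Q =
      D *m (F *m (D *m (wordmx phi D w *m F) *m Q)) by rewrite /= !mulmxA.
  apply: le_trans IH.
  rewrite -frob2_tr !(trmx_mul D) trmx_mul FT DT -mulmxA.
  rewrite -(frob2_tr (D *m _ *m Q)); set B := (D *m _ *m Q)^T.
  rewrite mulmxA; apply: le_trans (contract_letter true _) _.
  exact: contract_diag.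
- have -> : D *m (wordmx phi D (false :: w) *m F) *m Q =
      D *m F *m Q *m wordmx phi D w *m F *m Q by rewrite /= !mulmxA.
  apply: le_trans (contract_letter false _) _.
  by apply: le_trans (contract_diag _) _; exact: contract_wordmx.
Qed.

Lemma wordmx_cat (u v : seq bool) :
  wordmx phi D (u ++ v) = wordmx phi D u *m wordmx phi D v.
Proof. by elim: u => [|b u IH] /=; rewrite ?mul1mx // IH !mulmxA. Qed.

Lemma cumul1E : cumul phi D 1 = frob2 (D *m F *m Q).
Proof.
rewrite /cumul /= big_cons big_nil addr0 /= mul1r mulmx1.
rewrite frob2E !trmx_mul FT QT DT -/F -/Q.
rewrite -!mulmxA [Q *m (Q *m _)]mulmxA Q2.
by rewrite [RHS]mxtrace_mulC -!mulmxA D2.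
Qed.

(** By cyclicity, and since D and Q = 1 - D are idempotent, the trace is a
    Frobenius inner product of D F Q with D W Q for another word W. Both norms are
    at most that of D F Q, whose square is the variance. *)
Lemma trace_word_le u v :
  `|\tr (wordmx phi D (u ++ [:: false, true & v]))| <= cumul phi D 1.
Proof.
pose U := wordmx phi D u; pose V := wordmx phi D v.
have -> : \tr (wordmx phi D (u ++ [:: false, true & v])) =
    \tr ((D *m F *m Q)^T *m (D *m (wordmx phi D (v ++ u) *m F) *m Q)).
  transitivity (\tr (D *m (V *m U *m F *m Q *m F))).
    rewrite wordmx_cat /= -/F -/Q -/U -/V !mulmxA mxtrace_mulC.
    by rewrite !mulmxA mxtrace_mulC !mulmxA.
  rewrite wordmx_cat -/U -/V !trmx_mul FT QT DT [RHS]mxtrace_mulC.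
  rewrite -[RHS]/(\tr (D *m (V *m U *m F) *m Q *m (Q *m (F *m D)))).
  rewrite -(mulmxA _ Q (Q *m _)) (mulmxA Q Q) Q2 !mulmxA [RHS]mxtrace_mulC.
  by rewrite !mulmxA D2.
have le1 := frob2_word_le (v ++ u).
have := normr_tr_le (D *m F *m Q)^T (D *m (wordmx phi D (v ++ u) *m F) *m Q).
rewrite frob2_tr -cumul1E => le2.
move: le1; rewrite -cumul1E => le1.
rewrite -(ler_pM2l (_ : 0 < 2)) //; apply: le_trans le2 _.
by rewrite mulr_natl mulr2n lerD2l.
Qed.

(** This bound is what produces the rate (ln N)^(1 - k / 2): every cumulant is of
    the order of the variance at most. *)
Lemma cumul_le k : `|cumul phi D k.+1| <= k.+1`!%:R * cumul phi D 1.
Proof.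
rewrite {1}/cumul; apply: le_trans (ler_norm_sum _ _ _) _.
have -> : k.+1`!%:R * cumul phi D 1 = \sum_(x <- signed_words k.+1) cumul phi D 1.
  by rewrite big_const_seq count_predT iter_addr_0 size_signed_words mulr_natl.
rewrite big_seq [leRHS]big_seq.
apply: ler_sum => x /signed_words_transition[u [v E]].
by rewrite normrM normrX normrN1 expr1n mul1r E; exact: trace_word_le.
Qed.
End frobenius.

(** * Taylor bounds for sine and cosine *)

Section taylor.
Variable R : realType.
Implicit Types (f df : R -> R) (x : R).

Lemma le_of_derive_ge0 f df x : (forall t, is_derive t (1:R) f (df t)) ->
  (forall t, 0 <= t -> 0 <= df t) -> 0 <= x -> f 0 <= f x.
Proof.
move=> fdf df0 x0.
have [|c c0x E] := @MVT_segment R f df 0 x x0 (fun t _ => fdf t).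
- apply: derivable_within_continuous => t _; exact: ex_derive.
- rewrite -subr_ge0 E subr0 mulr_ge0 // df0 //.
  by move: c0x; rewrite in_itv /= => /andP[].
Qed.

Let mono_poly n : {poly R} := n.+1`!%:R^-1 *: 'X^(n.+1).

Let mono_polyE n x : (mono_poly n).[x] = x ^+ n.+1 / n.+1`!%:R.
Proof. by rewrite /mono_poly !hornerE mulrC. Qed.

Let mono_poly_deriv n x : (mono_poly n)^`().[x] = x ^+ n / n`!%:R.
Proof.
rewrite /mono_poly derivZ derivXn hornerZ hornerMn hornerXn mulrC -mulr_natr.
rewrite factS natrM invfM -!mulrA; congr (_ * _); rewrite mulrA mulfV ?mul1r //.
Qed.

(** Integrating a bound on the derivative, the inductive step of Taylor's
    formula. *)
Lemma growth f df n x : (forall t, is_derive t (1:R) f (df t)) -> f 0 = 0 ->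
  (forall t, `|df t| <= `|t| ^+ n / n`!%:R) ->
  `|f x| <= `|x| ^+ n.+1 / n.+1`!%:R.
Proof.
have pos (g dg : R -> R) (y : R) : (forall t, is_derive t (1:R) g (dg t)) -> g 0 = 0 ->
    (forall t, `|dg t| <= `|t| ^+ n / n`!%:R) -> 0 <= y ->
    g y <= y ^+ n.+1 / n.+1`!%:R.
  move=> gdg g0 gle y0.
  rewrite -subr_ge0 -mono_polyE.
  have := @le_of_derive_ge0 (horner (mono_poly n) - g)
     (fun t => (mono_poly n)^`().[t] - dg t) y.
  rewrite !fctE g0 mono_polyE expr0n mul0r subr0; apply => //.
  move=> t t0; rewrite mono_poly_deriv subr_ge0.
  by apply: le_trans (ler_norm _) _; rewrite -[in leRHS](ger0_norm t0).
have posN (g dg : R -> R) (y : R) : (forall t, is_derive t (1:R) g (dg t)) -> g 0 = 0 ->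
    (forall t, `|dg t| <= `|t| ^+ n / n`!%:R) -> 0 <= y ->
    `|g y| <= y ^+ n.+1 / n.+1`!%:R.
  move=> gdg g0 gle y0; rewrite ler_norml lerNl; apply/andP; split.
    apply: (pos (- g) (fun t => - dg t)) => //.
      by rewrite fctE g0 oppr0.
    by move=> t; rewrite normrN.
  exact: (pos g dg).
move=> fdf f0 fle; have [x0|x0] := leP 0 x.
  by rewrite (ger0_norm x0); exact: (posN f df).
rewrite (ltr0_norm x0).
have -> : f x = (f \o -%R) (- x) by rewrite /= opprK.
apply: (posN (f \o -%R) (fun t => - df (- t))) => //.
- by move=> t; apply: is_derive_eq; rewrite mulrN1.
- by rewrite /= oppr0.
- by move=> t; rewrite normrN -[in leRHS]normrN.
- by rewrite oppr_ge0 ltW.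
Qed.

(** [re_i p] and [im_i p] are the real and imaginary parts of the power p of the
    imaginary unit; keeping them apart avoids complex-valued calculus. *)
Definition re_i (p : nat) : R := if odd p then 0 else (-1) ^+ p./2.
Definition im_i (p : nat) : R := if odd p then (-1) ^+ p./2 else 0.

Lemma re_iS p : re_i p.+1 = - im_i p.
Proof.
rewrite /re_i /im_i /= uphalf_half; case: (odd p); rewrite ?oppr0 //=.
by rewrite exprD expr1 mulN1r.
Qed.

Lemma im_iS p : im_i p.+1 = re_i p.
Proof. by rewrite /re_i /im_i /= uphalf_half; case: (odd p). Qed.

Definition eexp_re n : {poly R} := \poly_(p < n) (re_i p / p`!%:R).
Definition eexp_im n : {poly R} := \poly_(p < n) (im_i p / p`!%:R).

Let deriv_egf (a : nat -> R) n :
  (\poly_(p < n.+1) (a p / p`!%:R))^`() = \poly_(p < n) (a p.+1 / p`!%:R).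
Proof.
apply/polyP => k; rewrite coef_deriv !coef_poly ltnS; case: ltnP => _; last first.
  by rewrite mul0rn.
rewrite -[_ *+ k.+1]mulr_natr -mulrA; congr (_ * _).
by rewrite factS natrM invfM mulrAC mulVf ?mul1r // pnatr_eq0.
Qed.

Lemma taylor_cos_sin n x :
  `|cos x - (eexp_re n).[x]| <= `|x| ^+ n / n`!%:R /\
  `|sin x - (eexp_im n).[x]| <= `|x| ^+ n / n`!%:R.
Proof.
elim: n x => [|n IH] x.
  rewrite /eexp_re /eexp_im !poly_def !big_ord0 !horner0 !subr0 expr0 divr1.
  by split; [exact: cos_max|exact: sin_max].
have at0 (a : nat -> R) : (\poly_(p < n.+1) (a p / p`!%:R)).[0] = a 0%N.
  by rewrite horner_coef0 coef_poly divr1.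
split.
- apply: (@growth (cos - horner (eexp_re n.+1))
     (fun t => - sin t - (eexp_re n.+1)^`().[t])).
  + by rewrite !fctE cos0 /eexp_re at0 /re_i /= expr0 subrr.
  + move=> t; rewrite /eexp_re deriv_egf.
    have -> : \poly_(p < n) (re_i p.+1 / p`!%:R) = - eexp_im n.
      apply/polyP => k; rewrite coefN !coef_poly re_iS mulNr.
      by case: ltnP; rewrite ?oppr0.
    by rewrite hornerN -opprD normrN; exact: (IH t).2.
- apply: (@growth (sin - horner (eexp_im n.+1))
     (fun t => cos t - (eexp_im n.+1)^`().[t])).
  + by rewrite !fctE sin0 /eexp_im at0 /im_i /= subrr.
  + move=> t; rewrite /eexp_im deriv_egf.
    have -> : \poly_(p < n) (im_i p.+1 / p`!%:R) = eexp_re n.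
      by apply/polyP => k; rewrite !coef_poly im_iS.
    exact: (IH t).1.
Qed.

Lemma normr_sin_le x : `|sin x| <= `|x|.
Proof.
have [_] := taylor_cos_sin 1 x.
by rewrite horner_poly big_ord_recl big_ord0 /im_i /= !mul0r addr0 subr0 expr1 divr1.
Qed.

Lemma normr_id_sub_sin x : `|x - sin x| <= x ^+ 2 / 2.
Proof.
have [_] := taylor_cos_sin 2 x.
rewrite horner_poly !big_ord_recl big_ord0 /im_i /= !mul0r add0r addr0 expr0.
by rewrite divr1 mul1r expr1 distrC real_normK ?num_real.
Qed.

Lemma normr_id_sub_sin3 x : `|x - sin x| <= `|x| ^+ 3 / 6.
Proof.
have [_] := taylor_cos_sin 3 x.
rewrite horner_poly !big_ord_recl big_ord0 /im_i /= !mul0r add0r !addr0 expr0.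
by rewrite divr1 mul1r expr1 distrC.
Qed.

(** A weak Jordan inequality, which the Taylor bound gives since pi / 2 <= 2. *)
Lemma sin_ge_third x : 0 <= x <= pi / 2 -> x / 3 <= sin x.
Proof.
move=> /andP[x0 xpi]; have x2 : x <= 2 by apply: (le_trans xpi); exact/ltW/pihalf_lt2.
have := normr_id_sub_sin3 x; rewrite (ger0_norm x0).
move=> /(le_trans (ler_norm _)) H; nra.
Qed.
End taylor.

(** * A projection matrix on the discrete circle *)

Section circulant.
Variable R : realType.
Implicit Types (M q : nat) (u x th : R).

Lemma sum_cos_telescope M th x :
  (\sum_(b < M) cos (th + b%:R * x)) * (2 * sin (x / 2)) =
  sin (th + (M%:R - 1 / 2) * x) - sin (th - x / 2).
Proof.
elim: M => [|M IH].
  rewrite big_ord0 mul0r; apply/esym/eqP; rewrite subr_eq0; apply/eqP.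
  by congr sin; ring.
rewrite big_ord_recr /= mulrDl IH.
have -> : th + (M.+1%:R - 1 / 2) * x = (th + M%:R * x) + x / 2.
  by rewrite -natr1; field.
have -> : th + (M%:R - 1 / 2) * x = (th + M%:R * x) - x / 2 by field.
rewrite (sinB (th + M%:R * x) (x / 2)) (sinD (th + _)); ring.
Qed.

Lemma sin_periodn (a : R) n : sin (a + n%:R * (2 * pi)) = sin a.
Proof.
by rewrite mulr_natl [2 * pi]mulr_natl; exact: periodicn (@sinD2pi R) n a.
Qed.

(** Orthogonality of distinct characters of Z/M. *)
Lemma sum_cos_period M (j k : nat) th : (j < M)%N -> (k < M)%N -> j != k ->
  \sum_(b < M) cos (th + b%:R * (2 * pi * (j%:R - k%:R) / M%:R)) = 0 :> R.
Proof.
move=> jM kM jk; set x := 2 * pi * _ / _.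
have M0 : M%:R != 0 :> R by rewrite pnatr_eq0; case: M jM {kM x}.
have Mp : 0 < M%:R :> R by rewrite lt0r M0 ler0n.
apply/eqP; have := sum_cos_telescope M th x.
have -> : sin (th + (M%:R - 1 / 2) * x) = sin (th - x / 2).
  rewrite -(sin_periodn (th + _) k) -[in RHS](sin_periodn (th - _) j).
  congr sin; rewrite /x; field.
  exact: M0.
rewrite subrr => /eqP; rewrite mulf_eq0 => /orP[//|].
rewrite mulf_eq0 pnatr_eq0 /= => /eqP s0; exfalso.
have sin_nz (a b : nat) : (a < b)%N -> (b < M)%N ->
    sin (pi * (b%:R - a%:R) / M%:R) != 0 :> R.
  move=> ab bM; apply/lt0r_neq0/sin_gt0_pi.
  have ba : 0 < b%:R - a%:R :> R by rewrite subr_gt0 ltr_nat.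
  rewrite divr_gt0 ?mulr_gt0 ?pi_gt0 //= ltr_pdivrMr // ltr_pM2l ?pi_gt0 //.
  rewrite ltrBlDr (lt_le_trans (_ : _ < M%:R)) ?ltr_nat //.
  by rewrite lerDl.
have xE : x / 2 = pi * (j%:R - k%:R) / M%:R by rewrite /x; field.
case: (ltngtP j k) jk => // [lt|lt] _.
- have := sin_nz _ _ lt kM.
  have <- : - (x / 2) = pi * (k%:R - j%:R) / M%:R by rewrite xE; field.
  by rewrite sinN s0 oppr0 eqxx.
- by have := sin_nz _ _ lt jM; rewrite -xE s0 eqxx.
Qed.

Definition freq M q (k : nat) : R := 2 * pi * (k%:R - q%:R) / M%:R.

(** Kernel of the projection of the functions on Z/M onto the characters of
    frequency between -q and q. *)
Definition dirichlet M q u : R :=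
  M%:R^-1 * \sum_(k < q.*2.+1) cos (freq M q k * u).

Definition circle_mx M q : 'M[R]_M := \matrix_(a, b) dirichlet M q (a%:R - b%:R).

Lemma dirichletN M q u : dirichlet M q (- u) = dirichlet M q u.
Proof. by congr (_ * _); apply: eq_bigr => k _; rewrite mulrN cosN. Qed.

Lemma circle_mx_tr M q : (circle_mx M q)^T = circle_mx M q.
Proof. by apply/matrixP => a b; rewrite !mxE -dirichletN opprB. Qed.

(** A product of two cosines is half the sum of two characters, which the
    reflection k -> 2 q - k of the frequencies exchanges; orthogonality then keeps
    the diagonal terms only. The 2 q + 1 frequencies are distinct modulo M. *)
Lemma circle_mx_idem M q : (q.*2.+1 <= M)%N ->
  circle_mx M q *m circle_mx M q = circle_mx M q.
Proof.
move=> qM.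
have M0 : M%:R != 0 :> R by rewrite pnatr_eq0; case: M qM.
apply/matrixP => a c; rewrite !mxE /dirichlet.
pose f k := freq M q k.
pose E j k := \sum_(b < M) cos (f j * (a%:R - b%:R)) * cos (f k * (b%:R - c%:R)).
transitivity (M%:R ^- 2 * \sum_(j < q.*2.+1) \sum_(k < q.*2.+1) E j k).
  rewrite /E; under [in RHS]eq_bigr => j _ do rewrite exchange_big /=.
  rewrite [in RHS]exchange_big /= mulr_sumr; apply: eq_bigr => b _.
  rewrite !mxE /dirichlet mulrACA -invfM expr2 big_distrlr /=; congr (_ * _).
suff ortho (j : 'I_(q.*2.+1)) :
    \sum_(k < q.*2.+1) E j k = M%:R * cos (f j * (a%:R - c%:R)).
  under eq_bigr => j _ do rewrite ortho.
  rewrite -mulr_sumr mulrA; congr (_ * _); rewrite expr2; field.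
  exact: M0.
pose G (k : nat) := \sum_(b < M)
  cos (f j * a%:R - f k * c%:R + b%:R * (2 * pi * (k%:R - j%:R) / M%:R)).
pose H (k : nat) := \sum_(b < M)
  cos (f j * a%:R + f k * c%:R - b%:R * (f j + f k)).
have EGH (k : nat) : E j k = 2^-1 * (G k + H k).
  rewrite /E /G /H -big_split mulr_sumr; apply: eq_bigr => b _ /=.
  have -> : f j * a%:R - f k * c%:R + b%:R * (2 * pi * (k%:R - j%:R) / M%:R) =
      f j * (a%:R - b%:R) + f k * (b%:R - c%:R).
    by rewrite /f /freq; field; exact: M0.
  have -> : f j * a%:R + f k * c%:R - b%:R * (f j + f k) =
      f j * (a%:R - b%:R) - f k * (b%:R - c%:R) by ring.
  by rewrite cosD cosB; field.
have HG (k : 'I_(q.*2.+1)) : H (rev_ord k) = G k.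
  apply: eq_bigr => b _; congr cos.
  have -> : f (rev_ord k) = - f k.
    rewrite /f /freq /= subSS natrB; last by rewrite -ltnS.
    have -> : q.*2%:R = q%:R + q%:R :> R by rewrite -addnn natrD.
    by field; exact: M0.
  by rewrite /f /freq; field; exact: M0.
transitivity (\sum_(k < q.*2.+1) G k).
  under eq_bigr => k _ do rewrite EGH.
  rewrite -mulr_sumr big_split /=.
  rewrite [X in _ + X](reindex_inj rev_ord_inj) /=.
  under [X in _ + X]eq_bigr => k _ do rewrite HG.
  by field.
rewrite (bigD1 j) //= [X in _ + X]big1 ?addr0; last first.
  move=> k kj; apply: sum_cos_period.
  - exact: leq_trans (ltn_ord k) qM.
  - exact: leq_trans (ltn_ord j) qM.
  - by [].
rewrite /G; under eq_bigr => b _ do rewrite subrr mulr0 mul0r mulr0 addr0.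
by rewrite sumr_const card_ord mulrBr mulr_natl.
Qed.
End circulant.

(** * Comparison of the Dirichlet and sine kernels *)

Section kernel_approximation.
Variable R : realType.
Implicit Types (M q : nat) (u v x y h : R).

Lemma sine_kernelE x y : sine_kernel x y = sine_kernel (x - y) 0.
Proof. by rewrite /sine_kernel subr_eq0 subr0. Qed.

Lemma normr_cos_sub x y : `|cos x - cos y| <= `|x - y|.
Proof.
have -> : cos x - cos y = - 2 * (sin ((x - y) / 2) * sin ((x + y) / 2)).
  have -> : cos x = cos ((x + y) / 2 + (x - y) / 2) by congr cos; field.
  have -> : cos y = cos ((x + y) / 2 - (x - y) / 2) by congr cos; field.
  rewrite cosD cosB; ring.
rewrite normrM normrN normrM (ger0_norm (_ : 0 <= 2)) //.
have := normr_sin_le ((x - y) / 2).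
rewrite normrM (ger0_norm (_ : 0 <= 2^-1)) // => A.
have B := sin_max ((x + y) / 2).
have := normr_ge0 (sin ((x - y) / 2)); have := normr_ge0 (sin ((x + y) / 2)).
move: A B; move: `|sin _| `|sin _| `|x - y| => a b c; nra.
Qed.

Lemma normr_sin_sub x y : `|sin x - sin y| <= `|x - y|.
Proof.
rewrite -[sin x]cosBpihalf -[sin y]cosBpihalf; apply: le_trans (normr_cos_sub _ _) _.
by rewrite opprB addrA subrK.
Qed.

Lemma sine_kernel_le v : `|sine_kernel v 0| <= pi^-1.
Proof.
rewrite /sine_kernel subr0; case: eqP => [_|/eqP v0].
  by rewrite ger0_norm // invr_ge0 pi_ge0.
rewrite normrM normfV normrM (ger0_norm (pi_ge0 R)) invfM mulrCA.
rewrite ler_piMr ?invr_ge0 ?pi_ge0 // ler_pdivrMr ?normr_gt0 // mul1r.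
exact: normr_sin_le.
Qed.

Lemma dirichlet_sum_le M q u :
  `|\sum_(k < q.*2.+1) cos (freq R M q k * u)| <= q.*2.+1%:R.
Proof.
apply: le_trans (ler_norm_sum _ _ _) _.
rewrite -[leRHS]mulr1 -[X in _ <= X%:R * _]card_ord mulr_natl -sumr_const.
by apply: ler_sum => k _; exact: cos_max.
Qed.

Lemma dirichlet_closed M q u : (0 < M)%N ->
  (\sum_(k < q.*2.+1) cos (freq R M q k * u)) * (2 * sin (pi * u / M%:R)) =
  2 * sin (q.*2.+1%:R * pi * u / M%:R).
Proof.
move=> M0; have Mn : M%:R != 0 :> R by rewrite pnatr_eq0 -lt0n.
pose x := 2 * pi * u / M%:R.
have := sum_cos_telescope q.*2.+1 (- (q%:R * x)) x.
have q2 : q.*2.+1%:R = q%:R + q%:R + 1 :> R by rewrite -addnn -natr1 natrD.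
have -> : x / 2 = pi * u / M%:R by rewrite /x; field.
under eq_bigr => k _.
  have -> : - (q%:R * x) + k%:R * x = freq R M q k * u by rewrite /x /freq; field.
  over.
move=> ->; rewrite [RHS]mulr_natl mulr2n q2.
have -> : - (q%:R * x) - pi * u / M%:R = - ((q%:R + q%:R + 1) * pi * u / M%:R).
  by rewrite /x; field.
rewrite sinN opprK; congr (_ + _); congr sin; rewrite /x; field.
exact: Mn.
Qed.

(** With t = pi u / M the closed form reads S sin t = sin (alpha h u), where S is
    the sum of cosines. The first error is the price of replacing sin t by t, the
    second that of replacing alpha by 1. *)
Lemma dirichlet_approx M q h u alpha : (0 < M)%N -> 0 < h ->
  alpha = q.*2.+1%:R * pi / (M%:R * h) ->
  `|dirichlet M q u / h - sine_kernel (h * u) 0| <=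
  alpha * `|h * u| / (2 * (M%:R * h)) + `|alpha - 1| / pi.
Proof.
move=> M0 h0 alphaE.
have Mn : M%:R != 0 :> R by rewrite pnatr_eq0 -lt0n.
have Mp : 0 < M%:R :> R by rewrite ltr0n.
have hn : h != 0 by rewrite gt_eqF.
have pin : pi != 0 :> R by rewrite gt_eqF ?pi_gt0.
have al0 : 0 <= alpha by rewrite alphaE divr_ge0 ?mulr_ge0 ?pi_ge0 ?ler0n ?ltW.
have [->|u0] := eqVneq u 0.
  rewrite mulr0 normr0 mulr0 mul0r add0r /sine_kernel eqxx /dirichlet.
  under eq_bigr => k _ do rewrite mulr0 cos0.
  rewrite sumr_const card_ord.
  have -> : M%:R^-1 * q.*2.+1%:R / h - pi^-1 = (alpha - 1) / pi.
    by rewrite alphaE; move: (pi : R) pin => p pn; field; rewrite pn hn Mn.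
  by rewrite normrM normfV (ger0_norm (pi_ge0 R)).
have hu0 : h * u != 0 by rewrite mulf_neq0.
rewrite /sine_kernel (negbTE hu0) subr0 /dirichlet.
have := dirichlet_closed q u M0; have := dirichlet_sum_le M q u.
set S := \sum_(k < _) _ => Sle SE.
pose t := pi * u / M%:R.
have tn : t != 0 by rewrite /t !mulf_neq0 ?invr_eq0.
have aE : q.*2.+1%:R * pi * u / M%:R = alpha * (h * u).
  by rewrite alphaE; field; rewrite ?Mn ?hn ?pin.
rewrite aE -/t in SE.
have -> : M%:R^-1 * S / h - sin (h * u) / (pi * (h * u)) =
    S * (t - sin t) / (pi * (h * u)) +
    (sin (alpha * (h * u)) - sin (h * u)) / (pi * (h * u)).
  rewrite -mulrDl; have -> : S * (t - sin t) + (sin (alpha * (h * u)) - sin (h * u)) =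
     S * t - sin (h * u).
    have -> : sin (alpha * (h * u)) = S * sin t.
      apply: (mulfI (_ : 2 != 0 :> R)); rewrite ?pnatr_eq0 // -SE; ring.
    ring.
  by rewrite /t; move: (pi : R) pin => p pn; field; rewrite pn hn u0 Mn.
apply: le_trans (ler_normD _ _) _; apply: lerD.
  rewrite !normrM normfV normrM (ger0_norm (pi_ge0 R)).
  rewrite ler_pdivrMr ?mulr_gt0 ?pi_gt0 ?normr_gt0 //.
  apply: le_trans (ler_pM _ _ Sle (normr_id_sub_sin t)) _ => //.
  rewrite le_eqVlt; apply/orP; left; apply/eqP.
  rewrite -[t ^+ 2]real_normK ?num_real // /t !normrM normfV.
  rewrite (ger0_norm (pi_ge0 R)) (ger0_norm (ltW h0)) (ger0_norm (ltW Mp)).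
  rewrite alphaE; field; exact/andP.
rewrite normrM normfV normrM (ger0_norm (pi_ge0 R)) invfM mulrCA mulrC.
rewrite ler_wpM2r ?invr_ge0 ?pi_ge0 // ler_pdivrMr ?normr_gt0 //.
apply: le_trans (normr_sin_sub _ _) _.
by rewrite -[in X in _ - X](mul1r (h * u)) -mulrBl normrM.
Qed.

Lemma dirichlet_le M q u : `|dirichlet M q u| <= q.*2.+1%:R / M%:R :> R.
Proof.
rewrite /dirichlet normrM normfV (ger0_norm (ler0n R M)) mulrC ler_wpM2r ?invr_ge0 //.
exact: dirichlet_sum_le.
Qed.

(** Up to half a period the denominator sin t of the closed form is at least
    t / 3. *)
Lemma dirichlet_decay M q (d : nat) : (0 < d)%N -> (d.*2 <= M)%N ->
  dirichlet M q d%:R ^+ 2 <= 3 / d%:R ^+ 2 :> R.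
Proof.
move=> d0 dM; have M0 : (0 < M)%N by apply: leq_trans dM; rewrite double_gt0.
have Mp : 0 < M%:R :> R by rewrite ltr0n.
have dp : 0 < d%:R :> R by rewrite ltr0n.
have pip := pi_gt0 R.
pose t : R := pi * d%:R / M%:R.
have t0 : 0 < t by rewrite /t divr_gt0 ?mulr_gt0.
have tpi : t <= pi / 2.
  rewrite /t ler_pdivrMr // -mulrA ler_pM2l // mulrC ler_pdivlMr //.
  by rewrite -natrM ler_nat muln2.
have st : t / 3 <= sin t by apply: sin_ge_third; rewrite (ltW t0) tpi.
have := dirichlet_closed q d%:R M0; rewrite -/t.
set S := \sum_(k < _) _ => SE; pose s : R := sin (q.*2.+1%:R * pi * d%:R / M%:R).
have SE' : S * sin t = s by apply: (mulfI (_ : 2 != 0 :> R)) => //; rewrite /s -SE; ring.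
have s1 : s ^+ 2 <= 1 by rewrite sin2cos2 lerBlDr lerDl sqr_ge0.
have sp : 0 < sin t by apply: lt_le_trans st; rewrite divr_gt0.
have S1 : S ^+ 2 * (t / 3) ^+ 2 <= 1.
  apply: le_trans s1; rewrite -SE' [(S * _) ^+ 2]exprMn ler_wpM2l ?sqr_ge0 //.
  have t3 : 0 <= t / 3 by apply: divr_ge0 => //; exact: ltW.
  by apply: lerXn2r; rewrite ?nnegrE ?st ?(ltW sp) ?t3.
rewrite /dirichlet -/S exprMn ler_pdivlMr ?exprn_gt0 //.
have -> : M%:R^-1 ^+ 2 * S ^+ 2 * d%:R ^+ 2 = (S ^+ 2 * (t / 3) ^+ 2) * (9 / pi ^+ 2).
  by rewrite /t; move: (pi : R) pip => p pp; field; rewrite !gt_eqF.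
have pi4 : 9 / pi ^+ 2 <= 3 :> R.
  rewrite ler_pdivrMr ?exprn_gt0 //.
  have := @pi_ge2 R; nra.
have : 0 <= 9 / pi ^+ 2 :> R by rewrite divr_ge0 ?sqr_ge0.
have : 0 <= S ^+ 2 * (t / 3) ^+ 2 by rewrite mulr_ge0 ?sqr_ge0.
move: S1 pi4; set A := S ^+ 2 * _; set B := 9 / _; nra.
Qed.
End kernel_approximation.

(** * The grid approximating an interval *)

Section kernel_uniform.
Variable R : realType.
Implicit Types (X v w : R) (n : nat).

Lemma le_of_inv_nat (a b c : R) (N0 : nat) :
  (forall n, (N0 < n)%N -> a <= b + c / n%:R) -> a <= b.
Proof.
move=> H; rewrite leNgt; apply/negP => ba.
pose n := (N0 + Num.truncn (`|c| / (a - b))).+1.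
have ab : 0 < a - b by rewrite subr_gt0.
have n0 : 0 < n%:R :> R by rewrite ltr0n.
have cn : `|c| / (a - b) < n%:R.
  have /andP[_ lt] := truncn_itv (divr_ge0 (normr_ge0 c) (ltW ab)).
  by apply: lt_le_trans lt _; rewrite ler_nat /n ltnS leq_addl.
have := H n; rewrite ltnS leq_addr => /(_ isT); apply/negP; rewrite -ltNge.
rewrite -ltrBrDl ltr_pdivrMr // mulrC -ltr_pdivrMr //.
by apply: le_lt_trans cn; rewrite ler_pM2r ?invr_gt0 // ler_norm.
Qed.

(** The number M of points of the circle. With steps h = X / n, the 2 n + 1
    frequencies give the density (2 n + 1) / (M h) of particles, which should be
    the density 1 / pi of the sine process; the exact solution is rounded down. *)
Definition grid_size X n : nat := Num.truncn (n.*2.+1%:R * pi * n%:R / X).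

Lemma grid_size_itv X n : 0 < X ->
  (grid_size X n)%:R <= n.*2.+1%:R * pi * n%:R / X < (grid_size X n).+1%:R.
Proof.
move=> X0; apply: truncn_itv.
by rewrite divr_ge0 ?(ltW X0) // !mulr_ge0 ?ler0n ?pi_ge0.
Qed.

Section grid.
Variables (X : R) (n : nat).
Hypotheses (X0 : 0 < X) (Xn : X <= n%:R).
Let h := X / n%:R.
Let M := grid_size X n.

Let np : 0 < n%:R :> R. Proof. exact: lt_le_trans X0 Xn. Qed.
Let hp : 0 < h. Proof. by rewrite divr_gt0. Qed.
Let h1 : h <= 1. Proof. by rewrite ler_pdivrMr // mul1r. Qed.
Let yE : n.*2.+1%:R * pi * n%:R / X = n.*2.+1%:R * pi / h.
Proof. by rewrite /h; field; rewrite !gt_eqF. Qed.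

Lemma grid_size_ge : (n.*2.+1 <= M)%N.
Proof.
have /andP[_ lt] := grid_size_itv n X0.
rewrite -ltnS -(ltr_nat R); apply: le_lt_trans lt.
rewrite yE ler_pdivlMr // ler_pM2l ?ltr0n //.
by apply: le_trans h1 (le_trans _ (pi_ge2 R)); rewrite ler1n.
Qed.

Let Mp : 0 < M%:R :> R.
Proof. by rewrite ltr0n; apply: leq_trans grid_size_ge. Qed.

(** The density of the grid process relative to 1 / pi. *)
Definition grid_alpha := n.*2.+1%:R * pi / (M%:R * h).

Lemma grid_alpha_itv : 1 <= grid_alpha <= 1 + n%:R^-1.
Proof.
have /andP[le lt] := grid_size_itv n X0; rewrite -/M yE in le lt.
have aE : grid_alpha = (n.*2.+1%:R * pi / h) / M%:R.
  by rewrite /grid_alpha; field; rewrite !gt_eqF.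
rewrite aE ler_pdivlMr // mul1r le /=.
rewrite ler_pdivrMr //; apply: (le_trans (ltW lt)); rewrite mulrDl mul1r -(natr1 M).
rewrite lerD2l mulrC ler_pdivlMr // mul1r ler_nat.
by apply: leq_trans grid_size_ge; rewrite -addnn leqW // leq_addr.
Qed.

(** The circle becomes infinitely longer than the interval, so that the
    periodicity of the Dirichlet kernel is not felt in the limit. *)
Lemma circumference_ge : n%:R <= M%:R * h.
Proof.
have /andP[_ lt] := grid_size_itv n X0; rewrite -/M yE in lt.
move: lt; rewrite ltr_pdivrMr // -(natr1 M) mulrDl mul1r => lt.
have := pi_ge2 R; have : n.*2.+1%:R = n%:R + n%:R + 1 :> R.
  by rewrite -addnn -natr1 natrD.
move=> n2 pi2; move: lt; rewrite n2 => lt.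
have : (n%:R + n%:R + 1) * 2 <= (n%:R + n%:R + 1) * pi :> R.
  by rewrite ler_wpM2l // !addr_ge0 ?ler0n.
by have := np; have := h1; move: lt; lra.
Qed.

Let alpha2 : grid_alpha <= 2.
Proof.
have /andP[_ a] := grid_alpha_itv; apply: le_trans a _.
have : n%:R^-1 <= 1 :> R by rewrite invf_le1 // ler1n -(ltr0n R).
by lra.
Qed.

Lemma kernel_approx u : `|h * u| <= X ->
  `|dirichlet M n u / h - sine_kernel (h * u) 0| <= (X + 1) / n%:R.
Proof.
move=> uX; have /andP[a1 an] := grid_alpha_itv.
have M0 : (0 < M)%N by rewrite -(ltr0n R).
apply: (le_trans (dirichlet_approx u M0 hp (erefl grid_alpha))).
have Lp : 0 < M%:R * h by rewrite mulr_gt0.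
rewrite [leRHS]mulrDl; apply: lerD.
  rewrite ler_pdivrMr ?mulr_gt0 ?invr_gt0 //.
  apply: (@le_trans _ _ (2 * X)).
    by apply: ler_pM => //; apply: le_trans a1.
  rewrite [leRHS](_ : _ = 2 * X * (M%:R * h / n%:R)); last by ring.
  rewrite ler_peMr ?mulr_ge0 ?(ltW X0) // ler_pdivlMr ?mul1r ?circumference_ge ?invr_gt0 //.
rewrite ger0_norm ?subr_ge0 // mul1r ler_pdivrMr ?pi_gt0 //.
apply: (@le_trans _ _ n%:R^-1); first by rewrite lerBlDl.
rewrite ler_peMr ?invr_ge0 ?ler0n //.
by apply: le_trans (pi_ge2 R); rewrite ler1n.
Qed.

Lemma grid_kernel_le u : `|dirichlet M n u / h| <= 1.
Proof.
have M0 : (0 < M)%N by rewrite -(ltr0n R).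
rewrite normrM normfV (gtr0_norm hp) ler_pdivrMr // mul1r.
apply: le_trans (dirichlet_le _ _ _) _.
have -> : n.*2.+1%:R / M%:R = grid_alpha * h / pi.
  rewrite /grid_alpha; move: (pi : R) (pi_gt0 R) => p pp; field.
  by rewrite !gt_eqF.
rewrite ler_pdivrMr ?pi_gt0 // mulrC ler_pM2l //.
exact: le_trans alpha2 (pi_ge2 R).
Qed.

Lemma grid_kernel_lipschitz u v :
  `|dirichlet M n (u / h) / h - dirichlet M n (v / h) / h| <= 2 * `|u - v|.
Proof.
have M0 : (0 < M)%N by rewrite -(ltr0n R).
rewrite -mulrBl -mulrBr -sumrB normrM normrM !normfV (gtr0_norm hp) (gtr0_norm Mp).
pose c : R := 2 * pi * n%:R / (M%:R * h).
have Lp : 0 < M%:R * h by exact: mulr_gt0.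
have c0 : 0 <= c.
  by apply: divr_ge0; [rewrite !mulr_ge0 ?pi_ge0 ?ler0n|exact: ltW].
apply: (@le_trans _ _ (M%:R^-1 * (n.*2.+1%:R * (c * `|u - v|)) / h)).
  rewrite ler_pM2r ?invr_gt0 // ler_pM2l ?invr_gt0 //.
  apply: le_trans (ler_norm_sum _ _ _) _.
  rewrite [leRHS]mulr_natl -[X in _ *+ X](card_ord n.*2.+1) -sumr_const.
  apply: ler_sum => k _; apply: le_trans (normr_cos_sub _ _) _.
  rewrite -mulrBr -mulrBl normrM /freq !normrM !normfV.
  rewrite (gtr0_norm hp) (gtr0_norm Mp) (ger0_norm (pi_ge0 R)) (ger0_norm (_ : 0 <= 2)) //.
  have kn : `|k%:R - n%:R| <= n%:R :> R.
    rewrite ler_norml lerBlDr lerBrDl subrr ler0n /= -natrD ler_nat addnn.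
    by rewrite -ltnS.
  rewrite [leLHS](_ : _ = `|k%:R - n%:R| * (2 * pi / (M%:R * h) * `|u - v|)); last first.
    by field; rewrite !gt_eqF.
  rewrite [leRHS](_ : _ = n%:R * (2 * pi / (M%:R * h) * `|u - v|)); last first.
    by rewrite /c; ring.
  rewrite ler_wpM2r // mulr_ge0 // divr_ge0 ?mulr_ge0 ?pi_ge0 //; exact: ltW.
rewrite [leLHS](_ : _ = n.*2.+1%:R * c / h / M%:R * `|u - v|); last by ring.
rewrite ler_wpM2r //.
have /andP[a1 _] := grid_alpha_itv.
have -> : n.*2.+1%:R * c / h / M%:R = grid_alpha * (2 * n%:R / (M%:R * h)).
  by rewrite /grid_alpha /c; field; rewrite !gt_eqF.
have le : 2 * n%:R / (M%:R * h) <= grid_alpha / 2.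
  rewrite /grid_alpha ler_pdivlMr // mulrAC ler_pM2r ?invr_gt0 ?Lp //.
  have := pi_ge2 R; have -> : n.*2.+1%:R = n%:R + n%:R + 1 :> R.
    by rewrite -addnn -natr1 natrD.
  by have := np; nra.
have : 0 <= 2 * n%:R / (M%:R * h).
  by apply: divr_ge0; [rewrite mulr_ge0 ?ler0n|exact: ltW].
move=> z0; apply: (@le_trans _ _ (2 * (grid_alpha / 2))).
  by apply: ler_pM => //; apply: le_trans a1.
by rewrite mulrCA divff ?mulr1 // pnatr_eq0.
Qed.
End grid.

(** Inherited from the trigonometric polynomials that approximate it, which
    avoids differentiating sin x / x at 0. *)
Lemma sine_kernel_lipschitz v w :
  `|sine_kernel v 0 - sine_kernel w 0| <= 2 * `|v - w|.
Proof.
pose X : R := 1 + `|v| + `|w|.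
have X0 : 0 < X by rewrite ltr_wpDr ?ltr_pwDl.
apply: (@le_of_inv_nat _ _ (2 * (X + 1)) (Num.truncn X)) => n Xn.
have {}Xn : X <= n%:R.
  have /andP[_ lt] := truncn_itv (ltW X0).
  by apply: le_trans (ltW lt) _; rewrite ler_nat.
have np : 0 < n%:R :> R by exact: lt_le_trans X0 Xn.
pose h := X / n%:R; have hp : 0 < h by rewrite divr_gt0.
have hK u : h * (u / h) = u by rewrite mulrC divfK // gt_eqF.
have vX : `|h * (v / h)| <= X.
  by rewrite hK /X -addrA addrCA lerDl addr_ge0.
have wX : `|h * (w / h)| <= X.
  by rewrite hK /X lerDr addr_ge0.
have := kernel_approx X0 Xn vX; have := kernel_approx X0 Xn wX.
have := grid_kernel_lipschitz X0 Xn v w.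
rewrite -/h !hK; move: (dirichlet _ _ _ / h) (dirichlet _ _ _ / h) => a b.
rewrite -mulrA; move: (_ / n%:R) (sine_kernel _ _) (sine_kernel _ _) => c s t.
by move=> H1 H2 H3; rewrite !ler_norml in H1 H2 H3 *; lra.
Qed.
End kernel_uniform.

(** * Variance of the grid statistic *)

Section variance.
Variable R : realType.

Lemma cumul1_sum m (phi : 'rV[R]_m) (D : 'M[R]_m) :
  cumul phi D 1 =
  \sum_a phi 0 a ^+ 2 * D a a - \sum_a \sum_b phi 0 a * phi 0 b * (D a b * D b a).
Proof.
rewrite /cumul /= big_cons big_nil addr0 /= mul1r mulmx1.
rewrite mulmxBr mulmx1 mulmxBl raddfB /=; congr (_ - _).
  by apply: eq_bigr => a _; rewrite !mul_diag_mx !mxE mulrA -expr2.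
apply: eq_bigr => a _; rewrite mxE; apply: eq_bigr => b _.
by rewrite !mul_diag_mx !mxE; ring.
Qed.

Lemma sum_symmetric (G : nat -> nat -> R) m : (forall a b, G a b = G b a) ->
  \sum_(0 <= a < m) \sum_(0 <= b < m) G a b =
  \sum_(0 <= a < m) G a a +
  2 * \sum_(1 <= d < m) \sum_(0 <= a < m - d) G a (a + d)%N.
Proof.
move=> Gs; elim: m => [|m IH].
  by rewrite !big_geq // mulr0 addr0.
rewrite big_nat_recr //= [\sum_(0 <= b < m.+1) G m b]big_nat_recr //=.
under eq_bigr => a _ do rewrite big_nat_recr //=.
rewrite big_split /= IH [\sum_(0 <= a < m.+1) _]big_nat_recr //=.
under [X in _ + (X + _)]eq_bigr => a _ do rewrite Gs.
suff -> : \sum_(1 <= d < m.+1) \sum_(0 <= a < m.+1 - d) G a (a + d)%N =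
   \sum_(1 <= d < m) \sum_(0 <= a < m - d) G a (a + d)%N + \sum_(0 <= a < m) G a m.
  ring.
transitivity (\sum_(1 <= d < m.+1)
    (\sum_(0 <= a < m - d) G a (a + d)%N + G (m - d)%N m)).
  apply: eq_big_nat => d /andP[d1 dm]; rewrite subSn // big_nat_recr //=.
  by rewrite subnK.
rewrite big_split /=; congr (_ + _).
  case: m {IH} => [|m]; first by rewrite !big_geq.
  by rewrite [LHS]big_nat_recr //= subnn [X in _ + X]big_geq ?addr0.
by rewrite big_add1 /= [RHS]big_nat_rev /=; apply: eq_bigr => a _; rewrite add0n.
Qed.

Lemma ler_sum_telescope m n (u f : nat -> R) : (m <= n)%N ->
  (forall k, (m <= k < n)%N -> u k <= f k.+1 - f k) ->
  \sum_(m <= k < n) u k <= f n - f m.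
Proof. by move=> mn H; rewrite -telescope_sumr //; exact: ler_sum_nat. Qed.

Lemma sum_inv_sqr_le m n : (0 < m)%N ->
  \sum_(m <= d < n) (d%:R ^+ 2)^-1 <= 2 / m%:R :> R.
Proof.
move=> m0; have [nm|mn] := leqP n m.
  by rewrite big_geq // divr_ge0 ?ler0n.
apply: (@le_trans _ _ (- 2 / n%:R - - 2 / m%:R)).
  apply: (@ler_sum_telescope m n _ (fun d => - 2 / d%:R)); first exact: ltnW.
  move=> k /andP[mk _]; have k0 : 0 < k%:R :> R by rewrite ltr0n (leq_trans m0).
  have k1 : 1 <= k%:R :> R by rewrite ler1n (leq_trans m0).
  have kS : 0 < k.+1%:R :> R by rewrite ltr0n.
  rewrite -subr_ge0.
  have -> : - 2 / k.+1%:R - - 2 / k%:R - (k%:R ^+ 2)^-1 =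
      (k%:R - 1) / (k%:R ^+ 2 * k.+1%:R) :> R.
    rewrite -natr1 in kS *; field.
    by rewrite !gt_eqF.
  by rewrite divr_ge0 ?subr_ge0 // mulr_ge0 ?sqr_ge0 ?ltW.
by rewrite !mulNr opprK gerDr oppr_le0 divr_ge0 ?ler0n.
Qed.

Lemma sum_weights m d :
  \sum_(0 <= a < m) ((m + d - a)%:R * (m - a)%:R) =
  m%:R * (m%:R + 1) * (2 * m%:R + 3 * d%:R + 1) / 6 :> R.
Proof.
elim: m => [|m IH]; first by rewrite big_geq // !mul0r.
rewrite big_nat_recl // !subn0.
under eq_bigr => a _ do rewrite addSn !subSS.
have -> : (m.+1 + d)%:R = m%:R + 1 + d%:R :> R.
  by rewrite natrD -natr1.
have -> : m.+1%:R = m%:R + 1 :> R by rewrite -natr1.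
by rewrite IH; field.
Qed.
End variance.

Section grid_variance.
Variable R : realType.

(** The function 1 - x / X sampled at the left ends of the n cells of [0, X]; the
    truncated subtraction makes it 0 on the rest of the circle. *)
Definition weights M n : 'rV[R]_M := \row_a ((n - a)%:R / n%:R).

Let F n a : R := (n - a)%:R / n%:R.

(** Closed form of the autocorrelation of [weights] at distance d. *)
Definition weights_corr n d : R :=
  (n%:R - d%:R) * (n%:R - d%:R + 1) * (2 * n%:R + d%:R + 1) / (6 * n%:R ^+ 2).

Lemma weights_correlation M n d : (n <= M)%N -> (d <= n)%N -> (0 < n)%N ->
  \sum_(0 <= a < M - d) F n a * F n (a + d)%N = weights_corr n d.
Proof.
move=> nM dn n0; have nn : n%:R != 0 :> R by rewrite pnatr_eq0 -lt0n.
rewrite (big_cat_nat (leq0n (n - d)) (leq_sub2r d nM)) /=.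
rewrite [X in _ + X]big_nat_cond [X in _ + X]big1 ?addr0; last first.
  move=> a; rewrite andbT => /andP[na _].
  have : (n - (a + d) = 0)%N by lia.
  by rewrite /F => ->; rewrite mul0r mulr0.
transitivity (\sum_(0 <= a < n - d) ((n - d + d - a)%:R * (n - d - a)%:R) / n%:R ^+ 2 : R).
  apply: eq_big_nat => a /andP[_ ad]; rewrite subnK // /F -subnDA [(d + a)%N]addnC.
  by field.
by rewrite -mulr_suml sum_weights natrB // /weights_corr; field.
Qed.

Section grid.
Variables (X : R) (n : nat).
Hypotheses (X0 : 0 < X) (Xn : X <= n%:R).
Let M := grid_size X n.
Let k (d : nat) : R := dirichlet M n d%:R.

Let n0 : (0 < n)%N. Proof. by rewrite -(ltr0n R); exact: lt_le_trans Xn. Qed.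
Let np : 0 < n%:R :> R. Proof. by rewrite ltr0n. Qed.
Let nM : (n.*2.+1 <= M)%N. Proof. exact: grid_size_ge. Qed.

Lemma sum_decay_le p : (n <= p)%N -> (p.-1.*2 <= M)%N ->
  0 <= \sum_(n <= d < p) k d ^+ 2 <= 6 / n%:R.
Proof.
move=> np' pM; apply/andP; split; first by apply: sumr_ge0 => d _; exact: sqr_ge0.
apply: (@le_trans _ _ (\sum_(n <= d < p) 3 * (d%:R ^+ 2)^-1)).
  apply: ler_sum_nat => d /andP[nd dp]; apply: dirichlet_decay.
    exact: leq_trans nd.
  apply: leq_trans pM; rewrite leq_double.
  by case: p dp {np'}.
rewrite -mulr_sumr; apply: (@le_trans _ _ (3 * (2 / n%:R))).
  by rewrite ler_pM2l // sum_inv_sqr_le.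
by rewrite mulrA -natrM.
Qed.

(** Idempotence at a diagonal entry says that k 0 is the sum of k d ^+ 2 over a
    period. Taking the entry at M / 2 unfolds the period symmetrically around 0,
    and the decay of the kernel makes the part beyond n of order 1 / n. *)
Lemma grid_row_sum : exists2 t : R, 0 <= t <= 12 / n%:R &
  k 0 = k 0 ^+ 2 + 2 * \sum_(1 <= d < n) k d ^+ 2 + t.
Proof.
(* row M / 2, whose entries are at distance at most M / 2 from the diagonal *)
pose r := M./2.
have r2 : (r + r <= M <= (r + r).+1)%N by rewrite /r; lia.
have rM : (r < M)%N by lia.
have nr : (n <= r)%N by lia.
have E : k 0 = \sum_(1 <= d < r.+1) k d ^+ 2 + (k 0 ^+ 2 + \sum_(1 <= d < M - r) k d ^+ 2).
  have := congr1 (fun A : 'M[R]_M => A (Ordinal rM) (Ordinal rM)) (circle_mx_idem R nM).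
  rewrite !mxE subrr -[dirichlet M n 0]/(k 0) => kE; rewrite -{1}kE.
  transitivity (\sum_(0 <= b < M) dirichlet M n (r%:R - b%:R) ^+ 2 : R).
    rewrite big_mkord; apply: eq_bigr => b _.
    by rewrite !mxE /= -[X in _ * X]dirichletN opprB expr2.
  rewrite (big_cat_nat (leq0n r) (ltnW rM)) /=; congr (_ + _).
    rewrite big_nat_rev /= big_add1 /=; apply: eq_big_nat => b /andP[_ br].
    rewrite add0n /k; congr (dirichlet _ _ _ ^+ 2).
    by rewrite natrB // opprB addrC subrK.
  rewrite big_ltn // subrr; congr (_ + _).
  rewrite -[r.+1]add1n big_addn.
  apply: eq_big_nat => b _; rewrite /k -dirichletN natrD.
  by congr (dirichlet _ _ _ ^+ 2); ring.
exists (\sum_(n <= d < r.+1) k d ^+ 2 + \sum_(n <= d < M - r) k d ^+ 2).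
  have /andP[a1 a2] : 0 <= \sum_(n <= d < r.+1) k d ^+ 2 <= 6 / n%:R.
    by apply: sum_decay_le; lia.
  have /andP[b1 b2] : 0 <= \sum_(n <= d < M - r) k d ^+ 2 <= 6 / n%:R.
    by apply: sum_decay_le; lia.
  rewrite addr_ge0 //=; apply: le_trans (lerD a2 b2) _.
  by rewrite -mulrDl -natrD.
rewrite {1}E (big_cat_nat n0 (_ : n <= r.+1)%N) /=; last by lia.
rewrite [X in _ + (_ + X)](big_cat_nat n0 (_ : n <= M - r)%N) /=; last by lia.
ring.
Qed.

Lemma grid_cumul1E : cumul (weights M n) (circle_mx R M n) 1 =
  weights_corr n 0 * (k 0 - k 0 ^+ 2) -
  2 * \sum_(1 <= d < n) weights_corr n d * k d ^+ 2.
Proof.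
pose C := weights_corr n; rewrite -!/(C _) cumul1_sum.
have nM' : (n <= M)%N by lia.
have C0E : \sum_(0 <= a < M) F n a ^+ 2 = C 0%N.
  rewrite /C -(weights_correlation nM' (leq0n n) n0) subn0.
  by apply: eq_bigr => a _; rewrite addn0 expr2.
pose G a b := F n a * F n b * dirichlet M n (a%:R - b%:R) ^+ 2.
have -> : \sum_a weights M n 0 a ^+ 2 * circle_mx R M n a a = C 0%N * k 0.
  rewrite -C0E big_mkord mulr_suml; apply: eq_bigr => a _.
  by rewrite !mxE subrr.
have -> : \sum_a \sum_b weights M n 0 a * weights M n 0 b *
     (circle_mx R M n a b * circle_mx R M n b a) = \sum_(0 <= a < M) \sum_(0 <= b < M) G a b.
  rewrite big_mkord; apply: eq_bigr => a _; rewrite big_mkord; apply: eq_bigr => b _.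
  rewrite !mxE /G /F [in RHS]expr2; congr (_ * (_ * _)).
  by rewrite -dirichletN opprB.
rewrite sum_symmetric; last first.
  by move=> a b; rewrite /G -[in RHS]dirichletN opprB [F n b * _]mulrC.
have -> : \sum_(0 <= a < M) G a a = C 0%N * k 0 ^+ 2.
  rewrite -C0E mulr_suml; apply: eq_bigr => a _.
  by rewrite /G subrr -expr2.
have -> : \sum_(1 <= d < M) \sum_(0 <= a < M - d) G a (a + d)%N =
    \sum_(1 <= d < n) C d * k d ^+ 2.
  have GE d : \sum_(0 <= a < M - d) G a (a + d)%N =
      (\sum_(0 <= a < M - d) F n a * F n (a + d)%N) * k d ^+ 2.
    rewrite mulr_suml; apply: eq_bigr => a _; rewrite /G /k -dirichletN.
    by congr (_ * dirichlet _ _ _ ^+ 2); rewrite natrD; ring.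
  rewrite (big_cat_nat n0 nM') /= [X in _ + X]big_nat_cond.
  rewrite [X in _ + X]big1 ?addr0; last first.
    move=> d; rewrite andbT => /andP[nd _]; rewrite GE big1 ?mul0r // => a _.
    have : (n - (a + d) = 0)%N by lia.
    by rewrite {2}/F => ->; rewrite mul0r mulr0.
  apply: eq_big_nat => d /andP[_ dn].
  by rewrite GE weights_correlation // ltnW.
ring.
Qed.

(** By [grid_row_sum] the variance is, up to O(1), the sum over d of
    2 (C 0 - C d) k d ^+ 2, where C is the autocorrelation of the weights; and
    2 (C 0 - C d) equals d up to a correction that is summable against
    k d ^+ 2 <= 3 / d ^+ 2. *)
Lemma grid_cumul1_approx :
  `|cumul (weights M n) (circle_mx R M n) 1 - \sum_(1 <= d < n) d%:R * k d ^+ 2| <= 17.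
Proof.
have [t /andP[t0 t12] kE] := grid_row_sum.
have n1 : 1 <= n%:R :> R by rewrite ler1n.
rewrite grid_cumul1E.
have -> : k 0 - k 0 ^+ 2 = 2 * \sum_(1 <= d < n) k d ^+ 2 + t.
  by rewrite {1}kE; ring.
pose c (d : nat) : R := d%:R * (3 * n%:R + 1 - d%:R ^+ 2) / (3 * n%:R ^+ 2).
have -> : weights_corr n 0 * (2 * \sum_(1 <= d < n) k d ^+ 2 + t) -
    2 * \sum_(1 <= d < n) weights_corr n d * k d ^+ 2 -
    \sum_(1 <= d < n) d%:R * k d ^+ 2 =
    \sum_(1 <= d < n) c d * k d ^+ 2 + weights_corr n 0 * t.
  have -> : \sum_(1 <= d < n) c d * k d ^+ 2 =
      (2 * weights_corr n 0) * \sum_(1 <= d < n) k d ^+ 2 -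
      2 * \sum_(1 <= d < n) weights_corr n d * k d ^+ 2 -
      \sum_(1 <= d < n) d%:R * k d ^+ 2.
    rewrite !mulr_sumr -!sumrB; apply: eq_bigr => d _.
    by rewrite /weights_corr /c; field; rewrite gt_eqF.
  ring.
apply: le_trans (ler_normD _ _) _.
rewrite (_ : 17 = 5 + 12); last by rewrite -natrD.
apply: lerD.
  apply: le_trans (ler_norm_sum _ _ _) _.
  apply: (@le_trans _ _ (\sum_(1 <= d < n) 5 / n%:R)).
    apply: ler_sum_nat => d /andP[d1 dn].
    have dp : 0 < d%:R :> R by rewrite ltr0n.
    have kd : k d ^+ 2 <= 3 / d%:R ^+ 2 by apply: dirichlet_decay => //; lia.
    have d1' : 1 <= d%:R :> R by rewrite ler1n.
    have dn' : d%:R <= n%:R :> R by rewrite ler_nat ltnW.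
    rewrite normrM (ger0_norm (sqr_ge0 _)).
    apply: (@le_trans _ _ (d%:R * (3 * n%:R + 1 + d%:R ^+ 2) / (3 * n%:R ^+ 2) *
                          (3 / d%:R ^+ 2))).
      apply: ler_pM => //; first exact: sqr_ge0.
      rewrite /c !normrM normfV (gtr0_norm dp).
      rewrite (gtr0_norm (_ : 0 < 3 * n%:R ^+ 2)) ?mulr_gt0 ?exprn_gt0 //.
      rewrite ler_pM2r ?invr_gt0 ?mulr_gt0 ?exprn_gt0 // ler_pM2l //.
      apply: le_trans (ler_normB _ _) _.
      by rewrite !ger0_norm ?sqr_ge0 // addr_ge0 ?mulr_ge0 ?ler0n.
    rewrite [leLHS](_ : _ = (3 * n%:R + 1 + d%:R ^+ 2) / (n%:R ^+ 2 * d%:R)); last first.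
      by field; rewrite !gt_eqF.
    rewrite ler_pdivrMr ?mulr_gt0 ?exprn_gt0 //.
    rewrite [leRHS](_ : _ = 5 * n%:R * d%:R); last by field; rewrite gt_eqF.
    by nra.
  rewrite sumr_const_nat -[_ *+ _]mulr_natl mulrA ler_pdivrMr // mulrC.
  by rewrite ler_pM2l // ler_nat leq_subr.
have w0 : 0 <= weights_corr n 0 <= n%:R.
  rewrite /weights_corr !subr0 addr0; apply/andP; split.
    by rewrite divr_ge0 ?mulr_ge0 ?addr_ge0 ?mulr_ge0 ?ler0n.
  by rewrite ler_pdivrMr ?mulr_gt0 ?exprn_gt0 //; nra.
have /andP[w0' w1] := w0.
rewrite ger0_norm ?mulr_ge0 //.
apply: (@le_trans _ _ (n%:R * (12 / n%:R))); first exact: ler_pM.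
by rewrite mulrCA divff ?mulr1 // gt_eqF.
Qed.
End grid.
End grid_variance.

(** * Logarithmic growth of the variance *)

Section log_asymptotics.
Variable R : realType.

Lemma ln_le_sub1 (x : R) : 0 < x -> ln x <= x - 1.
Proof.
move=> x0; have := expR_ge1Dx (ln x); rewrite lnK ?posrE // => H; lra.
Qed.

Lemma ln_succ_le (d : nat) : (0 < d)%N ->
  0 <= (d%:R^-1 : R) - (ln d.+1%:R - ln d%:R) <= (d%:R ^+ 2)^-1.
Proof.
move=> d0; have dp : 0 < d%:R :> R by rewrite ltr0n.
have sp : 0 < d.+1%:R :> R by rewrite ltr0n.
have sE : d.+1%:R = d%:R + 1 :> R by rewrite natr1.
have H1 : ln (d.+1%:R / d%:R) <= d.+1%:R / d%:R - 1 :> R.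
  by apply: ln_le_sub1; rewrite divr_gt0.
have H2 : ln (d%:R / d.+1%:R) <= d%:R / d.+1%:R - 1 :> R.
  by apply: ln_le_sub1; rewrite divr_gt0.
rewrite !ln_div ?posrE // in H1 H2.
have E1 : d.+1%:R / d%:R - 1 = d%:R^-1 :> R by rewrite sE; field; rewrite gt_eqF.
have E2 : d%:R / d.+1%:R - 1 = - d.+1%:R^-1 :> R.
  by rewrite sE in sp *; field; rewrite gt_eqF.
rewrite E1 in H1; rewrite E2 in H2; rewrite subr_ge0 H1 /=.
apply: (@le_trans _ _ (d%:R^-1 - d.+1%:R^-1)).
  by rewrite lerD2l opprB.
have -> : d%:R^-1 - d.+1%:R^-1 = (d%:R * d.+1%:R)^-1 :> R.
  by rewrite sE in sp *; field; rewrite !gt_eqF.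
rewrite lef_pV2 ?posrE ?mulr_gt0 ?exprn_gt0 //.
by rewrite expr2 ler_pM2l // ler_nat.
Qed.

Section sums.
Variables (h : R).
Hypothesis h01 : 0 < h <= 1.

Let hp : 0 < h. Proof. by case/andP: h01. Qed.
Let h1 : h <= 1. Proof. by case/andP: h01. Qed.
Let a (d : nat) : R := sin (h * d%:R) ^+ 2 / d%:R.

Let sinh3 : h / 3 <= sin h.
Proof.
apply: sin_ge_third; rewrite (ltW hp) /=; apply: le_trans h1 _.
exact: pihalf_ge1.
Qed.

Let sinhp : 0 < sin h. Proof. by apply: lt_le_trans sinh3; rewrite divr_gt0. Qed.

(* The cosines cos (2 h d) have bounded partial sums, given by P; P is normalised
   so that no constant of integration appears in [P_step]. *)
Let P (d : nat) : R := sin (h * (d%:R + d%:R - 1)) / (2 * sin h).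

Let P_le d : `|P d| <= 3 / (2 * h).
Proof.
rewrite normrM normfV (gtr0_norm (mulr_gt0 _ sinhp)) // ler_pdivrMr ?mulr_gt0 //.
apply: le_trans (sin_max _) _.
have -> : 3 / (2 * h) * (2 * sin h) = 3 * sin h / h by field; rewrite gt_eqF.
by rewrite ler_pdivlMr // mul1r mulrC -ler_pdivrMr.
Qed.

Let P_step d : P d.+1 - P d = cos (2 * (h * d%:R)).
Proof.
have -> : P d.+1 = sin (2 * (h * d%:R) + h) / (2 * sin h).
  by rewrite /P; congr (sin _ / _); rewrite -natr1; ring.
have -> : P d = sin (2 * (h * d%:R) - h) / (2 * sin h).
  by rewrite /P; congr (sin _ / _); ring.
by rewrite sinD sinB; field; rewrite gt_eqF.
Qed.

(* An approximate primitive of a: half the logarithm comes from the mean of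
   sin^2, the second term from summing the cosines by parts. *)
Let Phi (d : nat) : R := ln d%:R / 2 - P d / (2 * d%:R).

Let a_Phi d : (0 < d)%N ->
  `|a d - (Phi d.+1 - Phi d)| <= (1 / 2 + 3 / (4 * h)) * (d%:R ^+ 2)^-1.
Proof.
move=> d0; have dp : 0 < d%:R :> R by rewrite ltr0n.
have sp : 0 < d.+1%:R :> R by rewrite ltr0n.
have aE : a d = (1 - (P d.+1 - P d)) / (2 * d%:R).
  rewrite P_step /a mulr_natl cos_mulr2n cos2sin2.
  rewrite -mulr_natr; by field; rewrite gt_eqF.
have -> : a d - (Phi d.+1 - Phi d) =
    (d%:R^-1 - (ln d.+1%:R - ln d%:R)) / 2 -
    P d.+1 / 2 * (d%:R^-1 - d.+1%:R^-1).
  by rewrite aE /Phi; field; rewrite !gt_eqF.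
have /andP[l0 l1] := ln_succ_le d0.
have dd : 0 <= (d%:R^-1 : R) - d.+1%:R^-1 <= (d%:R ^+ 2)^-1.
  have -> : d%:R^-1 - d.+1%:R^-1 = (d%:R * d.+1%:R)^-1 :> R.
    by rewrite -natr1 in sp *; field; rewrite !gt_eqF.
  rewrite invr_ge0 mulr_ge0 ?ler0n //=.
  rewrite lef_pV2 ?posrE ?mulr_gt0 ?exprn_gt0 //.
  by rewrite expr2 ler_pM2l // ler_nat.
have /andP[d1 d2] := dd.
apply: le_trans (ler_normB _ _) _; rewrite [leRHS]mulrDl; apply: lerD.
  rewrite normrM ger0_norm // (ger0_norm (_ : 0 <= 2^-1)) //.
  by rewrite mulrC mul1r ler_pM2l.
rewrite normrM (ger0_norm d1) [ `|P _ / 2| ]normrM (ger0_norm (_ : 0 <= 2^-1)) //.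
apply: ler_pM => //.
have -> : 3 / (4 * h) = 3 / (2 * h) / 2 by field; rewrite gt_eqF.
by rewrite ler_pM2r ?invr_gt0 // P_le.
Qed.

Let sum_small n : 0 <= \sum_(1 <= d < n) a d <= (h * n%:R) ^+ 2.
Proof.
apply/andP; split; first by apply: sumr_ge0 => d _; rewrite divr_ge0 ?sqr_ge0.
apply: (@le_trans _ _ (\sum_(1 <= d < n) h ^+ 2 * n%:R)).
  apply: ler_sum_nat => d /andP[d1 dn]; have dp : 0 < d%:R :> R by rewrite ltr0n.
  rewrite /a ler_pdivrMr //.
  apply: (@le_trans _ _ ((h * d%:R) ^+ 2)).
    rewrite -[sin _ ^+ 2]real_normK ?num_real // -[(h * _) ^+ 2]real_normK ?num_real //.
    by apply: lerXn2r; rewrite ?nnegrE ?normr_ge0 ?normr_sin_le.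
  rewrite exprMn -[leRHS]mulrA; apply: ler_wpM2l; first exact: sqr_ge0.
  by rewrite expr2 ler_pM2r // ler_nat ltnW.
rewrite sumr_const_nat -[leLHS]mulr_natl exprMn [leLHS]mulrCA.
apply: ler_wpM2l; first exact: sqr_ge0.
by rewrite expr2 ler_wpM2r // ler_nat leq_subr.
Qed.

Let sqr_le4 (z : R) : 0 <= z -> z <= 2 -> z ^+ 2 <= 4.
Proof. by move=> z0 z2; nra. Qed.

(** The terms with d <= 1 / h add up to O(1). Beyond, sin^2 may be replaced by
    its mean 1 / 2, because [Phi] is a primitive up to O(1 / (h d^2)). The lower
    bound [x0] controls the logarithm when [h * n%:R] is small. *)
Lemma sum_sin_sqr_log n (x0 : R) : 0 < x0 <= h * n%:R ->
  `|\sum_(1 <= d < n) sin (h * d%:R) ^+ 2 / d%:R - ln (h * n%:R) / 2| <=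
  10 + `|ln x0|.
Proof.
move=> /andP[x00 x0X]; have Xp : 0 < h * n%:R by exact: lt_le_trans x0X.
have np : 0 < n%:R :> R by rewrite -(pmulr_rgt0 _ hp).
have lx : ln x0 <= ln (h * n%:R) by rewrite ler_ln ?posrE.
have lx' : - `|ln x0| <= ln x0 by rewrite lerNl ler_normr lexx orbT.
(* the first index beyond 1 / h *)
pose D := (Num.truncn h^-1).+1.
have /andP[D1 D2] : (Num.truncn h^-1)%:R <= h^-1 < D%:R.
  by apply: truncn_itv; rewrite invr_ge0 ltW.
have hD1 : 1 < h * D%:R by rewrite mulrC -ltr_pdivrMr // mul1r.
have hD2 : h * D%:R <= 2.
  have : h * (Num.truncn h^-1)%:R <= 1 by rewrite mulrC -ler_pdivlMr // mul1r.
  by rewrite /D -natr1 mulrDr mulr1; have := h1; lra.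
have [nD|Dn] := leqP n D.
  have /andP[s0 s1] := sum_small n.
  have X2 : h * n%:R <= 2.
    by apply: le_trans hD2; rewrite ler_pM2l // ler_nat.
  have lX : ln (h * n%:R) <= 1.
    by apply: le_trans (ln_le_sub1 Xp) _; lra.
  have X4 : (h * n%:R) ^+ 2 <= 4 by apply: sqr_le4 => //; exact: ltW.
  have nn := normr_ge0 (ln x0).
  rewrite -/a in s0 s1 *; rewrite ler_norml; apply/andP; split; lra.
have Dp : 0 < D%:R :> R by rewrite ltr0n.
rewrite (big_cat_nat _ (ltnW Dn)) //=.
have /andP[s0 s1] := sum_small D.
have s4 : (h * D%:R) ^+ 2 <= 4.
  by apply: sqr_le4 => //; apply: ltW; exact: mulr_gt0.
have hn1 : 1 < h * n%:R.
  by apply: lt_le_trans hD1 _; rewrite ler_pM2l // ler_nat ltnW.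
have tel : `|\sum_(D <= d < n) a d - (Phi n - Phi D)| <= 5 / 2.
  rewrite -telescope_sumr 1?ltnW // -sumrB.
  apply: le_trans (ler_norm_sum _ _ _) _.
  apply: (@le_trans _ _ (\sum_(D <= d < n) (1 / 2 + 3 / (4 * h)) * (d%:R ^+ 2)^-1)).
    by apply: ler_sum_nat => d /andP[Dd _]; apply: a_Phi; apply: leq_trans Dd.
  rewrite -mulr_sumr.
  have c0 : 0 <= 1 / 2 + 3 / (4 * h) by rewrite addr_ge0 ?divr_ge0 ?mulr_ge0 ?ltW.
  apply: le_trans (ler_wpM2l c0 (sum_inv_sqr_le R n (isT : (0 < D)%N))) _.
  rewrite [leLHS](_ : _ = (h + 3 / 2) / (h * D%:R)); last by field; rewrite !gt_eqF.
  rewrite ler_pdivrMr ?mulr_gt0 //; have := h1; have := hD1; lra.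
have PhiE : `|Phi n - Phi D - (ln n%:R - ln D%:R) / 2| <= 3 / 2.
  have Ple d : 1 < h * d%:R -> `|P d / (2 * d%:R)| <= 3 / 4.
    move=> hd; have dp : 0 < d%:R :> R by rewrite -(pmulr_rgt0 _ hp) (lt_trans _ hd).
    rewrite normrM normfV (gtr0_norm (_ : 0 < 2 * d%:R)) ?mulr_gt0 //.
    rewrite ler_pdivrMr ?mulr_gt0 //; apply: le_trans (P_le d) _.
    rewrite ler_pdivrMr ?mulr_gt0 //.
    rewrite [leRHS](_ : _ = 3 * (h * d%:R)); last by field.
    by move: hd; set z := h * _; lra.
  rewrite /Phi [X in `|X|](_ : _ = P D / (2 * D%:R) - P n / (2 * n%:R)); last by ring.
  apply: le_trans (ler_normB _ _) _.
  by have := Ple _ hD1; have := Ple _ hn1; lra.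
have lnE : ln (h * n%:R) = ln (h * D%:R) + (ln n%:R - ln D%:R).
  by rewrite !lnM ?posrE //; ring.
have lD0 : 0 <= ln (h * D%:R) by rewrite ln_ge0 // ltW.
have lD1 : ln (h * D%:R) <= 1.
  by apply: le_trans (ln_le_sub1 _) _; rewrite ?mulr_gt0 //; lra.
have nn := normr_ge0 (ln x0).
rewrite -/a in s0 s1 *; rewrite lnE.
move: tel PhiE s0 s1 s4 lD0 lD1 nn; rewrite -!/(a _).
move: (\sum_(1 <= i < D) _) (\sum_(D <= i < n) _) (Phi n) (Phi D) => A B p1 p2.
move: (ln (h * D%:R)) (ln n%:R - ln D%:R) `|ln x0| ((h * D%:R) ^+ 2) => u v w z.
rewrite !ler_norml => /andP[t1 t2] /andP[t3 t4] s0 s1 s4 l0 l1 w0.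
apply/andP; split; lra.
Qed.
End sums.
End log_asymptotics.

Section variance_log.
Variable R : realType.

(** At distance d the kernel is sin (h d) / (pi d) up to O(h / n), which turns
    the sum of d times its square into pi^-2 times the sum of sin^2 (h d) / d. *)
Lemma grid_variance_log (x0 X : R) (n : nat) : 0 < x0 <= X ->
  X + 2 * X ^+ 2 * (X + 1) <= n%:R ->
  `|cumul (weights R (grid_size X n) n) (circle_mx R (grid_size X n) n) 1 -
    ln X / (2 * pi ^+ 2)| <= 28 + `|ln x0|.
Proof.
move=> /andP[x00 x0X] Xn'; have X0 : 0 < X by exact: lt_le_trans x0X.
have q0 : 0 <= 2 * X ^+ 2 * (X + 1).
  by rewrite mulr_ge0 ?addr_ge0 ?mulr_ge0 ?sqr_ge0 // ltW.
have Xn : X <= n%:R by apply: le_trans Xn'; rewrite lerDl.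
have np : 0 < n%:R :> R by exact: lt_le_trans X0 Xn.
pose h := X / n%:R; have hp : 0 < h by rewrite divr_gt0.
have h1 : h <= 1 by rewrite ler_pdivrMr // mul1r.
have hn : h * n%:R = X by rewrite divfK // gt_eqF.
have pi1 : 1 <= pi :> R by apply: le_trans (pi_ge2 R); rewrite ler1n.
have pip := pi_gt0 R.
have := grid_cumul1_approx X0 Xn; set V := cumul _ _ _ => HV.
pose M := grid_size X n.
pose S := \sum_(1 <= d < n) sin (h * d%:R) ^+ 2 / d%:R.
have HS : `|S - ln X / 2| <= 10 + `|ln x0|.
  rewrite -hn; apply: sum_sin_sqr_log; first by rewrite hp h1.
  by rewrite x00 hn.
have HK : `|\sum_(1 <= d < n) d%:R * dirichlet M n d%:R ^+ 2 - S / pi ^+ 2| <= 1.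
  rewrite mulr_suml -sumrB; apply: le_trans (ler_norm_sum _ _ _) _.
  apply: (@le_trans _ _ (\sum_(1 <= d < n) 2 * X ^+ 2 * (X + 1) / n%:R ^+ 2)).
    apply: ler_sum_nat => d /andP[d1 dn].
    have dp : 0 < d%:R :> R by rewrite ltr0n.
    have hd : `|h * d%:R| <= X.
      rewrite (gtr0_norm (mulr_gt0 hp dp)); apply: (@le_trans _ _ (h * n%:R)).
        by rewrite ler_pM2l // ler_nat ltnW.
      by rewrite hn.
    have Ha := kernel_approx X0 Xn hd.
    have Hb := grid_kernel_le X0 Xn d%:R.
    have Hc := sine_kernel_le (h * d%:R).
    have {}Hc : `|sine_kernel (h * d%:R) 0| <= 1.
      by apply: le_trans Hc _; rewrite invf_le1.
    rewrite -/h -/M in Ha Hb.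
    pose kk := dirichlet M n d%:R / h; pose s := sine_kernel (h * d%:R) 0.
    rewrite -/kk -/s in Ha Hb Hc.
    have kE : dirichlet M n d%:R = kk * h by rewrite /kk divfK // gt_eqF.
    have sE : sin (h * d%:R) = s * (pi * (h * d%:R)).
      rewrite /s /sine_kernel subr0 mulf_eq0 (gt_eqF hp) (gt_eqF dp) /=.
      by rewrite divfK // gt_eqF // mulr_gt0 // (mulr_gt0 hp dp).
    rewrite kE sE.
    rewrite [X in `|X|](_ : _ = (d%:R * h ^+ 2) * ((kk - s) * (kk + s))); last first.
      move: (pi : R) pip => p pp; field.
      by rewrite !gt_eqF.
    rewrite normrM (gtr0_norm (mulr_gt0 dp (exprn_gt0 2 hp))) normrM.
    have ks : `|kk + s| <= 2.
      apply: le_trans (ler_normD _ _) _; rewrite (_ : 2 = 1 + 1) //.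
      exact: lerD.
    apply: (@le_trans _ _ (n%:R * h ^+ 2 * ((X + 1) / n%:R * 2))).
      apply: ler_pM => //.
      - by rewrite mulr_ge0 ?sqr_ge0 // ltW.
      - by rewrite ler_pM2r ?exprn_gt0 // ler_nat ltnW.
      - exact: ler_pM.
    by rewrite le_eqVlt; apply/orP; left; apply/eqP; rewrite /h; field; rewrite gt_eqF.
  rewrite sumr_const_nat -[leLHS]mulr_natl mulrA ler_pdivrMr ?exprn_gt0 // mul1r.
  apply: (@le_trans _ _ (n%:R * n%:R)); last by rewrite expr2.
  apply: ler_pM => //; first by rewrite ler_nat leq_subr.
  by apply: le_trans Xn'; rewrite lerDr ltW.
have -> : V - ln X / (2 * pi ^+ 2) =
   (V - \sum_(1 <= d < n) d%:R * dirichlet M n d%:R ^+ 2) +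
   (\sum_(1 <= d < n) d%:R * dirichlet M n d%:R ^+ 2 - S / pi ^+ 2) +
   (S - ln X / 2) / pi ^+ 2.
  by move: (pi : R) pip => p pp; field; rewrite gt_eqF.
have H3 : `|(S - ln X / 2) / pi ^+ 2| <= 10 + `|ln x0|.
  rewrite normrM normfV (gtr0_norm (exprn_gt0 2 pip)).
  rewrite ler_pdivrMr ?exprn_gt0 //; apply: le_trans HS _.
  by rewrite ler_peMr ?addr_ge0 // exprn_ege1.
apply: le_trans (ler_normD _ _) _.
apply: (@le_trans _ _ ((17 + 1) + (10 + `|ln x0|))).
  apply: lerD => //; apply: le_trans (ler_normD _ _) _.
  exact: lerD.
by move: `|ln x0| => w; lra.
Qed.
End variance_log.

(** * Linear combinations of integrable functions *)

Section linear_combinations.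
Context d (T : measurableType d) (R : realType) (mu : {measure set T -> \bar R}).
Variables (D : set T) (mD : measurable D).
Notation integrable f := (mu.-integrable D (EFin \o f)).
Notation Int f := (\int[mu]_(w in D) f w).

Lemma integrable_scale (k : R) (f : T -> R) : integrable f ->
  integrable (fun w => k * f w).
Proof.
move=> If; apply: (eq_integrable mD _ _ _ (integrableZl mD k If)) => w _ /=.
by rewrite EFinM.
Qed.

Lemma integrable_add (f g : T -> R) : integrable f -> integrable g ->
  integrable (fun w => f w + g w).
Proof.
move=> If Ig; apply: (eq_integrable mD _ _ _ (integrableD mD If Ig)) => w _ /=.
by rewrite EFinD.
Qed.

Lemma integrable_lin (k : R) (f g : T -> R) : integrable f -> integrable g ->
  integrable (fun w => k * f w + g w) /\
  Int (fun w => k * f w + g w) = k * Int f + Int g.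
Proof.
move=> If Ig.
have Ik := integrable_scale k If.
split; first exact: integrable_add.
by rewrite RintegralD // RintegralZl.
Qed.

Lemma integrable_lin_sum (I : Type) (r : seq I) (c : I -> R) (f : I -> T -> R) :
  (forall i, integrable (f i)) ->
  integrable (fun w => \sum_(i <- r) c i * f i w) /\
  Int (fun w => \sum_(i <- r) c i * f i w) = \sum_(i <- r) c i * Int (f i).
Proof.
move=> If; elim: r => [|i r [Ir Er]].
  under eq_fun do rewrite big_nil.
  split; last by rewrite Rintegral_cst // mul0r big_nil.
  by apply: (eq_integrable mD (cst 0%E)) => //; exact: integrable0.
under eq_fun do rewrite big_cons.
have [I1 E1] := integrable_lin (c i) (If i) Ir.
by split=> //; rewrite E1 Er big_cons.
Qed.

Lemma Rintegral_dist_le (f g h : T -> R) :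
  integrable f -> integrable g -> integrable h ->
  (forall w, D w -> `|f w - g w| <= h w) -> `|Int f - Int g| <= Int h.
Proof.
move=> If Ig Ih fgh.
have Ifg : integrable (fun w => f w - g w).
  apply: (eq_integrable mD _ _ _ (integrableB mD If Ig)) => w _ /=.
  by rewrite EFinB.
rewrite -RintegralB //; apply: le_trans (le_normr_Rintegral _ _) _ => //.
apply: le_Rintegral => //.
exact: (@integrable_norm _ _ _ mu _ (fun w => f w - g w)).
Qed.
End linear_combinations.

(** * Integrals of Lipschitz functions over boxes *)

Section box_integrals.
Variable R : realType.
Notation mu := (@lebesgue_measure R).
Implicit Types (Bs : seq (set R)) (f g : seq R -> R) (s t : seq R).

Definition bounded_lipschitz n (L K : R) f :=
  (forall s, size s = n -> `|f s| <= K) /\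
  (forall s t (delta : R), size s = n -> size t = n ->
     (forall i, `|s`_i - t`_i| <= delta) -> `|f s - f t| <= L * delta).

Fixpoint finite_boxes Bs : Prop :=
  if Bs is B :: Bs' then
    [/\ measurable (B : set (measurableTypeR R)), (mu B < +oo)%E & finite_boxes Bs'] else True.

Fixpoint in_box Bs s : Prop :=
  match Bs, s with
  | B :: Bs', x :: s' => B x /\ in_box Bs' s'
  | [::], [::] => True
  | _, _ => False
  end.

Definition box_volume Bs : R := \prod_(B <- Bs) fine (mu B).

Lemma box_volume_ge0 Bs : 0 <= box_volume Bs.
Proof. by apply: prodr_ge0 => B _; apply: fine_ge0; exact: measure_ge0. Qed.

Lemma box_integral_cst Bs (c : R) : finite_boxes Bs ->
  box_integral Bs (fun=> c%:E) = (c * box_volume Bs)%:E.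
Proof.
rewrite /box_volume; elim: Bs => [|B Bs IH] /=; first by rewrite big_nil mulr1.
case=> mB fB gB; rewrite big_cons.
under eq_integral => x _ do rewrite IH //.
have fE : mu B = (fine (mu B))%:E by rewrite fineK // ge0_fin_numE.
by rewrite integral_cst // [X in (_ * X)%E]fE -EFinM; congr EFin; ring.
Qed.

(** The two claims are proved together: an inner integral is measurable in the
    outer variable because it is continuous, and its continuity is the comparison
    of the integrals for two values of that variable. *)
Lemma box_integral_lipschitz Bs : finite_boxes Bs ->
  (forall L K f, bounded_lipschitz (size Bs) L K f ->
     box_integral Bs (EFin \o f) =
     (fine (box_integral Bs (EFin \o f)))%:E) /\
  (forall L K f L' K' g (delta : R), bounded_lipschitz (size Bs) L K f ->
     bounded_lipschitz (size Bs) L' K' g ->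
     (forall s, size s = size Bs -> in_box Bs s -> `|f s - g s| <= delta) ->
     `|fine (box_integral Bs (EFin \o f)) - fine (box_integral Bs (EFin \o g))| <=
     delta * box_volume Bs).
Proof.
elim: Bs => [|B Bs IH] /=.
  split=> // L K f L' K' g delta _ _ fg; rewrite /box_volume big_nil mulr1.
  exact: fg.
case=> mB fB gB; have [IH1 IH2] := IH gB.
have tailP L K f x : bounded_lipschitz (size Bs).+1 L K f ->
    bounded_lipschitz (size Bs) L K (fun s => f (x :: s)).
  move=> [fK fL]; split=> [s sn|s t delta sn tn H]; first by apply: fK; rewrite /= sn.
  apply: fL; rewrite /= ?sn ?tn // => -[|i] /=; last exact: H.
  rewrite subrr normr0; apply: le_trans (H 0%N); exact: normr_ge0.
(* v f is the inner integral as a function of the outer variable *)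
pose v f x := fine (box_integral Bs (EFin \o (fun s => f (x :: s)))).
have intE L K f : bounded_lipschitz (size Bs).+1 L K f ->
    (\int[mu]_(x in B) box_integral Bs (fun s => (EFin \o f) (x :: s)) =
    \int[mu]_(x in B) (v f x)%:E)%E.
  by move=> fP; apply: eq_integral => x _; rewrite -(IH1 L K) //; exact: tailP fP.
have vL L K f x x' : bounded_lipschitz (size Bs).+1 L K f ->
    `|v f x - v f x'| <= L * `|x - x'| * box_volume Bs.
  move=> fP; apply: (IH2 L K _ L K); [exact: tailP fP|exact: tailP fP|].
  move=> s sn _; apply: fP.2; rewrite /= ?sn // => -[|i] //=.
  by rewrite subrr normr0.
have vK L K f x : bounded_lipschitz (size Bs).+1 L K f ->
    `|v f x| <= K * box_volume Bs.
  move=> fP; have cP : bounded_lipschitz (size Bs) 0 0 (fun=> 0).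
    split=> [s|s t delta _ _ _]; first by rewrite normr0.
    by rewrite subrr normr0 mul0r.
  have <- : v f x - fine (box_integral Bs (EFin \o (fun=> 0))) = v f x.
    have -> : (EFin \o (fun=> 0)) = (fun=> 0%:E) :> (seq R -> \bar R) by [].
    by rewrite box_integral_cst // mul0r subr0.
  apply: (IH2 L K _ 0 0); [exact: tailP fP|exact: cP|].
  by move=> s sn _; rewrite subr0; apply: fP.1; rewrite /= sn.
have vC L K f : bounded_lipschitz (size Bs).+1 L K f -> continuous (v f).
  move=> fP x; apply/cvgrPdist_le => /= e e0.
  pose c := `|L| * box_volume Bs + 1.
  have c0 : 0 < c by rewrite ltr_wpDl // mulr_ge0 // box_volume_ge0.
  near=> y; apply: le_trans (vL L K f x y fP) _.
  apply: (@le_trans _ _ (c * `|x - y|)).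
    rewrite mulrAC ler_wpM2r // /c.
    apply: (@le_trans _ _ (`|L| * box_volume Bs)); last by rewrite lerDl.
    by rewrite ler_wpM2r ?box_volume_ge0 // ler_norm.
  rewrite mulrC -ler_pdivlMr //; near: y.
  by apply: cvgr_dist_le; [exact: cvg_id|rewrite divr_gt0].
have vI L K f : bounded_lipschitz (size Bs).+1 L K f ->
    mu.-integrable B (EFin \o v f).
  move=> fP; apply: measurable_bounded_integrable => //.
    by apply: measurable_funTS; apply: continuous_measurable_fun; exact: vC fP.
  exists (K * box_volume Bs); split; first exact: num_real.
  by move=> M KM x Bx /=; apply: le_trans (vK L K f x fP) (ltW KM).
have fE L K f : bounded_lipschitz (size Bs).+1 L K f ->
    (\int[mu]_(x in B) box_integral Bs (fun s => (EFin \o f) (x :: s)))%E =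
    (\int[mu]_(x in B) v f x)%:E.
  move=> fP; rewrite (intE L K f fP) /Rintegral fineK //.
  exact: integrable_fin_num (vI L K f fP).
split=> [L K f fP|L K f L' K' g delta fP gP fg]; first by rewrite (fE L K f fP).
rewrite (fE L K f fP) (fE L' K' g gP) /=.
have If := vI L K f fP; have Ig := vI L' K' g gP.
have -> : delta * box_volume (B :: Bs) = \int[mu]_(x in B) (delta * box_volume Bs).
  by rewrite Rintegral_cst // /box_volume big_cons mulrAC mulrA.
apply: Rintegral_dist_le => //.
  apply: measurable_bounded_integrable => //.
  exists `|delta * box_volume Bs|; split; first exact: num_real.
  by move=> M lM x _ /=; exact: ltW.
move=> x Bx; apply: (IH2 L K _ L' K'); [exact: tailP fP|exact: tailP gP|].
by move=> s sn sB; apply: fg; rewrite /= ?sn.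
Unshelve. all: by end_near. Qed.

Lemma box_integral_approx Bs L K f s0 (delta : R) : finite_boxes Bs ->
  bounded_lipschitz (size Bs) L K f -> size s0 = size Bs ->
  (forall s, in_box Bs s -> forall i, `|s`_i - s0`_i| <= delta) ->
  exists2 v, box_integral Bs (EFin \o f) = v%:E &
    `|v - f s0 * box_volume Bs| <= L * delta * box_volume Bs.
Proof.
move=> gB fP s0n H; have [E D] := box_integral_lipschitz gB.
exists (fine (box_integral Bs (EFin \o f))); first exact: E fP.
have cP : bounded_lipschitz (size Bs) 0 `|f s0| (fun=> f s0).
  by split=> // s t d _ _ _; rewrite subrr normr0 mul0r.
have := D L K f _ _ _ (L * delta) fP cP.
have -> : EFin \o (fun=> f s0) = (fun=> (f s0)%:E) :> (seq R -> \bar R) by [].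
rewrite box_integral_cst //=; apply => s sn sB.
by apply: fP.2 => // i; exact: H.
Qed.
End box_integrals.

(** * Determinants of the sine kernel *)

Section determinant_bounds.
Variable R : realType.

Lemma normr_prod_sub (I : Type) (r : seq I) (a b : I -> R) (delta : R) :
  0 <= delta ->
  (forall i, `|a i| <= 1) -> (forall i, `|b i| <= 1) ->
  (forall i, `|a i - b i| <= delta) ->
  `|\prod_(i <- r) a i - \prod_(i <- r) b i| <= (size r)%:R * delta.
Proof.
move=> d0 a1 b1 ab; elim: r => [|i r IH].
  by rewrite !big_nil subrr normr0 mul0r.
have pb : `|\prod_(j <- r) b j| <= 1.
  by rewrite normr_prod; apply: prodr_ile1 => j _; rewrite normr_ge0 b1.
rewrite !big_cons /= -natr1 mulrDl mul1r.
rewrite [X in `|X|](_ : _ = a i * (\prod_(j <- r) a j - \prod_(j <- r) b j) +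
   (a i - b i) * \prod_(j <- r) b j); last by ring.
apply: le_trans (ler_normD _ _) _; rewrite !normrM; apply: lerD.
  by apply: le_trans IH; rewrite ler_piMl.
by apply: le_trans (ab i); rewrite ler_piMr.
Qed.

Lemma normr_det_sub n (A B : 'M[R]_n) (delta : R) : 0 <= delta ->
  (forall i j, `|A i j| <= 1) -> (forall i j, `|B i j| <= 1) ->
  (forall i j, `|A i j - B i j| <= delta) ->
  `|\det A - \det B| <= n`!%:R * n%:R * delta.
Proof.
move=> d0 A1 B1 AB; rewrite /determinant -sumrB.
apply: le_trans (ler_norm_sum _ _ _) _.
apply: (@le_trans _ _ (\sum_(s : 'S_n) n%:R * delta)); last first.
  by rewrite sumr_const card_Sn -[leLHS]mulr_natl mulrA.
apply: ler_sum => s _; rewrite -mulrBr normrM normrX normrN1 expr1n mul1r.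
apply: le_trans (normr_prod_sub _ d0 _ _ _) _ => //.
by rewrite /index_enum -enumT size_enum_ord.
Qed.

Lemma normr_det_le n (A : 'M[R]_n) : (forall i j, `|A i j| <= 1) ->
  `|\det A| <= n`!%:R.
Proof.
move=> A1; apply: le_trans (ler_norm_sum _ _ _) _.
rewrite -card_Sn -[leRHS]mulr1 [leRHS]mulr_natl -sumr_const; apply: ler_sum => s _.
rewrite normrM normrX normrN1 expr1n mul1r normr_prod.
by apply: prodr_ile1 => i _; rewrite normr_ge0 A1.
Qed.

Definition sine_corr (s : seq R) : R :=
  \det (\matrix_(i < size s, j < size s) sine_kernel s`_i s`_j).

Lemma sine_kernel_le1 (x y : R) : `|sine_kernel x y| <= 1.
Proof.
rewrite sine_kernelE; apply: le_trans (sine_kernel_le _) _.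
by rewrite invf_le1 ?pi_gt0 //; apply: le_trans (pi_ge2 R); rewrite ler1n.
Qed.

Lemma sine_corr_lipschitz n :
  bounded_lipschitz n (n`!%:R * n%:R * 4) n`!%:R sine_corr.
Proof.
pose D (s : seq R) m := \det (\matrix_(i < m, j < m) sine_kernel s`_i s`_j).
split=> [s sn|s t delta sn tn st].
  rewrite -[sine_corr s]/(D s (size s)) sn; apply: normr_det_le => i j.
  by rewrite mxE; exact: sine_kernel_le1.
rewrite -[sine_corr s]/(D s (size s)) -[sine_corr t]/(D t (size t)) sn tn.
have d0 : 0 <= delta by apply: le_trans (st 0%N).
rewrite -mulrA; apply: normr_det_sub.
- exact: mulr_ge0.
- by move=> i j; rewrite mxE; exact: sine_kernel_le1.
- by move=> i j; rewrite mxE; exact: sine_kernel_le1.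
move=> i j; rewrite !mxE sine_kernelE [X in _ - X]sine_kernelE.
apply: le_trans (sine_kernel_lipschitz _ _) _.
have -> : 4 * delta = 2 * (2 * delta) by ring.
rewrite ler_pM2l //.
rewrite (_ : s`_i - s`_j - (t`_i - t`_j) = (s`_i - t`_i) - (s`_j - t`_j)); last by ring.
apply: le_trans (ler_normB _ _) _; rewrite mulr_natl mulr2n; exact: lerD.
Qed.

(** The first cell is closed so that the cells cover the interval; the others
    are open on the left so that they are disjoint. *)
Definition cell (h : R) (a : nat) : set R :=
  [set` Interval (BSide (a == 0%N) (h * a%:R)) (BRight (h * a.+1%:R))].

Lemma cellP h a x : cell h a x <->
  (if a == 0%N then 0 <= x else h * a%:R < x) /\ x <= h * a.+1%:R.
Proof.
rewrite /cell /= in_itv /=; case: eqP => [->|_] /=; first by rewrite mulr0; split=> /andP.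
by split=> /andP.
Qed.

Lemma lebesgue_measure_cell h a : 0 < h -> lebesgue_measure (cell h a) = h%:E.
Proof.
move=> h0; rewrite lebesgue_measure_itv /= lte_fin ltr_pM2l // ltr_nat ltnSn.
by rewrite -EFinB -mulrBr -natr1 addrAC subrr add0r mulr1.
Qed.

Lemma cell_near h a x : 0 < h -> cell h a x -> `|x - h * a.+1%:R| <= h.
Proof.
move=> h0 /cellP[xa xb]; rewrite distrC ger0_norm ?subr_ge0 // lerBlDr.
rewrite -natr1 mulrDr mulr1 addrC lerD2l.
by case: eqP xa => [->|_] H; rewrite ?mulr0 // ltW.
Qed.

Lemma trivIset_cell h m : 0 < h -> trivIset setT (fun a : 'I_m => cell h a).
Proof.
move=> h0; apply/trivIsetP => a b _ _ ab.
have disj (i j : nat) x : (i < j)%N -> cell h i x -> cell h j x -> False.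
  move=> ij /cellP[_ xi] /cellP[xj _].
  have j0 : (j == 0%N) = false by apply/negbTE; rewrite -lt0n; exact: leq_trans ij.
  rewrite j0 in xj; have := lt_le_trans xj xi.
  by rewrite ltr_pM2l // ltr_nat ltnS leqNgt ij.
apply/seteqP; split=> x //= [xa xb].
by case: (ltngtP a b) => [lt|lt|/val_inj E];
  [exact: disj lt xa xb|exact: disj lt xb xa|rewrite E eqxx in ab].
Qed.

Lemma bounded_cell h a : 0 < h -> bounded_set (cell h a).
Proof.
move=> h0; exists (h * a.+1%:R); split; first exact: num_real.
move=> M HM x /cellP[xa xb]; rewrite /= ger0_norm; first exact: le_trans xb (ltW HM).
by case: eqP xa => // _ /ltW; apply: le_trans; rewrite mulr_ge0 // ltW.
Qed.
End determinant_bounds.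

(** * Factorial moments of cell counts *)

Section factorial_moments.
Variable R : realType.
Implicit Types (h : R).

Lemma corr_perm (A : comNzRingType) m (D : 'M[A]_m) (s t : seq 'I_m) :
  perm_eq s t -> corr D s = corr D t.
Proof.
move=> /[dup] st /perm_size sz.
have [p sE] : exists p : 'S_(size t), s = [tuple tnth (in_tuple t) (p i) | i < size t].
  by apply/tuple_permP.
have E : corr D s = \det (\matrix_(i < size t, j < size t)
    D (tnth (in_tuple t) (p i)) (tnth (in_tuple t) (p j))).
  have detE (k : nat) (u : k.-tuple 'I_m) :
      corr D u = \det (\matrix_(i < k, j < k) D (tnth u i) (tnth u j)).
    rewrite /corr; case: u => u uk /=; have uk' := eqP uk.
    move: uk; rewrite -uk' => uk; congr (\det _); apply/matrixP => i j.
    have TE x : tnth (in_tuple u) x = tnth (Tuple uk) x.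
      have x0 := tnth (in_tuple u) x.
      by rewrite (tnth_nth x0) [RHS](tnth_nth x0).
    by rewrite !mxE !TE.
  rewrite sE detE; congr (\det _); apply/matrixP => i j.
  by rewrite !mxE !tnth_mktuple.
rewrite {}E /corr; set N := (X in _ = \det X).
have -> : (\matrix_(i, j) D (tnth (in_tuple t) (p i)) (tnth (in_tuple t) (p j))) =
    row_perm p (col_perm p N) by apply/matrixP => i j; rewrite !mxE.
rewrite row_permE col_permE !det_mulmx !det_perm mulrCA odd_permV.
by rewrite -expr2 sqrr_sign mulr1.
Qed.

(** The order in which points appear in the integrals that define correlation
    functions: grouped by cell. *)
Definition sort_indices m (s : seq 'I_m) : seq 'I_m :=
  flatten [seq nseq (count_mem a s) a | a <- enum 'I_m].

Lemma perm_sort_indices m (s : seq 'I_m) : perm_eq (sort_indices s) s.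
Proof.
apply/allP => a _ /=; apply/eqP; rewrite /sort_indices count_flatten -map_comp.
rewrite sumnE big_map -[enum _]/(enum 'I_m) big_enum /= (bigD1 a) //=.
rewrite count_nseq /= eqxx mul1n big1 ?addn0 // => b ba.
by rewrite count_nseq /= (negbTE ba).
Qed.

Section grid_boxes.
Variables (h : R) (m : nat).
Hypothesis h0 : 0 < h.

Lemma finite_boxes_cells (s : seq 'I_m) : finite_boxes [seq cell h a | a : 'I_m <- s].
Proof.
elim: s => //= a s IH; split=> //; first exact: measurable_itv.
by rewrite lebesgue_measure_cell // ltry.
Qed.

Lemma box_volume_cells (s : seq 'I_m) :
  box_volume [seq cell h a | a : 'I_m <- s] = h ^+ size s.
Proof.
rewrite /box_volume big_map; elim: s => [|a s IH]; first by rewrite big_nil.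
by rewrite big_cons IH lebesgue_measure_cell //= exprS.
Qed.

Lemma in_box_cells (s : seq 'I_m) (x : seq R) :
  in_box [seq cell h a | a : 'I_m <- s] x ->
  forall i, `|x`_i - [seq h * a.+1%:R | a : 'I_m <- s]`_i| <= h.
Proof.
elim: s x => [|a s IH] [|y x] //=.
  by move=> _ i; rewrite !nth_nil subrr normr0 ltW.
by case=> ya xs [|i] /=; [exact: cell_near|exact: IH].
Qed.
End grid_boxes.

Section counts.
Notation T := (config_space R).

Lemma measurable_particles (B : set R) (g : nat -> R) :
  measurable B -> bounded_set B ->
  measurable_fun [set: T] (fun w : T => g (particles B w)).
Proof.
move=> mB bB; apply: (@measurableT_comp _ _ _ _ _ _ (g : nat -> R)) => //.
move=> _ Y _; rewrite setTI.
have -> : (fun w : T => particles B w) @^-1` Y =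
    \bigcup_(k in Y) [set w : T | particles B w = k].
  apply/seteqP; split=> w /=; first by move=> Yw; exists (particles B w).
  by case=> k Yk E; rewrite E.
apply: bigcup_measurable => k _; apply: sub_sigma_algebra.
by exists B, k.
Qed.

Variables (P : probability T R) (m : nat) (B : 'I_m -> set R) (phi : 'rV[R]_m).
Hypotheses (mB : forall a, measurable (B a)) (bB : forall a, bounded_set (B a)).

Definition falling_prod (s : seq 'I_m) (w : T) : R :=
  (\prod_(a < m) particles (B a) w ^_ (count_mem a s))%N%:R.

Definition step_statistic (w : T) : R := \sum_a phi 0 a * (particles (B a) w)%:R.

Lemma measurable_falling_prod s : measurable_fun [set: T] (falling_prod s).
Proof.
rewrite /falling_prod; under eq_fun do rewrite natr_prod.
apply: measurable_prod => a _.
exact: (@measurable_particles (B a) (fun k => (k ^_ (count_mem a s))%:R)).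
Qed.

Lemma measurable_step_statistic : measurable_fun [set: T] step_statistic.
Proof.
apply: measurable_sum => a; apply: measurable_funM => //.
exact: (@measurable_particles (B a) (fun k => k%:R)).
Qed.

Lemma falling_prod_cons a s w :
  (particles (B a) w)%:R * falling_prod s w =
  falling_prod (a :: s) w + (count_mem a s)%:R * falling_prod s w.
Proof.
have cE (b : 'I_m) : count_mem b (a :: s) = ((a == b) + count_mem b s)%N by [].
rewrite /falling_prod (bigD1 a) // [in X in _ = X%:R + _](bigD1 a) //.
under [in X in _ = X%:R + _]eq_bigr => b ba do
  rewrite cE eq_sym (negbTE ba) add0n.
rewrite cE eqxx add1n; set k := count_mem a s; set N := particles _ _.
have key : (N * N ^_ k = N ^_ k.+1 + k * N ^_ k)%N.
  rewrite ffactnSr; have [kN|Nk] := leqP k N.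
    by rewrite mulnC [(k * _)%N]mulnC -mulnDr subnK.
  by rewrite ffact_small // !mul0n !muln0.
by rewrite -!natrM -natrD mulnA key mulnDl mulnA.
Qed.

(** The pathwise form of the recursion: it holds for each configuration, before
    any expectation is taken. *)
Lemma step_statistic_falling p s w :
  step_statistic w ^+ p * falling_prod s w =
  iter p (add_particle phi) (fun t => falling_prod t w) s.
Proof.
elim: p s => [|p IH] s; first by rewrite expr0 mul1r.
have E t : step_statistic w * falling_prod t w =
    add_particle phi (fun u => falling_prod u w) t.
  rewrite /step_statistic /add_particle mulr_suml.
  under eq_bigr => a _ do rewrite -mulrA falling_prod_cons mulrDr.
  rewrite big_split /=; congr (_ + _).
  under eq_bigr => a _ do rewrite mulrA.
  rewrite -mulr_suml; congr (_ * _).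
  elim: t => [|b t IHt]; first by rewrite big_nil big1 // => a _; rewrite mulr0.
  rewrite big_cons -IHt (bigD1 b) //= [in RHS](bigD1 b) //= eqxx add1n -natr1.
  under eq_bigr => a ab do rewrite eq_sym (negbTE ab) add0n.
  ring.
rewrite iterS exprSr -mulrA E /add_particle mulrDr mulr_sumr.
congr (_ + _); last by rewrite mulrCA IH.
by apply: eq_bigr => a _; rewrite mulrCA IH.
Qed.
End counts.
End factorial_moments.

Section expectations.
Variables (R : realType) (P : probability (config_space R) R).
Notation T := (config_space R).
Notation integrable f := (P.-integrable [set: T] (EFin \o f)).
Notation Ex f := (\int[P]_w f w).

Section moments.
Variables (m : nat) (B : 'I_m -> set R) (phi : 'rV[R]_m).

Lemma integrable_step_moment :
  (forall s, integrable (falling_prod B s)) ->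
  forall p s, integrable (fun w => step_statistic B phi w ^+ p * falling_prod B s w) /\
  Ex (fun w => step_statistic B phi w ^+ p * falling_prod B s w) =
  iter p (add_particle phi) (fun t => Ex (falling_prod B t)) s.
Proof.
move=> I0; elim=> [|p IH] s.
  by under eq_fun do rewrite expr0 mul1r.
have E w : step_statistic B phi w ^+ p.+1 * falling_prod B s w =
   \sum_a phi 0 a * (step_statistic B phi w ^+ p * falling_prod B (a :: s) w) +
   (\sum_(i <- s) phi 0 i) * (step_statistic B phi w ^+ p * falling_prod B s w).
  rewrite step_statistic_falling iterS /add_particle -step_statistic_falling.
  by congr (_ + _); apply: eq_bigr => a _; rewrite -step_statistic_falling.
under eq_fun do rewrite E addrC.
have [Is Es] := @integrable_lin_sum _ _ _ P _ measurableT _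
  (index_enum 'I_m) (fun a => phi 0 a) _ (fun a => (IH (a :: s)).1).
have [I1 E1] := integrable_lin measurableT (\sum_(i <- s) phi 0 i) (IH s).1 Is.
split=> //; rewrite E1 Es (IH s).2 addrC iterS /add_particle; congr (_ + _).
by apply: eq_bigr => a _; rewrite (IH (a :: s)).2.
Qed.

Lemma falling_prod_nil w : falling_prod B [::] w = 1.
Proof. by rewrite /falling_prod big1. Qed.

Lemma step_moment p : (forall s, integrable (falling_prod B s)) ->
  integrable (fun w => step_statistic B phi w ^+ p) /\
  Ex (fun w => step_statistic B phi w ^+ p) =
  iter p (add_particle phi) (fun t => Ex (falling_prod B t)) [::].
Proof.
move=> I0; have [I E] := integrable_step_moment I0 p [::].
have EE w : step_statistic B phi w ^+ p * falling_prod B [::] w =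
    step_statistic B phi w ^+ p by rewrite falling_prod_nil mulr1.
rewrite -E; under eq_Rintegral do rewrite -EE; split=> //.
by under eq_fun do rewrite -EE.
Qed.
End moments.

(** In one step a list receives one of n new points of weight h each, or repeats
    one of at most L points, so that an error eps h^|s| grows by the factor X + L
    at most. *)
Lemma add_particle_error (M n : nat) (phi : 'rV[R]_M) (e1 e2 : seq 'I_M -> R)
    (eps h X : R) (L : nat) :
  (n <= M)%N -> 0 <= eps -> 0 <= h -> n%:R * h = X ->
  (forall a, 0 <= phi 0 a <= 1) -> (forall a : 'I_M, (n <= a)%N -> phi 0 a = 0) ->
  (forall s, all (fun a : 'I_M => (a < n)%N) s -> (size s <= L)%N ->
     `|e1 s - e2 s| <= eps * h ^+ size s) ->
  forall p s, all (fun a : 'I_M => (a < n)%N) s -> (p + size s <= L)%N ->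
   `|iter p (add_particle phi) e1 s - iter p (add_particle phi) e2 s| <=
   (X + L%:R) ^+ p * eps * h ^+ size s.
Proof.
move=> nM eps0 h0 nhX phi01 phin H; have X0 : 0 <= X by rewrite -nhX mulr_ge0.
have XL : 0 <= X + L%:R by rewrite addr_ge0.
elim=> [|p IH] s sn sL; first by rewrite expr0 mul1r; apply: H.
rewrite !iterS /add_particle opprD addrACA -mulrBr -sumrB.
apply: le_trans (ler_normD _ _) _.
set A := (X + L%:R) ^+ p * eps * h ^+ size s.
have A0 : 0 <= A by rewrite !mulr_ge0 ?exprn_ge0.
apply: (@le_trans _ _ (X * A + L%:R * A)); last first.
  by rewrite -mulrDl /A exprS !mulrA.
apply: lerD.
  apply: (@le_trans _ _ (\sum_(a < M) (if (a < n)%N then h * A else 0))).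
    apply: le_trans (ler_norm_sum _ _ _) _; apply: ler_sum => a _.
    case: ltnP => an; last by rewrite phin // !mul0r subrr normr0.
    rewrite -mulrBr normrM; have /andP[p0 p1] := phi01 a.
    rewrite ger0_norm //.
    have IHa : `|iter p (add_particle phi) e1 (a :: s) -
       iter p (add_particle phi) e2 (a :: s)| <= h * A.
      rewrite /A mulrCA mulrC -exprS mulrC; apply: IH; first by rewrite /= an.
      by rewrite addnS.
    by apply: le_trans IHa; rewrite ler_piMl.
  rewrite -(big_mkord xpredT (fun a => if (a < n)%N then h * A else 0)).
  rewrite (big_cat_nat (leq0n n) nM) /= [X in _ + X]big_nat_cond.
  rewrite [X in _ + X]big1 ?addr0; last first.
    by move=> a; rewrite andbT => /andP[na _]; rewrite ltnNge na.
  rewrite big_nat (eq_bigr (fun=> h * A)); last by move=> a /andP[_ ->].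
  by rewrite -big_nat sumr_const_nat subn0 -[leLHS]mulr_natl mulrA nhX.
rewrite normrM; apply: ler_pM => //; last by apply: IH => //; exact: leq_trans sL.
apply: le_trans (ler_norm_sum _ _ _) _.
apply: (@le_trans _ _ (size s)%:R); last by rewrite ler_nat; lia.
elim: (s) => [|a t IHt]; first by rewrite big_nil.
rewrite big_cons /= -natr1 addrC; apply: lerD => //.
by have /andP[p0 p1] := phi01 a; rewrite ger0_norm.
Qed.
End expectations.

(** * Moments of step statistics of the sine process *)

Section sine_moments.
Variables (R : realType) (P : probability (config_space R) R).
Hypothesis hP : is_sine_process P.
Notation T := (config_space R).
Notation integrable f := (P.-integrable [set: T] (EFin \o f)).
Notation Ex f := (\int[P]_w f w).

Definition cells (h : R) m (a : 'I_m) : set R := cell h a.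

Definition grid_points (h : R) m (s : seq 'I_m) : seq R :=
  [seq h * a.+1%:R | a : 'I_m <- sort_indices s].

Lemma size_sort_indices m (s : seq 'I_m) : size (sort_indices s) = size s.
Proof. exact: perm_size (perm_sort_indices s). Qed.

Lemma expectationE (f : T -> R) : ('E_P[f] = \int[P]_w (f w)%:E)%E.
Proof. by rewrite unlock. Qed.

Lemma integrable_finite_expectation (f : T -> R) (v : R) :
  measurable_fun [set: T] f -> (forall w, 0 <= f w) ->
  ('E_P[f] = v%:E)%E -> integrable f /\ Ex f = v.
Proof.
move=> mf f0; rewrite expectationE => E; split; last by rewrite /Rintegral E.
apply/integrableP; split; first exact/measurable_EFinP.
under eq_integral => w _ do rewrite /= ger0_norm //.
by rewrite /= E ltry.
Qed.

Lemma falling_prod_box_integral m (B : 'I_m -> set R) (s : seq 'I_m) :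
  (forall a, measurable (B a)) -> (forall a, bounded_set (B a)) ->
  trivIset setT B ->
  ('E_P[falling_prod B s] =
   box_integral [seq B a | a <- sort_indices s] (EFin \o @sine_corr R))%E.
Proof.
move=> mB bB tB; have := hP (fun a => count_mem a s) mB bB tB.
rewrite [X in box_integral X _](_ : _ = [seq B a | a <- sort_indices s]) //.
have E2 : [seq [seq B a | a <- t]
      | t <- [seq nseq (count_mem a s) a | a <- enum 'I_m]] =
    [seq nseq (count_mem a s) (B a) | a <- enum 'I_m].
  by rewrite -map_comp; apply: eq_map => a /=; rewrite map_nseq.
by rewrite /sort_indices map_flatten E2.
Qed.

Lemma integrable_falling_prod m (B : 'I_m -> set R) (s : seq 'I_m) :
  (forall a, measurable (B a)) -> (forall a, bounded_set (B a)) ->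
  trivIset setT B -> (forall a, lebesgue_measure (B a) < +oo)%E ->
  integrable (falling_prod B s).
Proof.
move=> mB bB tB fB; have E := falling_prod_box_integral s mB bB tB.
have gB : finite_boxes [seq B a | a <- sort_indices s].
  elim: (sort_indices s) => //= a t IH; split=> //; exact: mB.
have [F _] := box_integral_lipschitz gB.
rewrite (F _ _ _ (sine_corr_lipschitz R _)) in E.
by have [] := integrable_finite_expectation (measurable_falling_prod mB bB s)
  (fun w => ler0n _ _) E.
Qed.

(** On a product of cells of length h the function [sine_corr] is constant up to
    O(h). *)
Lemma sine_falling_prod (h : R) m (s : seq 'I_m) : 0 < h ->
  integrable (falling_prod (@cells h m) s) /\
  `|Ex (falling_prod (@cells h m) s) -
    h ^+ size s * sine_corr (grid_points h s)| <=
  (size s)`!%:R * (size s)%:R * 4 * h * h ^+ size s.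
Proof.
move=> h0; have mc (a : 'I_m) : measurable (cell h a) by exact: measurable_itv.
have E := falling_prod_box_integral s mc (fun a => bounded_cell a h0)
  (@trivIset_cell R h m h0).
have sz : size [seq cell h a | a : 'I_m <- sort_indices s] = size s.
  by rewrite size_map size_sort_indices.
have [||v vE vle] := @box_integral_approx R [seq cell h a | a : 'I_m <- sort_indices s]
  _ _ _ (grid_points h s) h (finite_boxes_cells h0 _) (sine_corr_lipschitz R _).
- by rewrite /grid_points !size_map.
- by move=> x xin i; exact: in_box_cells xin i.
rewrite vE in E.
have [I ->] := integrable_finite_expectation
  (measurable_falling_prod mc (fun a => bounded_cell a h0) s) (fun w => ler0n _ _) E.
split=> //; move: vle; rewrite sz box_volume_cells // size_sort_indices.
by rewrite [h ^+ _ * _]mulrC.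
Qed.

(** Entrywise comparison of two determinants of the same size. *)
Lemma sine_grid_corr (X : R) (n : nat) (s : seq 'I_(grid_size X n)) :
  0 < X -> X <= n%:R -> all (fun a : 'I_(grid_size X n) => (a < n)%N) s ->
  `|(X / n%:R) ^+ size s * sine_corr (grid_points (X / n%:R) s) -
    corr (circle_mx R (grid_size X n) n) s| <=
  (size s)`!%:R * (size s)%:R * ((X + 1) / n%:R) * (X / n%:R) ^+ size s.
Proof.
move=> X0 Xn sn; set M := grid_size X n in s sn *.
have np : 0 < n%:R :> R by exact: lt_le_trans X0 Xn.
pose h := X / n%:R; rewrite -/h; have hp : 0 < h by rewrite divr_gt0.
pose u := sort_indices s.
have us : perm_eq u s := perm_sort_indices s.
have su : size u = size s := perm_size us.
have un : all (fun a : 'I_M => (a < n)%N) u by rewrite (perm_all _ us).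
rewrite -(corr_perm _ us) -su.
pose A := \matrix_(i < size u, j < size u)
  (dirichlet M n ((tnth (in_tuple u) i)%:R - (tnth (in_tuple u) j)%:R) / h).
pose K := \matrix_(i < size u, j < size u)
  sine_kernel (h * ((tnth (in_tuple u) i)%:R - (tnth (in_tuple u) j)%:R)) 0.
have -> : corr (circle_mx R M n) u = h ^+ size u * \det A.
  rewrite -detZ; congr (\det _); apply/matrixP => i j; rewrite !mxE.
  by rewrite mulrC divfK // gt_eqF.
have -> : sine_corr (grid_points h s) = \det K.
  pose D (x : seq R) m := \det (\matrix_(i < m, j < m) sine_kernel x`_i x`_j).
  rewrite -[sine_corr _]/(D (grid_points h s) (size (grid_points h s))).
  rewrite size_map -/u; congr (\det _); apply/matrixP => i j; rewrite !mxE.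
  rewrite sine_kernelE; congr (sine_kernel _ _).
  rewrite /grid_points -/u.
  have nthE (k : 'I_(size u)) :
      [seq h * a.+1%:R | a : 'I_M <- u]`_k = h * (tnth (in_tuple u) k).+1%:R.
    have x0 := tnth (in_tuple u) k.
    by rewrite (nth_map x0) ?ltn_ord // (tnth_nth x0).
  by rewrite !nthE -!natr1; ring.
rewrite -mulrBr normrM (ger0_norm (exprn_ge0 _ (ltW hp))) [leLHS]mulrC.
rewrite ler_pM2r ?exprn_gt0 //.
apply: normr_det_sub.
- by rewrite divr_ge0 ?addr_ge0 ?ltW.
- by move=> i j; rewrite mxE; exact: sine_kernel_le1.
- by move=> i j; rewrite mxE; exact: grid_kernel_le.
move=> i j; rewrite !mxE distrC; apply: kernel_approx => //.
have inu (k : 'I_(size u)) : (tnth (in_tuple u) k < n)%N.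
  by have /allP := un; apply; exact: mem_tnth.
have hnX : h * n%:R = X by rewrite divfK // gt_eqF.
rewrite normrM gtr0_norm // -[leRHS]hnX ler_pM2l //.
have := inu i; have := inu j; rewrite -!(ltr_nat R) => bj bi.
rewrite ler_norml lerBlDr lerBrDl.
have i0 : 0 <= (tnth (in_tuple u) i)%:R :> R by [].
have j0 : 0 <= (tnth (in_tuple u) j)%:R :> R by [].
by apply/andP; split; lra.
Qed.

Definition grid_moment (X : R) (n p : nat) : R :=
  joint_moment (weights R (grid_size X n) n) (circle_mx R (grid_size X n) n) p [::].

Lemma weights_itv M n a : (0 < n)%N -> 0 <= weights R M n 0 a <= 1.
Proof.
move=> n0; rewrite mxE divr_ge0 //= ler_pdivrMr ?ltr0n // mul1r ler_nat.
exact: leq_subr.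
Qed.

(** Both moments are produced by the same recursion, started from correlations
    that differ by O(1 / n) h^|s|. *)
Lemma grid_step_moment (X : R) (n p : nat) : 0 < X -> X <= n%:R ->
  let S := step_statistic (@cells (X / n%:R) (grid_size X n))
             (weights R (grid_size X n) n) in
  integrable (fun w => S w ^+ p) /\
  `|Ex (fun w => S w ^+ p) - grid_moment X n p| <=
  (X + p%:R) ^+ p * (p`!%:R * p%:R * (5 * X + 1)) / n%:R.
Proof.
move=> X0 Xn; set M := grid_size X n; move=> S.
have np : 0 < n%:R :> R by exact: lt_le_trans X0 Xn.
have n0 : (0 < n)%N by rewrite -(ltr0n R).
have nM : (n <= M)%N by have := grid_size_ge X0 Xn; rewrite -/M; lia.
pose h := X / n%:R; have hp : 0 < h by rewrite divr_gt0.
have If s : integrable (falling_prod (@cells h M) s) by have [] := sine_falling_prod s hp.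
have [I E] := step_moment (weights R M n) p If.
split; first exact: I.
rewrite /S E /grid_moment.
have H : forall s : seq 'I_M, all (fun a : 'I_M => (a < n)%N) s -> (size s <= p)%N ->
    `|Ex (falling_prod (@cells h M) s) - corr (circle_mx R M n) s| <=
    (p`!%:R * p%:R * (5 * X + 1) / n%:R) * h ^+ size s.
  move=> s sn sp; have [_ H1] := sine_falling_prod s hp.
  have H2 := sine_grid_corr X0 Xn sn.
  apply: le_trans (ler_distD (h ^+ size s * sine_corr (grid_points h s)) _ _) _.
  apply: le_trans (lerD H1 H2) _.
  rewrite [leLHS](_ : _ = (size s)`!%:R * (size s)%:R * ((5 * X + 1) / n%:R) * h ^+ size s);
    last by rewrite -/h /h; ring.
  rewrite ler_pM2r ?exprn_gt0 // -[leRHS]mulrA ler_pM2r ?divr_gt0 //; last first.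
    by rewrite ltr_wpDl // mulr_ge0 // ltW.
  apply: ler_pM => //; rewrite ler_nat //.
  exact: leq_fact.
have := @add_particle_error R M n (weights R M n) (fun s => Ex (falling_prod (@cells h M) s))
  (corr (circle_mx R M n)) _ h X p nM _ (ltW hp) _ (fun a => @weights_itv M n a n0) _ H p [::] isT.
rewrite addn0 leqnn expr0 mulr1 => H3.
rewrite -[leRHS]mulrA; apply: H3 => //.
- by rewrite !mulr_ge0 ?invr_ge0 ?addr_ge0 ?mulr_ge0 // ltW.
- by rewrite mulrC divfK // gt_eqF.
- move=> a na; rewrite mxE; have -> : (n - a = 0)%N by lia.
  by rewrite mul0r.
Qed.
End sine_moments.

(** * The linear statistic behind the averaged count *)

Section linear_statistic.
Variables (R : realType).
Notation T := (config_space R).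
Implicit Types (X h x : R) (w : T).

Definition support_on X w : set R := [set x | 0 <= x <= X /\ w x != 0%N].

Lemma finite_support_on X w : finite_set (support_on X w).
Proof. exact: config_locally_finite. Qed.

Definition points_on X w : seq R := enum_fset (fset_set (support_on X w)).

Lemma points_onP X w x : x \in points_on X w -> 0 <= x <= X.
Proof.
move=> H; have : x \in fset_set (support_on X w) by [].
by rewrite in_fset_set; [rewrite inE => -[]|exact: finite_support_on].
Qed.

Lemma particles_on X w (B : set R) : B `<=` [set x | 0 <= x <= X] ->
  (particles B w)%:R = \sum_(x <- points_on X w) (w x)%:R * (x \in B)%:R :> R.
Proof.
move=> BX; rewrite /particles.
pose g x := (w x * (x \in B))%N.
pose C := B `&` [set x | w x != 0%N].
have -> : \big[addn/0%N]_(x \in B) w x = \big[addn/0%N]_(x \in C) w x.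
  apply/esym/fsbig_widen; first by move=> x [].
  by move=> x [Bx nC] /=; apply/eqP/negPn/negP => wx; apply: nC.
have -> : \big[addn/0%N]_(x \in C) w x = \big[addn/0%N]_(x \in C) g x.
  apply: eq_fsbigr => x; rewrite inE => -[Bx _].
  by rewrite /g mem_set // muln1.
have -> : \big[addn/0%N]_(x \in C) g x = \big[addn/0%N]_(x \in support_on X w) g x.
  apply: fsbig_widen; first by move=> x [Bx wx]; split=> //; exact: BX.
  move=> x [[_ wx] nC] /=; rewrite /g; case: (boolP (x \in B)) => [|_]; last first.
    by rewrite muln0.
  by rewrite inE => Bx; exfalso; apply: nC.
rewrite fsbig_finite; last exact: finite_support_on.
rewrite /points_on; elim: (enum_fset _) => [|x s IH]; first by rewrite !big_nil.
by rewrite !big_cons natrD IH /g natrM.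
Qed.

(** A particle at x counts in [0, s N] as soon as s >= x / N, hence during a
    proportion 1 - x / X of the time interval [0, tau] if X = tau N. *)
Definition linear_stat X w : R :=
  \sum_(x <- points_on X w) (w x)%:R * (1 - x / X).

Lemma cell_sub h (n a : nat) : 0 < h -> (a < n)%N ->
  cell h a `<=` [set x | 0 <= x <= h * n%:R].
Proof.
move=> h0 an x /cellP[xa xb] /=; apply/andP; split.
  by case: eqP xa => // _ /ltW; apply: le_trans; rewrite mulr_ge0 // ltW.
by apply: le_trans xb _; rewrite ler_pM2l // ler_nat.
Qed.

Lemma cell_cover h (n : nat) x : 0 < h -> (0 < n)%N -> 0 <= x <= h * n%:R ->
  exists2 a, (a < n)%N & cell h a x.
Proof.
move=> h0 n0 /andP[x0 xn].
have ex : exists a, x <= h * a.+1%:R by exists n.-1; rewrite prednK.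
exists (ex_minn ex).
  case: ex_minnP => a _ amin; rewrite -ltnS -(prednK n0) ltnS ltnS.
  by apply: amin; rewrite prednK.
case: ex_minnP => a xa amin; apply/cellP; split=> //.
case: eqP => [//|/eqP a0]; rewrite ltNge; apply/negP => xa'.
have := amin a.-1; rewrite prednK ?lt0n // => /(_ xa').
by case: a a0 {xa amin xa'} => // a _; rewrite /= ltnn.
Qed.

Section approximation.
Variables (X : R) (n M : nat).
Hypotheses (X0 : 0 < X) (n0 : (0 < n)%N) (nM : (n <= M)%N).
Let h := X / n%:R.
Let np : 0 < n%:R :> R. Proof. by rewrite ltr0n. Qed.
Let h0 : 0 < h. Proof. by rewrite divr_gt0. Qed.
Let hn : h * n%:R = X. Proof. by rewrite divfK // gt_eqF. Qed.

Let phi x : R := \sum_(a < M) weights R M n 0 a * (x \in cell h a)%:R.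

Let phiE x : 0 <= x <= X ->
  exists2 a : nat, (a < n)%N & cell h a x /\ phi x = (n - a)%:R / n%:R.
Proof.
move=> x0X; have [|a an ax] := @cell_cover h n x h0 n0; first by rewrite hn.
exists a => //; split=> //; have aM : (a < M)%N by exact: leq_trans nM.
rewrite /phi (bigD1 (Ordinal aM)) //= big1 ?addr0; last first.
  move=> b ba; rewrite memNset ?mulr0 // => bx.
  have /trivIsetP/(_ (Ordinal aM) b I I) := @trivIset_cell R h M h0.
  rewrite eq_sym => /(_ ba); rewrite -subset0 => /(_ x); apply; split => //.
by rewrite mxE mem_set // mulr1.
Qed.

Lemma step_statistic_linear w :
  step_statistic (@cells R h M) (weights R M n) w =
  \sum_(x <- points_on X w) (w x)%:R * phi x.
Proof.
rewrite /phi; under [RHS]eq_bigr => x _ do rewrite mulr_sumr.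
rewrite exchange_big /=; apply: eq_bigr => a _.
under [RHS]eq_bigr => x _ do rewrite mulrCA.
rewrite -mulr_sumr; have [an|na] := ltnP a n.
  by rewrite (@particles_on X) // -hn; exact: cell_sub.
rewrite mxE; have -> : (n - a = 0)%N by lia.
by rewrite !mul0r.
Qed.

Let Y w : R := (particles `[0, X]%classic w)%:R.

Let YE w : Y w = \sum_(x <- points_on X w) (w x)%:R.
Proof.
rewrite /Y (@particles_on X) //.
rewrite big_seq [RHS]big_seq; apply: eq_bigr => x /points_onP xX.
by rewrite mem_set ?mulr1 //= in_itv.
Qed.

Lemma step_statistic_itv w :
  0 <= step_statistic (@cells R h M) (weights R M n) w <= Y w.
Proof.
rewrite step_statistic_linear YE big_seq [X in _ <= _ <= X]big_seq.
have H x : x \in points_on X w -> 0 <= phi x <= 1.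
  move=> /points_onP/phiE[a an [_ ->]].
  rewrite divr_ge0 //= ler_pdivrMr // mul1r ler_nat; exact: leq_subr.
apply/andP; split.
  by apply: sumr_ge0 => x /H/andP[p0 _]; exact: mulr_ge0.
by apply: ler_sum => x /H/andP[_ p1]; rewrite ler_piMr.
Qed.

Lemma linear_stat_itv w : 0 <= linear_stat X w <= Y w.
Proof.
rewrite /linear_stat YE big_seq [X in _ <= _ <= X]big_seq.
have H x : x \in points_on X w -> 0 <= 1 - x / X <= 1.
  move=> /points_onP/andP[x0 xX]; rewrite subr_ge0 ler_pdivrMr // mul1r xX /=.
  by rewrite gerBl divr_ge0 // ltW.
apply/andP; split.
  by apply: sumr_ge0 => x /H/andP[p0 _]; exact: mulr_ge0.
by apply: ler_sum => x /H/andP[_ p1]; rewrite ler_piMr.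
Qed.

Lemma linear_stat_approx w :
  `|linear_stat X w - step_statistic (@cells R h M) (weights R M n) w| <=
  Y w / n%:R.
Proof.
rewrite step_statistic_linear /linear_stat -sumrB YE mulr_suml.
apply: le_trans (ler_norm_sum _ _ _) _; rewrite big_seq [leRHS]big_seq.
apply: ler_sum => x /points_onP/phiE[a an [/cellP[xa xb] ->]].
rewrite -mulrBr normrM ger0_norm // ler_wpM2l //.
have {}xa : h * a%:R <= x by case: eqP xa => [->|_]; [rewrite mulr0|exact: ltW].
have xX : x / X = (x / h) / n%:R by rewrite /h; field; rewrite !gt_eqF.
have E : 1 - x / X - (n - a)%:R / n%:R = (a%:R - x / h) / n%:R.
  by rewrite xX natrB 1?ltnW //; field; rewrite !gt_eqF.
rewrite E normrM normfV (gtr0_norm np) ler_pdivrMr // mulVf ?gt_eqF //.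
rewrite distrC ger0_norm ?subr_ge0 ?ler_pdivlMr ?[_ * h]mulrC //.
rewrite lerBlDr ler_pdivrMr //; apply: le_trans xb _.
by rewrite -natr1 mulrC addrC.
Qed.
End approximation.

(** The set of particles over which the sum runs depends on the configuration, so
    measurability is obtained through the limit of step statistics. *)
Lemma measurable_linear_stat X : 0 < X ->
  measurable_fun [set: T] (linear_stat X).
Proof.
move=> X0.
apply: (@measurable_fun_cvg _ _ _ _ (fun n => step_statistic (@cells R (X / n.+1%:R) n.+1)
   (weights R n.+1 n.+1))).
  move=> n; apply: measurable_step_statistic => a; first exact: measurable_itv.
  by apply: bounded_cell; rewrite divr_gt0.
move=> w _; apply/cvgrPdist_le => /= e e0.
near=> n.
apply: le_trans (@linear_stat_approx X n.+1 n.+1 X0 isT (leqnn _) w) _.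
rewrite ler_pdivrMr // mulrC -ler_pdivrMr //.
apply: (@le_trans _ _ n%:R); last by rewrite ler_nat.
near: n; exact: nbhs_infty_ger.
Unshelve. all: by end_near. Qed.
End linear_statistic.

Section linear_moments.
Variables (R : realType) (P : probability (config_space R) R).
Hypothesis hP : is_sine_process P.
Notation T := (config_space R).
Notation integrable f := (P.-integrable [set: T] (EFin \o f)).
Notation Ex f := (\int[P]_w f w).

Let Y (X : R) (w : T) : R := (particles `[0, X]%classic w)%:R.

Lemma bounded_itv_cc (X : R) : bounded_set `[0, X]%classic.
Proof.
exists `|X|; split; first exact: num_real.
move=> M XM x /=; rewrite in_itv /= => /andP[x0 xX].
by rewrite ger0_norm //; apply: le_trans (ltW XM); apply: le_trans xX (ler_norm _).
Qed.

Lemma integrable_count_moment (X : R) p : integrable (fun w => Y X w ^+ p).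
Proof.
pose B := fun _ : 'I_1 => `[0, X]%classic : set R.
have If s : integrable (falling_prod B s).
  apply: (integrable_falling_prod hP) => [a|a||a].
  - exact: measurable_itv.
  - exact: bounded_itv_cc.
  - by apply/trivIsetP => a b _ _; rewrite !ord1 eqxx.
  - by rewrite /B lebesgue_measure_itv /=; case: ifP => _; rewrite -?EFinB ltry.
have [I _] := step_moment (const_mx 1) p If.
apply: (eq_integrable measurableT _ _ _ I) => w _ /=.
by rewrite /step_statistic big_ord1 mxE mul1r.
Qed.

Lemma normr_exp_sub (a b y e : R) p : 0 <= a <= y -> 0 <= b <= y ->
  `|a - b| <= y * e -> `|a ^+ p - b ^+ p| <= p%:R * e * y ^+ p.
Proof.
move=> /andP[a0 ay] /andP[b0 by_] ab; have y0 : 0 <= y by exact: le_trans ay.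
elim: p => [|p IH]; first by rewrite subrr normr0 !mul0r.
rewrite [X in `|X|](_ : _ = a * (a ^+ p - b ^+ p) + (a - b) * b ^+ p); last first.
  by rewrite !exprS; ring.
apply: le_trans (ler_normD _ _) _; rewrite !normrM.
rewrite [leRHS](_ : _ = y * (p%:R * e * y ^+ p) + y * e * y ^+ p); last first.
  by rewrite -natr1 exprS; ring.
apply: lerD; apply: ler_pM => //; first by rewrite ger0_norm.
by rewrite ger0_norm ?exprn_ge0 // lerXn2r ?nnegrE.
Qed.

Lemma integrable_linear_moment (X : R) p : 0 < X ->
  integrable (fun w => linear_stat X w ^+ p).
Proof.
move=> X0; apply: (le_integrable measurableT _ _ (integrable_count_moment X p)).
  apply/measurable_EFinP; apply: measurable_funX.
  exact: measurable_linear_stat.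
move=> w _ /=; have /andP[l0 lY] := @linear_stat_itv R X X0 w.
rewrite lee_fin ger0_norm ?exprn_ge0 // ger0_norm ?exprn_ge0 //.
by rewrite lerXn2r ?nnegrE // (le_trans l0).
Qed.

Lemma linear_moment_approx (X : R) p : 0 < X -> exists c : R,
  forall n, X <= n%:R ->
    `|Ex (fun w => linear_stat X w ^+ p) - grid_moment X n p| <= c / n%:R.
Proof.
move=> X0.
pose c1 := p%:R * Ex (fun w => Y X w ^+ p).
pose c2 := (X + p%:R) ^+ p * (p`!%:R * p%:R * (5 * X + 1)).
exists (c1 + c2) => n Xn; have np : 0 < n%:R :> R by exact: lt_le_trans X0 Xn.
have n0 : (0 < n)%N by rewrite -(ltr0n R).
have nM : (n <= grid_size X n)%N by have := grid_size_ge X0 Xn; lia.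
have [IS ES] := grid_step_moment hP p X0 Xn.
set S := step_statistic _ _ in IS ES.
apply: le_trans (ler_distD (Ex (fun w => S w ^+ p)) _ _) _.
rewrite [leRHS]mulrDl; apply: lerD => //.
have IL := integrable_linear_moment p X0.
have IY := integrable_count_moment X p.
have -> : c1 / n%:R = Ex (fun w => (p%:R / n%:R) * Y X w ^+ p).
  by rewrite RintegralZl // /c1 mulrAC.
apply: Rintegral_dist_le => //; first exact: integrable_scale.
move=> w _; apply: normr_exp_sub.
- exact: linear_stat_itv.
- exact: step_statistic_itv.
- exact: linear_stat_approx.
Qed.

Lemma expectation_count (u : R) : 0 <= u ->
  fine 'E_P[fun w => (particles `[0, u]%classic w)%:R] = u / pi.
Proof.
move=> u0; pose B := fun _ : 'I_1 => `[0, u]%classic : set R.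
have tB : trivIset setT B by apply/trivIsetP => a b _ _; rewrite !ord1 eqxx.
have := hP (fun=> 1%N) (fun=> measurable_itv _) (fun=> bounded_itv_cc u) tB.
rewrite [X in box_integral X _](_ : _ = [:: `[0, u]%classic]); last first.
  by rewrite enum_ordSl enum_ord0.
under [X in expectation.body _ X]eq_fun do rewrite big_ord1 ffactn1.
move=> ->; rewrite /=.
under eq_integral => x _ do rewrite det_mx11 mxE /= /sine_kernel eqxx.
have mu0 : measurable (`[0, u]%classic : set (measurableTypeR R)).
  exact: measurable_itv.
rewrite integral_cst //=.
rewrite lebesgue_measure_itv /= lte_fin; case: ltP => [_|u0'].
  by rewrite -EFinB subr0 -EFinM /= mulrC.
have -> : u = 0 by apply/eqP; rewrite eq_le u0 u0'.
by rewrite mule0 /= mul0r.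
Qed.

Notation mu := (@lebesgue_measure R).

Lemma Rintegral_id (tau : R) : 0 < tau ->
  mu.-integrable `[0, tau] (EFin \o id) /\
  \int[mu]_(s in `[0, tau]) s = tau ^+ 2 / 2.
Proof.
move=> t0.
have ci : {within `[0, tau], continuous (id : R -> R)}.
  by apply: continuous_subspaceT => x; exact: cvg_id.
split.
  by apply: continuous_compact_integrable => //; exact: segment_compact.
pose F : {poly R} := 2^-1 *: 'X^2.
have FE x : F.[x] = x ^+ 2 / 2 by rewrite /F hornerZ hornerXn mulrC.
rewrite /Rintegral (@continuous_FTC2 R id (horner F) 0 tau t0 ci) /=.
- by rewrite !FE expr0n mul0r subr0.
- split=> [x _||]; first exact: derivable_horner.
  + by apply: cvg_at_right_filter; exact: continuous_horner.
  + by apply: cvg_at_left_filter; exact: continuous_horner.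
- move=> x _; rewrite -derivE /F derivZ derivXn hornerZ hornerMn hornerXn /= expr1.
  by rewrite -[x *+ 2]mulr_natl mulrA mulVf ?mul1r.
Qed.

Lemma Rintegral_step (tau a : R) : 0 <= a <= tau ->
  mu.-integrable `[0, tau] (EFin \o (\1_(`[a, +oo[%classic) : R -> R)) /\
  \int[mu]_(s in `[0, tau]) (\1_(`[a, +oo[%classic) s : R) = tau - a.
Proof.
move=> /andP[a0 at_].
have mT : measurable (`[0, tau]%classic : set (measurableTypeR R)) by exact: measurable_itv.
have ma : measurable (`[a, +oo[%classic : set (measurableTypeR R)) by exact: measurable_itv.
split.
  have fT : (mu `[0%R, tau]%classic < +oo)%E.
    by rewrite lebesgue_measure_itv /=; case: ifP => _; rewrite -?EFinB ltry.
  apply: measurable_bounded_integrable => //.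
  exists 1; split; first exact: num_real.
  move=> M M1 x _ /=; rewrite indicE; case: (_ \in _); rewrite ?normr1 ?normr0 ltW //.
  by apply: lt_trans M1.
rewrite /Rintegral integral_indic //.
have -> : `[a, +oo[%classic `&` `[0, tau]%classic = `[a, tau]%classic :> set R.
  apply/seteqP; split=> x /=; rewrite !in_itv /= ?andbT.
    by case=> -> /andP[_ ->].
  by move=> /andP[ax xt]; rewrite ax xt (le_trans a0 ax).
transitivity (fine (lebesgue_measure (`[a, tau]%classic : set R))); first by [].
rewrite lebesgue_measure_itv /= lte_fin; case: ltP => [_|ta]; first by rewrite -EFinB.
have -> : a = tau by apply/eqP; rewrite eq_le at_ ta.
by rewrite subrr.
Qed.

(** Fubini for the finite sum over the particles of one configuration. *)
Lemma eta_avgE (tau : R) (N : nat) (w : T) : 0 < tau -> (0 < N)%N ->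
  eta_avg P tau N w =
  (linear_stat (tau * N%:R) w - tau * N%:R / (2 * pi)) /
  (pi^-1 * Num.sqrt (ln N%:R)).
Proof.
move=> t0 N0; set X := tau * N%:R; set c := pi^-1 * _.
have Np : 0 < N%:R :> R by rewrite ltr0n.
have X0 : 0 < X by rewrite mulr_gt0.
have mT : measurable (`[0, tau]%classic : set (measurableTypeR R)) by exact: measurable_itv.
have ptsI x : x \in points_on X w -> 0 <= x / N%:R <= tau.
  move=> /points_onP/andP[x0 xX]; rewrite divr_ge0 //= ?ler_pdivrMr // ltW //.
(* x / N is clipped to [0, tau] so that g x is integrable for every real x and
   not only for the particles of w *)
pose g (x s : R) := \1_(`[Num.min tau (Num.max 0 (x / N%:R)), +oo[%classic) s : R.
have clip x : 0 <= Num.min tau (Num.max 0 (x / N%:R)) <= tau.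
  by rewrite le_min (ltW t0) le_max lexx /= ge_min lexx.
have [Is Es] := integrable_lin_sum mT (points_on X w) (fun x => (w x)%:R)
  (fun x => (Rintegral_step (clip x)).1).
have [Ii Ei] := Rintegral_id t0.
have [I1 E1] := integrable_lin mT (- (N%:R / pi)) Ii Is.
rewrite /eta_avg.
have -> : \int[mu]_(s in `[0, tau]) xi P N s w =
   \int[mu]_(s in `[0, tau]) (c^-1 *
    (- (N%:R / pi) * s + \sum_(x <- points_on X w) (w x)%:R * g x s)).
  apply: eq_Rintegral => s; rewrite inE /= in_itv /= => /andP[s0 st].
  rewrite /xi expectation_count ?mulr_ge0 // -/c mulrC; congr (_ * _).
  rewrite (@particles_on R X) => [|x /=]; last first.
    rewrite in_itv /= => /andP[-> xs]; apply: le_trans xs _.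
    by rewrite ler_pM2r.
  rewrite addrC; congr (_ + _); first by ring.
  rewrite big_seq [RHS]big_seq; apply: eq_bigr => x xp; congr (_ * _).
  have /andP[x0 xt] := ptsI x xp; have /andP[x0' _] := points_onP xp.
  rewrite /g indicE (max_idPr _) // (min_idPr _) //; congr (nat_of_bool _)%:R.
  apply/idP/idP; rewrite !inE /= !in_itv /= ?andbT.
    by move=> /andP[_ xs]; rewrite ler_pdivrMr.
  by rewrite ler_pdivrMr // x0'.
rewrite RintegralZl // E1 Ei Es /linear_stat.
have -> : \sum_(x <- points_on X w) (w x)%:R *
    \int[mu]_(s in `[0, tau]) g x s =
    tau * \sum_(x <- points_on X w) (w x)%:R * (1 - x / X).
  rewrite mulr_sumr big_seq [RHS]big_seq; apply: eq_bigr => x xp.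
  rewrite /g (Rintegral_step (clip x)).2.
  have /andP[x0 xt] := ptsI x xp.
  rewrite (max_idPr _) // (min_idPr _) // mulrCA; congr (_ * _).
  by rewrite /X; field; rewrite !gt_eqF.
rewrite /X; move: (\sum_(x <- _) _) (c^-1) => S c1.
have pp := pi_gt0 R; move: (pi : R) pp => p pp.
by field; rewrite !gt_eqF.
Qed.
End linear_moments.

(** * From the moment recursion to the exponential formula *)

Section exponential_formula.
Variable R : realType.

Lemma lipschitz_of_derive (f df : R -> R) (u K : R) :
  (forall t, is_derive t (1:R) f (df t)) ->
  (forall t, `|t| <= `|u| -> `|df t| <= K) -> `|f u - f 0| <= K * `|u|.
Proof.
move=> fdf dfK.
have K0 : 0 <= K by apply: le_trans (dfK 0 _); rewrite ?normr0.
have cont (a b : R) : {within `[a, b], continuous f}.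
  by apply: derivable_within_continuous => t _; exact: ex_derive.
have [u0|u0] := leP 0 u.
  have [c cu E] := MVT_segment u0 (fun t _ => fdf t) (cont 0 u).
  rewrite E subr0 normrM ler_wpM2r // dfK //; move: cu; rewrite in_itv /= => /andP[c0 cu].
  by rewrite !ger0_norm.
have [c cu E] := MVT_segment (ltW u0) (fun t _ => fdf t) (cont u 0).
rewrite distrC E sub0r normrM normrN ler_wpM2r // dfK //.
move: cu; rewrite in_itv /= => /andP[cu c0].
by rewrite !ler0_norm ?(ltW u0) // lerN2.
Qed.

Lemma re_iD p q : re_i R (p + q) = re_i R p * re_i R q - im_i R p * im_i R q.
Proof.
suff: re_i R (p + q) = re_i R p * re_i R q - im_i R p * im_i R q /\
      im_i R (p + q) = re_i R p * im_i R q + im_i R p * re_i R q by case.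
elim: p => [|p [IH1 IH2]].
  by rewrite add0n /re_i /im_i /= expr0 !mul1r !mul0r subr0 addr0.
by rewrite addSn !re_iS !im_iS IH1 IH2; split; ring.
Qed.

Lemma im_iD p q : im_i R (p + q) = re_i R p * im_i R q + im_i R p * re_i R q.
Proof.
elim: p => [|p IH].
  by rewrite add0n /re_i /im_i /= expr0 mul1r mul0r addr0.
by rewrite addSn !im_iS !re_iS re_iD; ring.
Qed.

Lemma normr_re_i p : `|re_i R p| <= 1.
Proof. by rewrite /re_i; case: ifP => _; rewrite ?normr0 // normrX normrN1 expr1n. Qed.

Lemma normr_im_i p : `|im_i R p| <= 1.
Proof. by rewrite /im_i; case: ifP => _; rewrite ?normr0 // normrX normrN1 expr1n. Qed.

Variables (m kappa : nat -> R) (A : R).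
Hypothesis m0 : m 0%N = 1.
Hypothesis mS : forall p,
  m p.+1 = \sum_(j < p.+1) 'C(p, j)%:R * kappa j * m (p - j)%N.
Hypothesis A1 : 1 <= A.
Hypothesis kappaA : forall j, `|kappa j| <= j`!%:R * A.

Let A0 : 0 <= A. Proof. exact: le_trans A1. Qed.

Lemma moment_bound p : `|m p| <= p`!%:R * A ^+ p.
Proof.
suff: forall q, (q <= p)%N -> `|m q| <= q`!%:R * A ^+ q by apply.
elim: p => [|p IH] q; first by rewrite leqn0 => /eqP->; rewrite m0 normr1 expr0 mulr1.
rewrite leq_eqVlt => /orP[/eqP->|]; last by rewrite ltnS; exact: IH.
rewrite mS; apply: le_trans (ler_norm_sum _ _ _) _.
apply: (@le_trans _ _ (\sum_(j < p.+1) p`!%:R * A ^+ p.+1)); last first.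
  by rewrite sumr_const card_ord -[leLHS]mulr_natl factS natrM mulrA.
apply: ler_sum => j _; have jp : (j <= p)%N by rewrite -ltnS.
have pj : (p - j <= p)%N by exact: leq_subr.
rewrite !normrM ger0_norm ?ler0n //.
apply: (@le_trans _ _ ('C(p, j)%:R * (j`!%:R * A) * ((p - j)`!%:R * A ^+ (p - j)))).
  by apply: ler_pM; rewrite ?mulr_ge0 // ?ler_wpM2l ?IH.
rewrite [leLHS](_ : _ = 'C(p, j)%:R * j`!%:R * (p - j)`!%:R * (A * A ^+ (p - j))); last by ring.
rewrite -!natrM -mulnA bin_fact // -exprS ler_wpM2l //.
by apply: ler_weXn2l => //; rewrite ltnS.
Qed.

(** [mom_re n] and [mom_im n] are the real and imaginary parts of the truncated
    generating function F of the moments, as polynomials in a real variable u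
    standing for the imaginary number iu; [cum_re n] and [cum_im n] are those of
    the generating function G of the cumulants. *)
Definition mom_re n : {poly R} := \poly_(p < n) (re_i R p * m p / p`!%:R).
Definition mom_im n : {poly R} := \poly_(p < n) (im_i R p * m p / p`!%:R).
(** An index shift: [kappa j] is the cumulant of order j + 1. *)
Definition cum_seq k : R := if k is k'.+1 then kappa k' else 0.
Definition cum_re n : {poly R} := \poly_(k < n) (re_i R k * cum_seq k / k`!%:R).
Definition cum_im n : {poly R} := \poly_(k < n) (im_i R k * cum_seq k / k`!%:R).

Let deriv_gf (a : nat -> R) n p :
  (\poly_(p < n) (a p / p`!%:R))^`()`_p = if (p.+1 < n)%N then a p.+1 / p`!%:R else 0.
Proof.
rewrite coef_deriv coef_poly; case: ifP => _; last by rewrite mul0rn.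
rewrite -[_ *+ p.+1]mulr_natr -mulrA; congr (_ * _).
by rewrite factS natrM invfM mulrAC mulVf ?mul1r // pnatr_eq0.
Qed.

(* coefficient of X^p in F' - G' F, up to the factor i^(p+1) *)
Let defect n p : R :=
  (if (p.+1 < n)%N then m p.+1 / p`!%:R else 0) -
  \sum_(j < p.+1) (if (j.+1 < n)%N then kappa j / j`!%:R else 0) *
                  (if (p - j < n)%N then m (p - j)%N / (p - j)`!%:R else 0).

Let err_re n := (mom_re n)^`() - ((cum_re n)^`() * mom_re n - (cum_im n)^`() * mom_im n).
Let err_im n := (mom_im n)^`() - ((cum_re n)^`() * mom_im n + (cum_im n)^`() * mom_re n).

Let err_reE n p : (err_re n)`_p = re_i R p.+1 * defect n p.
Proof.
rewrite /err_re /mom_re /mom_im /cum_re /cum_im !coefB !coefM -sumrB /defect mulrBr.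
congr (_ - _).
  rewrite (deriv_gf (fun p => re_i R p * m p)); case: ifP => _; last by rewrite mulr0.
  by rewrite mulrA.
rewrite mulr_sumr; apply: eq_bigr => j _.
rewrite (deriv_gf (fun k => re_i R k * cum_seq k)) (deriv_gf (fun k => im_i R k * cum_seq k)).
have -> : re_i R p.+1 = re_i R j.+1 * re_i R (p - j) - im_i R j.+1 * im_i R (p - j).
  by rewrite -re_iD addSn subnKC // -ltnS.
rewrite !coef_poly /=; case: ifP => _; case: ifP => _; ring.
Qed.

Let err_imE n p : (err_im n)`_p = im_i R p.+1 * defect n p.
Proof.
rewrite /err_im /mom_re /mom_im /cum_re /cum_im coefB coefD !coefM -big_split /=.
rewrite /defect mulrBr; congr (_ - _).
  rewrite (deriv_gf (fun p => im_i R p * m p)); case: ifP => _; last by rewrite mulr0.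
  by rewrite mulrA.
rewrite mulr_sumr; apply: eq_bigr => j _.
rewrite (deriv_gf (fun k => re_i R k * cum_seq k)) (deriv_gf (fun k => im_i R k * cum_seq k)).
have -> : im_i R p.+1 = re_i R j.+1 * im_i R (p - j) + im_i R j.+1 * re_i R (p - j).
  by rewrite -im_iD addSn subnKC // -ltnS.
rewrite !coef_poly /=; case: ifP => _; case: ifP => _; ring.
Qed.

Let defect0 n p : (p.+1 < n)%N -> defect n p = 0.
Proof.
move=> pn; rewrite /defect pn mS; apply/eqP; rewrite subr_eq0; apply/eqP.
rewrite mulr_suml; apply: eq_bigr => j _; have jp : (j <= p)%N by rewrite -ltnS.
rewrite (leq_ltn_trans _ pn) ?ltnS // (leq_ltn_trans (leq_subr _ _)) 1?ltnW //.
have nz (q : nat) : q`!%:R != 0 :> R by rewrite pnatr_eq0 -lt0n fact_gt0.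
have -> : 'C(p, j)%:R = p`!%:R / (j`!%:R * (p - j)`!%:R) :> R.
  by rewrite -(bin_fact jp) natrM natrM mulfK // mulf_neq0.
by field; rewrite !nz.
Qed.

Let defect_le n p : (n <= p.+1)%N -> `|defect n p| <= p.+1%:R * A ^+ p.+1.
Proof.
move=> np; rewrite /defect ltnNge np /= sub0r normrN.
apply: le_trans (ler_norm_sum _ _ _) _.
rewrite -[X in _ <= X%:R * _](card_ord p.+1) mulr_natl -sumr_const; apply: ler_sum => j _.
have jp : (j <= p)%N by rewrite -ltnS.
have fp (q : nat) : 0 < q`!%:R :> R by rewrite ltr0n fact_gt0.
have k1 : `|if (j.+1 < n)%N then kappa j / j`!%:R else 0| <= A.
  case: ifP => _; last by rewrite normr0.
  by rewrite normrM normfV (gtr0_norm (fp _)) ler_pdivrMr // mulrC.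
have k2 : `|if (p - j < n)%N then m (p - j)%N / (p - j)`!%:R else 0| <= A ^+ (p - j).
  case: ifP => _; last by rewrite normr0 exprn_ge0.
  by rewrite normrM normfV (gtr0_norm (fp _)) ler_pdivrMr // mulrC moment_bound.
rewrite normrM; apply: (@le_trans _ _ (A * A ^+ (p - j))); first exact: ler_pM.
by rewrite -exprS; apply: ler_weXn2l => //; rewrite ltnS leq_subr.
Qed.

Lemma geometric_half (M n : nat) :
  \sum_(n <= p < M) (2 ^- p : R) <= 2 * 2 ^- n.
Proof.
have [Mn|nM] := leqP M n; first by rewrite big_geq // mulr_ge0 ?invr_ge0 ?exprn_ge0.
apply: (@le_trans _ _ (- 2 * 2 ^- M - - 2 * 2 ^- n)).
  apply: (@ler_sum_telescope R n M _ (fun p => - 2 * 2 ^- p)); first exact: ltnW.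
  move=> k _; rewrite exprS invfM le_eqVlt; apply/orP; left; apply/eqP; field.
  by rewrite expf_neq0.
by rewrite !mulNr opprK gerDr oppr_le0 mulr_ge0 ?invr_ge0 ?exprn_ge0.
Qed.

Let err_le (E : {poly R}) (c : nat -> R) n u : (0 < n)%N -> A * `|u| <= 1 / 4 ->
  (forall p, E`_p = c p * defect n p) -> (forall p, `|c p| <= 1) ->
  `|E.[u]| <= 4 * A * 2 ^- n.
Proof.
move=> n0 Au EE c1; rewrite horner_coef; apply: le_trans (ler_norm_sum _ _ _) _.
have term p : `|E`_p * u ^+ p| <= if (n.-1 <= p)%N then A * 2 ^- p else 0.
  rewrite EE; case: (leqP n.-1 p) => np; last first.
    by rewrite defect0 ?mulr0 ?mul0r ?normr0 //; lia.
  rewrite normrM normrX normrM.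
  apply: (@le_trans _ _ (p.+1%:R * A ^+ p.+1 * `|u| ^+ p)).
    rewrite ler_wpM2r ?exprn_ge0 //; apply: le_trans (_ : `|defect n p| <= _).
      by rewrite ler_piMl.
    by apply: defect_le; lia.
  rewrite exprS mulrA -mulrA -exprMn.
  have -> : 2 ^- p = 2 ^+ p * (1 / 4) ^+ p :> R.
    rewrite div1r exprVn (_ : 4 = 2 * 2); last by ring.
    by rewrite exprMn invfM mulrA mulfV ?mul1r // expf_neq0.
  rewrite mulrA [A * _]mulrC; apply: ler_pM.
  - by rewrite mulr_ge0.
  - by rewrite exprn_ge0 // mulr_ge0.
  - rewrite ler_wpM2r ?mulr_ge0 // -natrX ler_nat; exact: ltn_expl.
  - by apply: lerXn2r; rewrite ?nnegrE ?mulr_ge0 // divr_ge0.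
pose f p : R := if (n.-1 <= p)%N then A * 2 ^- p else 0.
apply: (@le_trans _ _ (\sum_(p < size E) f p)).
  by apply: ler_sum => p _; exact: term.
have b0 : 0 <= A * (2 * 2 ^- n.-1) by rewrite !mulr_ge0 // invr_ge0 exprn_ge0.
have -> : 4 * A * 2 ^- n = A * (2 * 2 ^- n.-1).
  by rewrite -[in LHS](prednK n0) exprS invfM; field; rewrite expf_neq0.
rewrite -(big_mkord xpredT f).
have f0 p : (p < n.-1)%N -> f p = 0 by move=> pn; rewrite /f leqNgt pn.
have [sn|ns] := leqP (size E) n.-1.
  rewrite big_nat big1 // => p /andP[_ ps]; apply: f0; exact: leq_trans sn.
rewrite (big_cat_nat (leq0n n.-1) (ltnW ns)) /= big_nat big1 ?add0r; last first.
  by move=> p /andP[_ ps]; exact: f0.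
rewrite (eq_big_nat _ _ (F2 := fun p => A * 2 ^- p)); last first.
  by move=> p /andP[np _]; rewrite /f np.
by rewrite -mulr_sumr ler_wpM2l // geometric_half.
Qed.

Lemma cum_term_le (c : nat -> R) k u : (forall p, `|c p| <= 1) ->
  `|c k * cum_seq k / k`!%:R * u ^+ k| <= (if k is 0 then 0 else A * `|u| ^+ k).
Proof.
move=> c1; case: k => [|k] /=; first by rewrite mulr0 mul0r mul0r normr0.
have fp (q : nat) : 0 < q`!%:R :> R by rewrite ltr0n fact_gt0.
rewrite normrM normrX ler_wpM2r ?exprn_ge0 // normrM normfV (gtr0_norm (fp _)).
rewrite ler_pdivrMr // normrM; apply: (@le_trans _ _ `|kappa k|).
  by rewrite ler_piMl.
apply: le_trans (kappaA k) _; rewrite mulrC ler_wpM2l // ler_nat.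
exact: leq_fact.
Qed.

Lemma cum_poly_le (c : nat -> R) n u : A * `|u| <= 1 / 4 ->
  (forall p, `|c p| <= 1) ->
  `|(\poly_(k < n) (c k * cum_seq k / k`!%:R)).[u]| <= 1.
Proof.
move=> Au c1; rewrite horner_poly; apply: le_trans (ler_norm_sum _ _ _) _.
have u1 : `|u| <= 1 / 4 by apply: le_trans Au; rewrite ler_peMl.
apply: (@le_trans _ _ (\sum_(k < n) if (1 <= k)%N then 2 ^- k / 2 else 0)).
  apply: ler_sum => k _; apply: le_trans (cum_term_le _ _ c1) _.
  case: (nat_of_ord k) => // {}k.
  rewrite exprS mulrA; apply: (@le_trans _ _ (1 / 4 * (1 / 2) ^+ k)).
    apply: ler_pM => //; rewrite ?mulr_ge0 ?exprn_ge0 //.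
    apply: lerXn2r; rewrite ?nnegrE ?divr_ge0 //; lra.
  rewrite exprS invfM !div1r exprVn le_eqVlt; apply/orP; left; apply/eqP; field.
  by rewrite expf_neq0.
case: n => [|n]; first by rewrite big_ord0.
rewrite big_ord_recl /= add0r.
rewrite -(big_mkord xpredT (fun k => 2 ^- (bump 0 k) / 2)) -mulr_suml.
under eq_bigr => k _ do rewrite /bump /= add1n.
rewrite -(big_add1 _ _ 0%N n.+1 xpredT (fun k => 2 ^- k)) /= ler_pdivrMr // mul1r.
apply: le_trans (geometric_half _ _) _; rewrite expr1 mulfV //.
by rewrite ler1n.
Qed.

(** The recursion is the coefficient form of F' = G' F. The truncations satisfy it
    up to an error which is geometrically small when A |u| <= 1 / 4, so that
    exp (- G) F, whose real and imaginary parts are W1 and W2, has a small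
    derivative and stays close to its value 1 at 0. *)
Lemma exp_poly_approx n u : (0 < n)%N -> A * `|u| <= 1 / 4 ->
  `|(mom_re n).[u] - expR (cum_re n).[u] * cos (cum_im n).[u]| <=
    16 * A * expR 1 ^+ 2 * 2 ^- n /\
  `|(mom_im n).[u] - expR (cum_re n).[u] * sin (cum_im n).[u]| <=
    16 * A * expR 1 ^+ 2 * 2 ^- n.
Proof.
move=> n0 Au.
set a := cum_re n; set b := cum_im n; set c := mom_re n; set s := mom_im n.
have e0 : 0 < expR 1 :> R by exact: expR_gt0.
have Au' t : `|t| <= `|u| -> A * `|t| <= 1 / 4.
  by move=> tu; apply: le_trans Au; rewrite ler_wpM2l.
have aN t : `|t| <= `|u| -> expR (- a.[t]) <= expR 1.
  move=> /Au' tA; rewrite ler_expR lerNl.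
  have := cum_poly_le n tA normr_re_i; rewrite -/(cum_re n) -/a.
  by rewrite ler_norml => /andP[].
pose W1 : R -> R := (expR \o - horner a) *
  (horner c * (cos \o horner b) + horner s * (sin \o horner b)).
pose W2 : R -> R := (expR \o - horner a) *
  (horner s * (cos \o horner b) - horner c * (sin \o horner b)).
pose E1 t := (err_re n).[t]; pose E2 t := (err_im n).[t].
have E1le t : `|t| <= `|u| -> `|E1 t| <= 4 * A * 2 ^- n.
  by move=> /Au' tA; exact: (err_le n0 tA (err_reE n) (fun p => normr_re_i p.+1)).
have E2le t : `|t| <= `|u| -> `|E2 t| <= 4 * A * 2 ^- n.
  by move=> /Au' tA; exact: (err_le n0 tA (err_imE n) (fun p => normr_im_i p.+1)).
have dW1 t : is_derive t (1:R) W1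
    (expR (- a.[t]) * (cos b.[t] * E1 t + sin b.[t] * E2 t)).
  apply: is_derive_eq; rewrite /E1 /E2 /err_re /err_im !hornerE -/a -/b -/c -/s.
  rewrite !fctE /= /GRing.scale /=; ring.
have dW2 t : is_derive t (1:R) W2
    (expR (- a.[t]) * (cos b.[t] * E2 t - sin b.[t] * E1 t)).
  apply: is_derive_eq; rewrite /E1 /E2 /err_re /err_im !hornerE -/a -/b -/c -/s.
  rewrite !fctE /= /GRing.scale /=; ring.
have combo t (x y p q : R) : `|t| <= `|u| -> `|x| <= 4 * A * 2 ^- n ->
    `|y| <= 4 * A * 2 ^- n -> `|p| <= 1 -> `|q| <= 1 ->
    `|expR (- a.[t]) * (p * x + q * y)| <= expR 1 * (8 * A * 2 ^- n).
  move=> tu xl yl p1 q1; rewrite normrM (gtr0_norm (expR_gt0 _)).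
  apply: ler_pM; rewrite ?expR_ge0 // ?aN //.
  apply: le_trans (ler_normD _ _) _; rewrite !normrM.
  rewrite [leRHS](_ : _ = 4 * A * 2 ^- n + 4 * A * 2 ^- n); last by ring.
  by apply: lerD; [apply: le_trans xl|apply: le_trans yl]; rewrite ler_piMl.
have u1 : `|u| <= 1.
  by apply: (@le_trans _ _ (1 / 4)); [apply: le_trans Au; rewrite ler_peMl|lra].
have B0 : 0 <= expR 1 * (8 * A * 2 ^- n) :> R.
  by rewrite !mulr_ge0 ?expR_ge0 // invr_ge0 exprn_ge0.
have at0 (x : nat -> R) : (\poly_(p < n) (x p / p`!%:R)).[0] = x 0%N.
  by rewrite horner_coef0 coef_poly n0 divr1.
have a0 : a.[0] = 0 by rewrite /a /cum_re (at0 (fun k => re_i R k * cum_seq k)) mulr0.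
have b0 : b.[0] = 0 by rewrite /b /cum_im (at0 (fun k => im_i R k * cum_seq k)) mulr0.
have c0 : c.[0] = 1.
  by rewrite /c /mom_re (at0 (fun p => re_i R p * m p)) m0 mulr1 /re_i /= expr0.
have s0 : s.[0] = 0.
  by rewrite /s /mom_im (at0 (fun p => im_i R p * m p)) m0 mulr1 /im_i.
have H1 : `|W1 u - 1| <= expR 1 * (8 * A * 2 ^- n).
  have W10 : W1 0 = 1.
    by rewrite /W1 !fctE /= a0 b0 c0 s0 oppr0 expR0 cos0 sin0; ring.
  have := lipschitz_of_derive dW1 (K := expR 1 * (8 * A * 2 ^- n)) (u := u).
  rewrite W10 => H; apply: le_trans (H _) _; last by rewrite ler_piMr.
  by move=> t tu; apply: combo => //; rewrite ?E1le ?E2le ?cos_max ?sin_max.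
have H2 : `|W2 u| <= expR 1 * (8 * A * 2 ^- n).
  have W20 : W2 0 = 0.
    by rewrite /W2 !fctE /= a0 b0 c0 s0 oppr0 expR0 cos0 sin0; ring.
  have := lipschitz_of_derive dW2 (K := expR 1 * (8 * A * 2 ^- n)) (u := u).
  rewrite W20 subr0 => H; apply: le_trans (H _) _; last by rewrite ler_piMr.
  move=> t tu; rewrite -mulNr; apply: combo => //; rewrite ?E1le ?E2le ?cos_max //.
  by rewrite normrN sin_max.
have ea : expR a.[u] <= expR 1.
  rewrite ler_expR; have := cum_poly_le n Au normr_re_i.
  by rewrite -/(cum_re n) -/a ler_norml => /andP[].
have cs1 := cos2Dsin2 b.[u].
have eaN : expR a.[u] * expR (- a.[u]) = 1 by exact: expRxMexpNx_1.
have cE : c.[u] - expR a.[u] * cos b.[u] =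
    expR a.[u] * ((W1 u - 1) * cos b.[u] - W2 u * sin b.[u]).
  transitivity (expR a.[u] * expR (- a.[u]) *
     (c.[u] * (cos b.[u] ^+ 2 + sin b.[u] ^+ 2)) - expR a.[u] * cos b.[u]).
    by rewrite eaN cs1 mulr1 mul1r.
  by rewrite /W1 /W2 !fctE /=; ring.
have sE : s.[u] - expR a.[u] * sin b.[u] =
    expR a.[u] * ((W1 u - 1) * sin b.[u] + W2 u * cos b.[u]).
  transitivity (expR a.[u] * expR (- a.[u]) *
     (s.[u] * (cos b.[u] ^+ 2 + sin b.[u] ^+ 2)) - expR a.[u] * sin b.[u]).
    by rewrite eaN cs1 mulr1 mul1r.
  by rewrite /W1 /W2 !fctE /=; ring.
have fin (x y p q : R) : `|x| <= expR 1 * (8 * A * 2 ^- n) ->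
    `|y| <= expR 1 * (8 * A * 2 ^- n) -> `|p| <= 1 -> `|q| <= 1 ->
    `|expR a.[u] * (x * p + y * q)| <= 16 * A * expR 1 ^+ 2 * 2 ^- n.
  move=> xl yl p1 q1; rewrite normrM (gtr0_norm (expR_gt0 _)).
  rewrite [leRHS](_ : _ = expR 1 * (expR 1 * (8 * A * 2 ^- n) +
    expR 1 * (8 * A * 2 ^- n))); last by ring.
  apply: ler_pM; rewrite ?expR_ge0 //.
  apply: le_trans (ler_normD _ _) _; rewrite !normrM.
  by apply: lerD; [apply: le_trans xl|apply: le_trans yl]; rewrite ler_piMr.
rewrite cE sE; split; last by apply: fin; rewrite ?cos_max ?sin_max.
by rewrite -mulrN; apply: fin; rewrite ?normrN ?cos_max ?sin_max.
Qed.
End exponential_formula.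

(** * Characteristic functions and cumulants *)

Section complex_lemmas.
Variable R : realType.

Lemma cvg_Complex (a b : nat -> R) (la lb : R) :
  a n @[n --> \oo] --> la -> b n @[n --> \oo] --> lb ->
  (fun n => Complex (a n) (b n) : (R[i] : numFieldType)) @ \oo -->
    (Complex la lb : (R[i] : numFieldType)).
Proof.
move=> ca cb; apply/cvgrPdist_lt => -[e e'] e0.
have [e'0 er0] : e' = 0 /\ 0 < e.
  by move: e0; rewrite ltcE /= => /andP[/eqP-> ->].
subst e'; have e2 : 0 < e / 2 by rewrite divr_gt0.
near=> n.
have an : `|la - a n| < e / 2 by near: n; move/cvgrPdist_lt: ca; apply.
have bn : `|lb - b n| < e / 2 by near: n; move/cvgrPdist_lt: cb; apply.
rewrite ltcE /= eqxx /=.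
have key (x y : R) : Num.sqrt (x ^+ 2 + y ^+ 2) <= `|x| + `|y|.
  rewrite -[leRHS]ger0_norm ?addr_ge0 // -sqrtr_sqr ler_sqrt ?sqr_ge0 //.
  rewrite sqrrD !real_normK ?num_real // -addrA [_ *+ 2 + _]addrC addrA lerDl.
  by rewrite mulrn_wge0 ?mulr_ge0.
by apply: le_lt_trans (key _ _) _; rewrite [ltRHS](splitr e) ltrD.
Unshelve. all: by end_near. Qed.

Lemma Complex_mul (a b c e : R) :
  Complex a b * Complex c e = Complex (a * c - b * e) (a * e + b * c) :> R[i].
Proof. by []. Qed.

Lemma Complex_imag_exp (y : R) k :
  Complex 0 y ^+ k = Complex (re_i R k * y ^+ k) (im_i R k * y ^+ k) :> R[i].
Proof.
elim: k => [|k IH]; first by rewrite !expr0 /re_i /im_i /= expr0 mul1r mul0r.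
rewrite exprS IH Complex_mul re_iS im_iS !exprS; congr Complex; ring.
Qed.

Lemma cumulant_series_term (y J : R) k :
  Complex J 0 * Complex 0 y ^+ k / k`!%:R =
  Complex (re_i R k * (J * y ^+ k) / k`!%:R) (im_i R k * (J * y ^+ k) / k`!%:R) :> R[i].
Proof.
have -> : (k`!%:R : R[i]) = Complex k`!%:R 0.
  by rewrite complexr0 rmorph_nat.
have k0 : k`!%:R != 0 :> R by rewrite pnatr_eq0 -lt0n fact_gt0.
have -> : (Complex k`!%:R 0 : R[i])^-1 = Complex k`!%:R^-1 0.
  by rewrite complexr0 -fmorphV.
rewrite Complex_imag_exp !Complex_mul; congr Complex; ring.
Qed.

Lemma Cln_exp (a b : R) : `|b| < pi ->
  Cln (Complex (expR a * cos b) (expR a * sin b)) = Complex a b.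
Proof.
move=> bpi; rewrite /Cln.
have e0 := expR_gt0 a.
have -> : (expR a * cos b) ^+ 2 + (expR a * sin b) ^+ 2 = expR a ^+ 2.
  by rewrite !exprMn -mulrDr cos2Dsin2 mulr1.
rewrite sqrtr_sqr gtr0_norm // expRK mulrAC mulfV ?gt_eqF // mul1r; congr Complex.
rewrite pmulr_rge0 //; move: bpi; rewrite ltr_norml => /andP[b1 b2].
have [b0|b0] := ltP b 0.
  have sb : sin b < 0.
    by rewrite -[b]opprK sinN oppr_lt0 sin_gt0_pi // oppr_gt0 b0 ltrNl.
  by rewrite leNgt sb /= cosKN ?opprK // (ltW b0) (ltW b1).
have -> : 0 <= sin b by rewrite sin_ge0_pi // b0 ltW.
by rewrite cosK // in_itv /= b0 ltW.
Qed.
End complex_lemmas.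

Section characteristic_function.
Context d (T : measurableType d) (R : realType) (P : probability T R).
Variable S : T -> R.
Hypothesis measS : measurable_fun setT S.
Hypothesis intS : forall p, P.-integrable setT (EFin \o (fun w => S w ^+ p)).
Notation integrable f := (P.-integrable [set: T] (EFin \o f)).
Notation Ex f := (\int[P]_w f w).

Lemma integrable_bounded (f : T -> R) (K : R) :
  measurable_fun setT f -> (forall w, `|f w| <= K) -> integrable f.
Proof.
move=> mf fK; apply: measurable_bounded_integrable => //.
  by apply: le_lt_trans (probability_le1 P measurableT) (ltry 1).
exists K; split; first exact: num_real.
by move=> M KM w _; exact: le_trans (fK w) (ltW KM).
Qed.

(** For even n the Taylor remainder |S|^n is the moment S^n. *)
Lemma moment_expansion (F : R -> R) (c : nat -> R) n (u : R) :
  measurable_fun setT F -> (forall x, `|F x| <= 1) ->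
  (forall x, `|F x - (\poly_(p < n) (c p / p`!%:R)).[x]| <= `|x| ^+ n / n`!%:R) ->
  ~~ odd n ->
  `|Ex (fun w => F (u * S w)) -
    (\poly_(p < n) (c p * Ex (fun w => S w ^+ p) / p`!%:R)).[u]| <=
  `|u| ^+ n / n`!%:R * Ex (fun w => S w ^+ n).
Proof.
move=> mF F1 Fn evn.
have IF : integrable (fun w => F (u * S w)).
  apply: (@integrable_bounded _ 1) => [|w]; last exact: F1.
  by apply: measurableT_comp => //; exact: measurable_funM.
have [Ip Ep] := integrable_lin_sum measurableT (index_enum 'I_n)
  (fun p : 'I_n => c p / p`!%:R * u ^+ p) (fun p : 'I_n => intS p).
have -> : (\poly_(p < n) (c p * Ex (fun w => S w ^+ p) / p`!%:R)).[u] =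
    Ex (fun w => \sum_(p < n) c p / p`!%:R * u ^+ p * S w ^+ p).
  by rewrite Ep horner_poly; apply: eq_bigr => p _; ring.
rewrite -RintegralZl //; apply: Rintegral_dist_le => //.
  exact: integrable_scale.
move=> w _.
have := Fn (u * S w); rewrite horner_poly normrM exprMn.
have -> : `|S w| ^+ n = S w ^+ n by rewrite -normrX ger0_norm // exprn_even_ge0.
rewrite mulrAC; congr (`|_ - _| <= _); apply: eq_bigr => p _.
by rewrite exprMn mulrA.
Qed.

Let m p := Ex (fun w => S w ^+ p).
Variables (kappa : nat -> R) (A : R).
Hypothesis mS : forall p,
  m p.+1 = \sum_(j < p.+1) 'C(p, j)%:R * kappa j * m (p - j)%N.
Hypothesis A1 : 1 <= A.
Hypothesis kappaA : forall j, `|kappa j| <= j`!%:R * A.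

Let m0 : m 0%N = 1.
Proof.
rewrite /m; under eq_Rintegral do rewrite expr0.
by rewrite Rintegral_cst // mul1r; exact: (congr1 fine (probability_setT P)).
Qed.

Let A0 : 0 <= A. Proof. exact: le_trans A1. Qed.

Lemma cvg_cum_poly (c : nat -> R) u : A * `|u| <= 1 / 4 ->
  (forall p, `|c p| <= 1) -> exists2 l,
  (fun n => (\poly_(k < n) (c k * cum_seq kappa k / k`!%:R)).[u]) @ \oo --> l &
  `|l| <= 1.
Proof.
move=> Au c1.
have u1 : `|u| <= 1 / 4 by apply: le_trans Au; rewrite ler_peMl.
pose f k := c k * cum_seq kappa k / k`!%:R * u ^+ k.
have fE n : (\poly_(k < n) (c k * cum_seq kappa k / k`!%:R)).[u] = series f n.
  by rewrite horner_poly /series /= big_mkord.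
have cf : cvgn (series f).
  apply: normed_cvg; apply: (@series_le_cvg _ _ (geometric A `|u|)).
  - by move=> n /=.
  - by move=> n; rewrite /geometric /= mulr_ge0 ?exprn_ge0.
  - move=> n; rewrite /geometric /=; apply: le_trans (cum_term_le A1 kappaA _ _ c1) _.
    by case: n => // ; rewrite expr0 mulr1.
  - by apply: is_cvg_geometric_series; rewrite normr_id; lra.
exists (limn (series f)); first by under eq_fun do rewrite fE.
have le1 n : `|series f n| <= 1 by rewrite -fE; exact: (cum_poly_le A1).
rewrite ler_norml; apply/andP; split.
  apply: limr_ge => //; apply: nearW => n.
  by have := le1 n; rewrite ler_norml => /andP[].
apply: limr_le => //; apply: nearW => n.
by have := le1 n; rewrite ler_norml => /andP[].
Qed.

(** Along even orders of truncation, both the Taylor remainder of the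
    characteristic function and the defect in the exponential formula tend to 0. *)
Lemma expectation_exp_imag u : A * `|u| <= 1 / 4 -> exists a b : R,
  [/\ (fun n => (cum_re kappa n).[u]) @ \oo --> a,
      (fun n => (cum_im kappa n).[u]) @ \oo --> b, `|b| <= 1,
      Ex (fun w => cos (u * S w)) = expR a * cos b &
      Ex (fun w => sin (u * S w)) = expR a * sin b].
Proof.
move=> Au; have [a ca _] := cvg_cum_poly Au (@normr_re_i R).
have [b cb b1] := cvg_cum_poly Au (@normr_im_i R).
pose K := 16 * A * expR 1 ^+ 2 + 1.
have K0 : 0 <= K by rewrite addr_ge0 ?mulr_ge0 ?exprn_ge0 ?expR_ge0.
have mn n : ~~ odd n -> `|u| ^+ n / n`!%:R * m n <= 2 ^- n.
  move=> evn; have f0 : 0 < n`!%:R :> R by rewrite ltr0n fact_gt0.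
  apply: (@le_trans _ _ ((A * `|u|) ^+ n)).
    rewrite mulrAC ler_pdivrMr // exprMn mulrAC mulrC ler_wpM2r ?exprn_ge0 //.
    rewrite mulrC; apply: le_trans (ler_norm _) _; exact: moment_bound.
  rewrite -exprVn; apply: lerXn2r; rewrite ?nnegrE ?mulr_ge0 ?invr_ge0 //; lra.
have lim_eq (x l : R) (v : nat -> R) : v @ \oo --> l ->
    (forall n, (0 < n)%N -> ~~ odd n -> `|x - v n| <= K * 2 ^- n) -> x = l.
  move=> cv xv; apply/eqP; rewrite -subr_eq0 -normr_le0; apply/ler_addgt0Pr => e e0.
  rewrite add0r.
  have c2 : (fun n => 2 ^- n : R) @ \oo --> 0.
    under eq_fun do rewrite -exprVn.
    by apply: cvg_expr; rewrite ger0_norm ?invr_ge0 // invf_lt1 // ltr1n.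
  have e2 : 0 < e / 2 by rewrite divr_gt0.
  have eK : 0 < e / 2 / (K + 1) by rewrite divr_gt0 // ltr_wpDl.
  have [n [n0 evn vn qn]] : exists n : nat, [/\ (0 < n)%N, ~~ odd n, `|l - v n| < e / 2 &
      `|0 - 2 ^- n| < e / 2 / (K + 1) :> R].
    move/cvgrPdist_lt: cv => /(_ _ e2) [n1 _ H1].
    move/cvgrPdist_lt: c2 => /(_ _ eK) [n2 _ H2].
    (* an even positive order beyond both ranks *)
    exists (maxn n1 n2).+1.*2; split; rewrite ?odd_double //.
      by apply: H1 => /=; lia.
    by apply: H2 => /=; lia.
  apply: le_trans (ler_distD (v n) _ _) _; rewrite [leRHS](splitr e).
  rewrite distrC in vn; apply: lerD; last exact: ltW.
  apply: le_trans (xv n n0 evn) _; move: qn; rewrite sub0r normrN ger0_norm; last first.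
    by rewrite invr_ge0 exprn_ge0.
  rewrite ltr_pdivlMr ?ltr_wpDl // => /ltW; apply: le_trans.
  by rewrite mulrC ler_wpM2l ?invr_ge0 ?exprn_ge0 // lerDl.
have ccos : (fun n => expR (cum_re kappa n).[u] * cos (cum_im kappa n).[u]) @ \oo -->
    expR a * cos b.
  by apply: cvgM; [apply: continuous_cvg ca; exact: continuous_expR|
                   apply: continuous_cvg cb; exact: continuous_cos].
have csin : (fun n => expR (cum_re kappa n).[u] * sin (cum_im kappa n).[u]) @ \oo -->
    expR a * sin b.
  by apply: cvgM; [apply: continuous_cvg ca; exact: continuous_expR|
                   apply: continuous_cvg cb; exact: continuous_sin].
exists a, b; split => //.
- apply: (lim_eq _ _ _ ccos) => n n0 evn.
  apply: le_trans (ler_distD (mom_re m n).[u] _ _) _.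
  rewrite /K mulrDl mul1r addrC; apply: lerD.
    exact: (exp_poly_approx m0 mS A1 kappaA n0 Au).1.
  apply: le_trans _ (mn n evn).
  apply: (moment_expansion (F := cos) (c := re_i R)) => //.
  + by apply: continuous_measurable_fun; exact: continuous_cos.
  + exact: cos_max.
 
  + by move=> x; exact: (taylor_cos_sin n x).1.
- apply: (lim_eq _ _ _ csin) => n n0 evn.
  apply: le_trans (ler_distD (mom_im m n).[u] _ _) _.
  rewrite /K mulrDl mul1r addrC; apply: lerD.
    exact: (exp_poly_approx m0 mS A1 kappaA n0 Au).2.
  apply: le_trans _ (mn n evn).
  apply: (moment_expansion (F := sin) (c := im_i R)) => //.
  + by apply: continuous_measurable_fun; exact: continuous_sin.
  + exact: sin_max.
 
  + by move=> x; exact: (taylor_cos_sin n x).2.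
Qed.

(** Translation acts on the first cumulant only and scaling by powers. For small
    y the argument b - e u of the characteristic function stays in ]-pi, pi[, so
    the principal logarithm is the continuous one. *)
Lemma cumulants_affine (k e : R) (Z : T -> R) (J : nat -> R) :
  (forall w, Z w = k * (S w - e)) -> J 1%N = k * (kappa 0%N - e) ->
  (forall j, J j.+2 = k ^+ j.+2 * kappa j.+1) -> is_cumulants P Z J.
Proof.
move=> ZE J1 JS; split.
  rewrite (_ : Z = fun w => k * (S w - e)); last exact/funext.
  by apply: measurable_funM => //; apply: measurable_funB.
have near_lin (c r : R) : 0 < r -> \forall y \near (0 : R), `|c * y| < r.
  move=> r0; have : (fun y : R => c * y) y @[y --> (0:R)] --> c * 0.
    by apply: cvgM; [exact: cvg_cst|exact: cvg_id].
  rewrite mulr0 => /cvgrPdist_lt /(_ _ r0); apply: filterS => y.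
  by rewrite sub0r normrN.
have q4 : 0 < 1 / 4 :> R by rewrite divr_gt0.
near=> y.
pose u := k * y.
have Au : A * `|u| <= 1 / 4.
  rewrite -[A]ger0_norm // -normrM /u mulrA ltW //.
  by near: y; exact: (near_lin (A * k) (1 / 4) q4).
have ue : `|e * u| < 1.
  by rewrite /u mulrA; near: y; exact: (near_lin (e * k) 1 ltr01).
have [a [b [ca cb b1 Ecos Esin]]] := expectation_exp_imag Au.
have Icos : integrable (fun w => cos (u * S w)).
  apply: (@integrable_bounded _ 1) => [|w]; last exact: cos_max.
  apply: measurableT_comp; last exact: measurable_funM.
  by apply: continuous_measurable_fun; exact: continuous_cos.
have Isin : integrable (fun w => sin (u * S w)).
  apply: (@integrable_bounded _ 1) => [|w]; last exact: sin_max.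
  apply: measurableT_comp; last exact: measurable_funM.
  by apply: continuous_measurable_fun; exact: continuous_sin.
have -> : charfun P Z y = Complex (expR a * cos (b - e * u)) (expR a * sin (b - e * u)).
  have EE (f : T -> R) : fine 'E_P[f] = Ex f by rewrite unlock.
  rewrite /charfun !EE; congr Complex.
    transitivity (Ex (fun w => cos (e * u) * cos (u * S w) + sin (e * u) * sin (u * S w))).
      apply: eq_Rintegral => w _; rewrite ZE.
      have -> : y * (k * (S w - e)) = u * S w - e * u by rewrite /u; ring.
      by rewrite cosB; ring.
    have [_ ->] := integrable_lin measurableT (cos (e * u)) Icos 
      (integrable_scale measurableT (sin (e * u)) Isin).
    by rewrite RintegralZl // Ecos Esin cosB; ring.
  transitivity (Ex (fun w => cos (e * u) * sin (u * S w) + - sin (e * u) * cos (u * S w))).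
    apply: eq_Rintegral => w _; rewrite ZE.
    have -> : y * (k * (S w - e)) = u * S w - e * u by rewrite /u; ring.
    by rewrite sinB; ring.
  have [_ ->] := integrable_lin measurableT (cos (e * u)) Isin 
    (integrable_scale measurableT (- sin (e * u)) Icos).
  by rewrite RintegralZl // Ecos Esin sinB; ring.
rewrite Cln_exp; last first.
  apply: le_lt_trans (ler_normB _ _) _.
  have : 2 <= pi :> R by exact: pi_ge2.
  move: b1 ue; lra.
have part (c : nat -> R) n :
    \sum_(1 <= j < n) c j * (J j * y ^+ j) / j`!%:R =
    (\poly_(j < n) (c j * cum_seq kappa j / j`!%:R)).[u] -
    (if (1 < n)%N then c 1%N * (e * u) else 0).
  rewrite horner_poly -(big_mkord xpredT (fun j => c j * cum_seq kappa j / j`!%:R * u ^+ j)).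
  case: n => [|[|n]]; first by rewrite !big_geq // subr0.
    by rewrite [in LHS]big_geq // [in RHS]big_nat1 /= mulr0 !mul0r subr0.
  rewrite [in RHS]big_ltn //= mulr0 !mul0r add0r.
  rewrite [in LHS]big_ltn // [in RHS]big_ltn // addrAC; congr (_ + _).
    by rewrite J1 /= !divr1 !expr1 /u; ring.
  rewrite !big_add1 /=; apply: eq_bigr => j _.
  by rewrite JS /= /u exprMn; ring.
have -> : (fun n => \sum_(1 <= j < n)
      Complex (J j) 0 * Complex 0 y ^+ j / j`!%:R : (R[i] : numFieldType)) =
    (fun n => Complex ((cum_re kappa n).[u])
       ((cum_im kappa n).[u] - (if (1 < n)%N then e * u else 0)) : (R[i] : numFieldType)).
  apply/funext => n; under eq_bigr do rewrite cumulant_series_term.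
  transitivity (Complex (\sum_(1 <= j < n) re_i R j * (J j * y ^+ j) / j`!%:R)
     (\sum_(1 <= j < n) im_i R j * (J j * y ^+ j) / j`!%:R) : R[i]).
    elim/big_rec3: _ => [//|j x1 x2 x3 _ ->]; by [].
  rewrite !part /re_i /im_i /= !mul0r expr0 mul1r; congr Complex.
  by case: ifP; rewrite subr0.
apply: cvg_Complex => //; apply: cvgB => //.
apply: cvg_near_cst; exists 2%N => // n /= n2.
by rewrite n2.
Unshelve. all: by end_near. Qed.
End characteristic_function.

(** * Cumulants of the Gaussian variable *)

Section density.
Context d (T : measurableType d) (R : realType).
Variables (nu : {finite_measure set T -> \bar R})
          (mu : {sigma_finite_measure set T -> \bar R}) (g : T -> R).
Hypothesis mg : measurable_fun setT g.
Hypothesis nuE : forall A, measurable A -> nu A = (\int[mu]_(x in A) (g x)%:E)%E.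

Lemma density_dominates : nu `<< mu.
Proof.
apply/null_content_dominatesP => A mA muA0; rewrite nuE //.
by apply: null_set_integral => //; apply/measurable_EFinP; exact: measurable_funTS.
Qed.

(** The density agrees almost everywhere with the Radon-Nikodym derivative, so the
    change of variables for the latter applies. *)
Lemma integral_density (f : T -> R) : measurable_fun setT f -> (forall x, 0 <= g x) ->
  mu.-integrable setT (EFin \o (fun x => f x * g x)) ->
  nu.-integrable setT (EFin \o f) /\
  \int[nu]_x f x = \int[mu]_x (f x * g x).
Proof.
move=> mf g0 If; have dom := density_dominates.
have mgE (D : set T) : measurable_fun D (EFin \o g).
  by apply/measurable_EFinP; exact: measurable_funTS.
have Ig (nf : T -> \bar R) : mu.-integrable setT nf ->
    (forall A, measurable A -> nu A = \int[mu]_(x in A) nf x)%E ->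
    ae_eq mu setT nf (EFin \o g).
  move=> Inf Anf; apply: integral_ae_eq => // A _ mA.
  by rewrite -Anf // nuE.
have I1 : nu.-integrable setT (EFin \o f).
  apply/integrableP; split; first exact/measurable_EFinP.
  have mff : measurable_fun setT (fun x => (`|f x|)%:E : \bar R).
    by apply/measurable_EFinP; exact: measurableT_comp.
  under eq_integral => x _ do rewrite /=.
  rewrite -(Radon_Nikodym_SigmaFinite.change_of_variables dom) //.
  have /integrableP[_] := If; apply: le_lt_trans.
  rewrite le_eqVlt; apply/orP; left; apply/eqP.
  transitivity (\int[mu]_x ((`|f x|)%:E * (g x)%:E))%E.
    apply: ae_eq_integral => //.
    - apply: emeasurable_funM => //; apply: (measurable_int mu).
      exact: Radon_Nikodym_SigmaFinite.f_integrable.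
    - by apply: emeasurable_funM => //; exact: mgE.
    - apply: ae_eqe_mul2l; apply: Ig; first exact: Radon_Nikodym_SigmaFinite.f_integrable.
      by move=> A mA; exact: Radon_Nikodym_SigmaFinite.f_integral.
  by apply: eq_integral => x _; rewrite /= normrM (ger0_norm (g0 x)) EFinM.
split=> //; rewrite /Rintegral; congr fine.
rewrite -(Radon_Nikodym_change_of_variables dom) //.
under [RHS]eq_integral => x _ do rewrite EFinM.
apply: ae_eq_integral => //.
- apply: emeasurable_funM; first exact/measurable_EFinP.
  by apply: (measurable_int mu); exact: Radon_Nikodym_integrable.
- by apply: emeasurable_funM; [exact/measurable_EFinP|exact: mgE].
- apply: ae_eqe_mul2l; apply: Ig; first exact: Radon_Nikodym_integrable.
  by move=> A mA; rewrite -Radon_Nikodym_integral.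
Qed.
End density.

Section gaussian_moments.
Variable R : realType.
Notation mu := (@lebesgue_measure R).
Notation integrable f := (mu.-integrable setT (EFin \o f)).

Let s : R := Num.sqrt (1 / 2).
Let g : R -> R := normal_pdf 0 s.
Let peak : R := normal_peak s.

Let s0 : s != 0. Proof. by rewrite /s sqrtr_eq0 -ltNge divr_gt0. Qed.

Let pdfE c x : normal_pdf c s x = peak * expR (- (x - c) ^+ 2).
Proof.
rewrite /normal_pdf (negbTE s0) /normal_fun; congr (_ * expR _).
by rewrite /s sqr_sqrtr ?divr_ge0 // -mulr_natr div1r mulVf // divr1.
Qed.

Let gE x : g x = peak * expR (- x ^+ 2).
Proof. by rewrite /g pdfE subr0. Qed.

Let g0 x : 0 <= g x. Proof. exact: normal_pdf_ge0. Qed.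

Let K p : R := p`!%:R * expR (1 / 4).
Let dom p x : R := K p * (normal_pdf (1 / 2) s x + normal_pdf (- (1 / 2)) s x).

Let K0 p : 0 <= K p. Proof. by rewrite mulr_ge0 ?expR_ge0. Qed.

(** Completing the square: an exponential times a centred Gaussian density is a
    multiple of a shifted one, so that exponential moments are finite. *)
Let tilt_pdf (c x : R) : c ^+ 2 = 1 / 4 ->
  expR (2 * c * x) * g x = expR (1 / 4) * normal_pdf c s x.
Proof.
by move=> c4; rewrite gE pdfE !(mulrCA _ peak) -!expRD -c4; congr (_ * expR _); ring.
Qed.

Let normr_exp_le p (x : R) : `|x| ^+ p <= p`!%:R * (expR x + expR (- x)).
Proof.
have fp : 0 < p`!%:R :> R by rewrite ltr0n fact_gt0.
have H : `|x| ^+ p <= p`!%:R * expR `|x|.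
  rewrite mulrC -ler_pdivrMr //; case: p fp => [|p] fp.
    rewrite expr0 divr1 -[leLHS]expR0 ler_expR; exact: normr_ge0.
  have := @expR_ge1Dxn R `|x| p (normr_ge0 x); apply: le_trans.
  by rewrite lerDr.
apply: le_trans H _; rewrite (ler_wpM2l (ltW fp)) //.
have [x0|x0] := leP 0 x; first by rewrite (ger0_norm x0) lerDl expR_ge0.
by rewrite (ltr0_norm x0) lerDr expR_ge0.
Qed.

Let monomial_pdf_le p x : `|x ^+ p * g x| <= dom p x.
Proof.
rewrite normrM (ger0_norm (g0 x)) normrX.
apply: le_trans (ler_wpM2r (g0 x) (normr_exp_le p x)) _.
rewrite -mulrA mulrDl /dom /K -[in leRHS]mulrA [in leRHS]mulrDr.
rewrite -!tilt_pdf; [|by rewrite sqrrN; field|by field].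
have -> : 2 * (1 / 2) * x = x by field.
by have -> : 2 * - (1 / 2) * x = - x by field.
Qed.

Let dom_le p x : dom p x <= K p * (2 * peak).
Proof.
rewrite /dom ler_wpM2l // mulr_natl mulr2n.
by apply: lerD; exact: normal_pdf_ub.
Qed.

Let integrable_dom p : integrable (dom p).
Proof.
by apply: integrable_scale => //; apply: integrable_add => //; exact: integrable_normal_pdf.
Qed.

Let measurable_monomial_pdf p : measurable_fun [set: R] (fun x : R => x ^+ p * g x).
Proof. by apply: measurable_funM; [exact: measurable_funX|exact: measurable_normal_pdf]. Qed.

Lemma integrable_monomial_pdf p : integrable (fun x : R => x ^+ p * g x).
Proof.
apply: (le_integrable measurableT _ _ (integrable_dom p)).
  by apply/measurable_EFinP; exact: measurable_monomial_pdf.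
move=> x _ /=; rewrite lee_fin; apply: le_trans (monomial_pdf_le p x) _; exact: ler_norm.
Qed.

Let M p := \int[mu]_x ((x : R) ^+ p * g x).

Let derivative_pdf p x : is_derive x (1:R) (fun y : R => y ^+ p * g y)
  (p%:R * (x ^+ p.-1 * g x) - 2 * (x ^+ p.+1 * g x)).
Proof.
have -> : (fun y : R => y ^+ p * g y) =
    (fun y => horner 'X^p y * (peak * (expR \o horner (- 'X^2)) y)) :> (R -> R).
  by apply/funext => y; rewrite gE /= hornerN !hornerXn.
apply: is_derive_eq.
rewrite gE /= derivN !derivXn !hornerE !hornerMn !hornerXn /GRing.scale /=.
have H (a b c q k : R) : b * (peak * (c * - (a + a))) + peak * c * (k * q) =
    k * q * peak * c - 2 * (a * b) * peak * c by ring.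
by rewrite [x ^+ p.+1]exprS -[_ *+ p]mulr_natl; exact: H.
Qed.

(** The derivative of x^p g x integrates to 0: its integral over [-n, n] is a
    boundary term, and this term and the integral outside [-n, n] are O(1 / n),
    since one more power of x is still dominated by an integrable and bounded
    function. *)
Lemma gaussian_parts p : 2 * M p.+1 = p%:R * M p.-1.
Proof.
pose f (x : R) := p%:R * (x ^+ p.-1 * g x) + - 2 * (x ^+ p.+1 * g x).
have If : integrable f.
  by apply: integrable_add => //; apply: integrable_scale => //; exact: integrable_monomial_pdf.
suff f0 : \int[mu]_x f x = 0.
  move: f0; rewrite /f (integrable_lin measurableT p%:R (integrable_monomial_pdf _)
    (integrable_scale measurableT (- 2) (integrable_monomial_pdf _))).2 RintegralZl //;
    last exact: integrable_monomial_pdf.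
  by rewrite mulNr => /eqP; rewrite subr_eq0 => /eqP ->.
pose B (x : R) := p%:R * dom p x + 2 * dom p.+2 x.
have IB : integrable B by apply: integrable_add => //; exact: integrable_scale.
apply/eqP; rewrite -normr_le0.
apply: (@le_of_inv_nat _ _ _ (\int[mu]_x B x + 2 * (K p.+1 * (2 * peak))) 0%N) => n n0.
have np : 0 < n%:R :> R by rewrite ltr0n.
rewrite add0r mulrDl.
have end_le (y : R) : `|y| = n%:R -> `|y ^+ p * g y| <= K p.+1 * (2 * peak) / n%:R.
  move=> yn; rewrite ler_pdivlMr // -yn -normrM mulrAC -exprSr.
  by apply: le_trans (monomial_pdf_le p.+1 y) _; exact: dom_le.
pose D : set R := `[(- n%:R : R), n%:R]%classic.
have mD : measurable (D : set (measurableTypeR R)) by exact: measurable_itv.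
have ID : \int[mu]_(x in D) f x = n%:R ^+ p * g n%:R - (- n%:R) ^+ p * g (- n%:R).
  rewrite /Rintegral (@continuous_FTC2 R f (fun y : R => y ^+ p * g y)) //=.
  - by rewrite -subr_gt0 opprK addr_gt0.
  - apply: continuous_subspaceT => x.
    have cg : {for x, continuous g} by exact: continuous_normal_pdf.
    have cX q : {for x, continuous (fun y : R => y ^+ q)} by exact: exprn_continuous.
    by apply: cvgD; apply: cvgMr; apply: cvgM; [exact: cX|exact: cg|exact: cX|exact: cg].
  - have cF x : {for x, continuous (fun y : R => y ^+ p * g y)}.
      apply: differentiable_continuous; apply/derivable1_diffP.
      exact: (@ex_derive _ _ _ _ _ _ _ (derivative_pdf p x)).
    split=> [x _||].
    + exact: (@ex_derive _ _ _ _ _ _ _ (derivative_pdf p x)).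
    + by apply: cvg_at_right_filter; exact: cF.
    + by apply: cvg_at_left_filter; exact: cF.
  - move=> x _; rewrite derive1E (@derive_val _ _ _ _ _ _ _ (derivative_pdf p x)).
    by rewrite /f mulNr.
apply: le_trans (_ : `|\int[mu]_x f x - \int[mu]_(x in D) f x| +
   `|\int[mu]_(x in D) f x| <= _).
  by rewrite -[X in `|X| <= _](subrK (\int[mu]_(x in D) f x)) ler_normD.
apply: lerD; last first.
  rewrite ID; apply: le_trans (ler_normB _ _) _.
  rewrite -[leRHS]mulrA mulr_natl mulr2n; apply: lerD; apply: end_le.
    by rewrite ger0_norm.
  by rewrite normrN ger0_norm.
have -> : (\int[mu]_x B x) / n%:R = \int[mu]_x (n%:R^-1 * B x).
  by rewrite RintegralZl // mulrC.
have -> : \int[mu]_(x in D) f x = \int[mu]_x (f \_ D) x by exact: Rintegral_mkcond.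
apply: Rintegral_dist_le => //.
- by rewrite -restrict_EFin; apply/(integrable_mkcond _ mD); exact: integrableS If.
- exact: integrable_scale.
move=> x _; rewrite patchE.
have B0 : 0 <= B x.
  have d0 q : 0 <= dom q x by rewrite mulr_ge0 // addr_ge0 // normal_pdf_ge0.
  by rewrite addr_ge0 // mulr_ge0.
case: ifPn => xD; first by rewrite subrr normr0 mulr_ge0 // invr_ge0.
rewrite subr0 mulrC ler_pdivlMr //.
have nx : n%:R <= `|x|.
  rewrite leNgt; apply: contra xD => xn; rewrite inE /D /= in_itv /=.
  by move: xn; rewrite ltr_norml => /andP[/ltW -> /ltW ->].
apply: (@le_trans _ _ `|f x * x|); first by rewrite normrM ler_wpM2l.
rewrite /f mulrDl; apply: le_trans (ler_normD _ _) _; apply: lerD.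
  rewrite -mulrA normrM ger0_norm //; case: (p) => [|q]; first by rewrite !mul0r.
  by rewrite ler_wpM2l // mulrAC -exprSr; exact: monomial_pdf_le.
rewrite -mulrA normrM normrN (@ger0_norm _ 2) // ler_wpM2l // mulrAC -exprSr.
exact: monomial_pdf_le.
Qed.
End gaussian_moments.

Section gaussian_cumulants.
Context (R : realType) d (T : measurableType d) (Q : probability T R) (eta : {RV Q >-> R}).
Hypothesis heta : forall V : set R, measurable V ->
  distribution Q eta V = normal_prob 0 (Num.sqrt (1 / 2)) V.
Notation mu := (@lebesgue_measure R).
Notation g := (normal_pdf 0 (Num.sqrt (1 / 2) : R)).

(* the same variable, valued in the line with the sigma-algebra that carries
   Lebesgue measure *)
Let etaR : T -> measurableTypeR R := eta.

Let measurable_etaR : measurable_fun setT etaR.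
Proof. exact: (@measurable_funPT _ _ _ _ eta). Qed.

#[local] HB.instance Definition _ :=
  @isMeasurableFun.Build _ _ _ _ etaR measurable_etaR.

Lemma gaussian_moment p :
  Q.-integrable setT (EFin \o (fun w => eta w ^+ p)) /\
  \int[Q]_w eta w ^+ p = \int[mu]_x ((x : R) ^+ p * g x).
Proof.
have mX : measurable_fun [set: R] (fun x : R => x ^+ p) by exact: measurable_funX.
have [I E] := @integral_density _ (measurableTypeR R) R (distribution Q etaR) mu g
  (measurable_normal_pdf _ _) heta (fun x : R => x ^+ p) mX
  (fun x => normal_pdf_ge0 _ _ x) (integrable_monomial_pdf R p).
have mXE : measurable_fun [set: measurableTypeR R] (fun x : R => (x ^+ p)%:E).
  exact/measurable_EFinP.
have IQ : Q.-integrable setT (EFin \o (fun w => eta w ^+ p)).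
  apply/integrableP; split.
    by apply/measurable_EFinP; apply: measurable_funX.
  have /integrableP[_] := I; apply: le_lt_trans.
  rewrite ge0_integral_distribution //.
  by apply: measurableT_comp.
split=> //; rewrite -E /Rintegral; congr fine.
by rewrite (integral_distribution mXE).
Qed.

Definition half_gaussian_cumulant k : R := if k == 2%N then 1 / 2 else 0.

Lemma gaussian_cumulants : is_cumulants Q eta half_gaussian_cumulant.
Proof.
(* cumulants of orders 1, 2, 3 and so on: only the variance is nonzero *)
pose kappa j : R := if j == 1%N then 1 / 2 else 0.
have mE : measurable_fun setT eta by [].
pose m p := \int[Q]_w eta w ^+ p.
have part p : 2 * m p.+1 = p%:R * m p.-1.
  by rewrite /m !(gaussian_moment _).2; exact: gaussian_parts.
apply: (@cumulants_affine _ _ R Q eta mE (fun p => (gaussian_moment p).1) kappa 1 _ _ _ 1 0).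
- case=> [|p]; rewrite -/(m _).
    rewrite big_ord1 /kappa /= mulr0 mul0r; have := part 0%N; rewrite mul0r => /eqP.
    by rewrite mulf_eq0 pnatr_eq0 /= => /eqP.
  rewrite 2!big_ord_recl big1 => [|j _]; last by rewrite /kappa /= mulr0 mul0r.
  rewrite /kappa /= /bump /= mulr0 mul0r add0r addr0 addn0 bin1 subn1 /= -/(m p).
  have := part p.+1; rewrite /= => E.
  have -> : m p.+2 = 2^-1 * (2 * m p.+2) by rewrite mulrA mulVf ?mul1r.
  by rewrite E; field.
- exact: lexx.
- move=> j; rewrite mulr1 /kappa; case: eqP => [->|_]; last by rewrite normr0.
  by rewrite ger0_norm ?divr_ge0 // ler_pdivrMr // mul1r ler1n.
- by move=> w; rewrite mul1r subr0.
- by rewrite /half_gaussian_cumulant /kappa /= subr0 mulr0.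
- by move=> [|j]; rewrite expr1n mul1r.
Qed.
End gaussian_cumulants.

(** * Cumulants of the linear statistic *)

Section limits.
Variable R : realType.

Lemma cvg_of_inv_nat (u : nat -> R) (l c : R) :
  (\forall n \near \oo, `|u n - l| <= c / n%:R) -> u @ \oo --> l.
Proof.
move=> H; apply/cvgrPdist_le => e e0; near=> n.
have n0 : 0 < n%:R :> R by near: n; exact: nbhs_infty_gtr.
rewrite distrC; apply: (@le_trans _ _ (c / n%:R)); first by near: n.
rewrite ler_pdivrMr // mulrC -ler_pdivrMr //; near: n; exact: nbhs_infty_ger.
Unshelve. all: by end_near. Qed.

Lemma cvg_seq_unique (u : nat -> R) (a b : R) :
  u @ \oo --> a -> u @ \oo --> b -> a = b.
Proof.
by move=> ua ub; rewrite -(cvg_lim (@Rhausdorff R) ua) (cvg_lim (@Rhausdorff R) ub).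
Qed.

Lemma cvg_sum_ord p (f : 'I_p -> nat -> R) (l : 'I_p -> R) :
  (forall j, f j @ \oo --> l j) ->
  (fun n => \sum_(j < p) f j n) @ \oo --> \sum_(j < p) l j.
Proof.
elim: p f l => [|p IH] f l fl.
  rewrite big_ord0; under eq_fun do rewrite big_ord0; exact: cvg_cst.
rewrite big_ord_recr /=; under eq_fun do rewrite big_ord_recr /=.
by apply: cvgD => //; apply: IH => j; exact: fl.
Qed.
End limits.

Section sine_cumulants.
Variables (R : realType) (P : probability (config_space R) R).
Hypothesis hP : is_sine_process P.
Variable X : R.
Hypothesis X0 : 0 < X.

Let m p := \int[P]_w linear_stat X w ^+ p.
Let phi n := weights R (grid_size X n) n.
Let D n := circle_mx R (grid_size X n) n.
Let k n j := cumul (phi n) (D n) j.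

Let grid_ok : \forall n \near \oo,
  [/\ X <= n%:R :> R, (0 < n)%N & (n.*2.+1 <= grid_size X n)%N].
Proof.
near=> n; have Xn : X <= n%:R by near: n; exact: nbhs_infty_ger.
have np : 0 < n%:R :> R by exact: lt_le_trans Xn.
by split => //; [rewrite -(ltr0n R)|exact: grid_size_ge].
Unshelve. all: by end_near. Qed.

Lemma cvg_grid_moment p : (fun n => grid_moment X n p) @ \oo --> m p.
Proof.
have [c Hc] := linear_moment_approx hP p X0.
apply: (@cvg_of_inv_nat _ _ _ c); apply: filterS grid_ok => n [Xn _ _].
by rewrite distrC; exact: Hc.
Qed.

Let grid_moment0 n : grid_moment X n 0 = 1.
Proof. by rewrite /grid_moment /joint_moment /= corr_nil. Qed.

(** The recursion expresses a cumulant by moments and earlier cumulants. *)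
Lemma cvg_grid_cumul p : exists l : R, (fun n => k n p) @ \oo --> l.
Proof.
elim/ltn_ind: p => p IH.
have /choice[l Hl] : forall j, exists l : R, (j < p)%N -> (fun n => k n j) @ \oo --> l.
  move=> j; case: (ltnP j p) => [jp|_]; last by exists 0.
  by have [l Hl] := IH j jp; exists l.
exists (m p.+1 - \sum_(j < p) 'C(p, j)%:R * l j * m (p - j)%N).
have -> : (fun n => k n p) = (fun n => grid_moment X n p.+1 -
    \sum_(j < p) 'C(p, j)%:R * k n j * grid_moment X n (p - j)).
  apply/funext => n; rewrite {1}/grid_moment moment_cumul big_ord_recr /=.
  by rewrite subnn -/(grid_moment X n 0) grid_moment0 binn mul1r mulr1 addrC addrK.
apply: cvgB; first exact: cvg_grid_moment.
apply: cvg_sum_ord => j; apply: cvgM; last exact: cvg_grid_moment.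
by apply: cvgMr; exact: Hl.
Qed.

Lemma sum_weights_row M n : (0 < n <= M)%N ->
  \sum_a weights R M n 0 a = n.+1%:R / 2.
Proof.
move=> /andP[n0 nM].
under eq_bigr do rewrite mxE; rewrite -mulr_suml.
rewrite -(big_mkord xpredT (fun a => (n - a)%:R)) (big_cat_nat (leq0n n) nM) /=.
rewrite [X in _ + X]big_nat [X in _ + X]big1 => [|a /andP[na _]]; last first.
  by rewrite (eqP (_ : n - a == 0)%N) // subn_eq0.
rewrite addr0 big_mkord -natr_sum.
have S q : (2 * \sum_(a < q) (q - a) = q * q.+1)%N.
  elim: q => [|q IH]; first by rewrite big_ord0.
  rewrite big_ord_recl subn0 mulnDr.
  under eq_bigr do rewrite lift0 subSS.
  by rewrite IH; lia.
have -> : (\sum_(a < n) (n - a))%N%:R = n%:R * n.+1%:R / 2 :> R.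
  by rewrite -natrM -S natrM mulrC mulKf.
by field; rewrite pnatr_eq0 -lt0n.
Qed.

Let kernel_diag n := dirichlet (grid_size X n) n 0 / (X / n%:R).

Let cvg_kernel_diag : kernel_diag @ \oo --> pi^-1.
Proof.
apply: (@cvg_of_inv_nat _ _ _ (X + 1)); apply: filterS grid_ok => n [Xn _ _].
have := @kernel_approx R X n X0 Xn 0; rewrite mulr0 normr0 => /(_ (ltW X0)).
by rewrite /sine_kernel eqxx.
Qed.

Let cvg_grid_cumul0 : (fun n => k n 0) @ \oo --> X / (2 * pi).
Proof.
have E : \forall n \near \oo, X / 2 * ((1 + n%:R^-1) * kernel_diag n) = k n 0.
  apply: filterS grid_ok => n [Xn n0 nM].
  have -> : k n 0 = \tr (diag_mx (phi n) *m D n).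
    by rewrite /k /cumul big_cons big_nil addr0 expr0 mul1r /= mulmx1.
  have -> : \tr (diag_mx (phi n) *m D n) = (\sum_a phi n 0 a) * dirichlet (grid_size X n) n 0.
    rewrite mulr_suml; apply: eq_bigr => a _.
    by rewrite mul_diag_mx !mxE subrr.
  rewrite sum_weights_row ?n0 /=; last by apply: leq_trans nM; lia.
  rewrite /kernel_diag -natr1; field.
  by rewrite pnatr_eq0 -lt0n n0 gt_eqF.
apply: cvg_trans; first exact: near_eq_cvg E.
have -> : X / (2 * pi) = X / 2 * ((1 + 0) * pi^-1).
  by rewrite addr0 mul1r invfM mulrA.
apply: cvgMr; apply: cvgM; last exact: cvg_kernel_diag.
apply: cvgD; first exact: cvg_cst.
apply: (@cvg_of_inv_nat _ _ _ 1); apply: nearW => n.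
by rewrite subr0 mul1r ger0_norm.
Qed.

(** Identities and non-strict inequalities pass from the grid to the limit. *)
Lemma linear_cumulants : exists kappa : nat -> R,
  [/\ forall p, m p.+1 = \sum_(j < p.+1) 'C(p, j)%:R * kappa j * m (p - j)%N,
      kappa 0%N = X / (2 * pi),
      forall j, `|kappa j.+1| <= j.+1`!%:R * kappa 1%N &
      forall x0, 0 < x0 <= X ->
        `|kappa 1%N - ln X / (2 * pi ^+ 2)| <= 28 + `|ln x0|].
Proof.
have /choice[kappa Hk] := cvg_grid_cumul; exists kappa; split.
- move=> p; apply: (@cvg_seq_unique R (fun n => grid_moment X n p.+1)).
  + exact: cvg_grid_moment.
  + rewrite /grid_moment; under eq_fun do rewrite moment_cumul.
    apply: cvg_sum_ord => j; apply: cvgM; last exact: cvg_grid_moment.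
    by apply: cvgMr; exact: Hk.
- exact: cvg_seq_unique (Hk 0%N) cvg_grid_cumul0.
- move=> j; apply: (@ler_cvg_to _ \oo _ R (fun n => `|k n j.+1|) (fun n => j.+1`!%:R * k n 1%N)).
  + by apply: cvg_norm; exact: Hk.
  + by apply: cvgMr; exact: Hk.
  + apply: filterS grid_ok => n [_ n0 nM]; apply: cumul_le.
    * exact: circle_mx_idem.
    * exact: circle_mx_tr.
    * by move=> a; exact: weights_itv.
- move=> x0 x0X.
  apply: (@cvgr_to_le _ \oo _ R (fun n => `|k n 1%N - ln X / (2 * pi ^+ 2)|)).
    by apply: cvg_norm; apply: cvgB; [exact: Hk|exact: cvg_cst].
  near=> n; apply: grid_variance_log => //; near: n; exact: nbhs_infty_ger.
Unshelve. all: by end_near. Qed.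
End sine_cumulants.

(** * The averaged count *)

Section averaged_count.
Variables (R : realType) (P : probability (config_space R) R).
Hypothesis hP : is_sine_process P.
Variable tau : R.
Hypothesis tau0 : 0 < tau.

Let c2 : R := pi ^+ 2 * (28 + `|ln (2 * tau)|) + `|ln tau| / 2.
Let c3 : R := 1 / 2 + c2 / ln 2.

(** [c2] is pi^2 times the O(1) term of the variance, and [c3] bounds the variance
    by c3 ln N / pi^2, using ln N >= ln 2. *)
Definition cumulant_bound k : R :=
  if k == 2%N then c2 else pi ^+ k * k.-1`!%:R * (c3 / pi ^+ 2).

(** Scaling by s = pi / sqrt (ln N) turns the variance ln N / (2 pi^2) + O(1) into
    1 / 2 + O(1 / ln N), and a cumulant of order k and size O(ln N) into
    O((ln N)^(1 - k / 2)). *)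
Lemma averaged_count_cumulants (N : nat) : (2 <= N)%N -> exists J : nat -> R,
  [/\ is_cumulants P (eta_avg P tau N) J, J 1%N = 0,
      `|J 2%N - 1 / 2| <= cumulant_bound 2 * (ln N%:R)^-1 &
      forall k, (3 <= k)%N ->
        `|J k| <= cumulant_bound k / (ln N%:R) `^ (k%:R / 2 - 1)].
Proof.
move=> N2; have N0 : (0 < N)%N by exact: ltnW.
have Np : 0 < N%:R :> R by rewrite ltr0n.
set L := ln N%:R; have ln2p : 0 < ln 2 :> R by rewrite ln_gt0 // ltr1n.
have L2 : ln 2 <= L by rewrite ler_ln ?posrE // ler_nat.
have L0 : 0 < L by exact: lt_le_trans L2.
pose X := tau * N%:R; have X0 : 0 < X by rewrite mulr_gt0.
have [kappa [mS k0E kle kvar]] := linear_cumulants hP X0.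
have k1_ge0 : 0 <= kappa 1%N by have := kle 0%N; rewrite mul1r; exact: le_trans.
pose s : R := (pi^-1 * Num.sqrt L)^-1.
have sE : s = pi / Num.sqrt L by rewrite /s invfM invrK.
pose J j := if j == 1%N then 0 else s ^+ j * cum_seq kappa j.
have pi2 : 0 < pi ^+ 2 :> R by rewrite exprn_gt0 // pi_gt0.
have var : `|kappa 1%N - L / (2 * pi ^+ 2)| <= c2 / pi ^+ 2.
  have := kvar (2 * tau); rewrite mulr_gt0 //= /X mulrC ler_pM2l // ler_nat => /(_ N2).
  rewrite lnM ?posrE // -/L mulrC => H.
  rewrite [X in `|X|](_ : _ = (kappa 1%N - (ln tau + L) / (2 * pi ^+ 2)) +
     ln tau / (2 * pi ^+ 2)); last by ring.
  apply: le_trans (ler_normD _ _) _; rewrite /c2 [leRHS]mulrDl; apply: lerD.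
    by rewrite [leRHS]mulrC mulKf ?gt_eqF.
  by rewrite invfM mulrA normrM normrM !(@ger0_norm _ (_^-1)) // invr_ge0 ltW.
have s2 : s ^+ 2 = pi ^+ 2 / L by rewrite sE expr_div_n sqr_sqrtr // ltW.
have c2_ge0 : 0 <= c2.
  have : 0 <= c2 / pi ^+ 2 by exact: le_trans var.
  by rewrite pmulr_lge0 ?invr_gt0.
have k1_le : kappa 1%N <= c3 * L / pi ^+ 2.
  have /(le_trans (ler_norm _)) := var; rewrite lerBlDr => H; apply: le_trans H _.
  rewrite /c3 ler_pdivlMr // mulrDl divfK ?gt_eqF //.
  have -> : L / (2 * pi ^+ 2) * pi ^+ 2 = L / 2.
    by move: (pi ^+ 2) pi2 => p pp; field; rewrite gt_eqF.
  rewrite mulrDl addrC mul1r [_^-1 * L]mulrC lerD2l mulrAC ler_pdivlMr //.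
  by rewrite ler_wpM2l.
exists J; split.
- have A1 : 1 <= 1 + `|kappa 0%N| + kappa 1%N by rewrite -addrA lerDl addr_ge0.
  apply: (@cumulants_affine _ _ R P (linear_stat X) _ _ kappa _ mS A1 _ s (X / (2 * pi))).
  + exact: measurable_linear_stat.
  + by move=> p; exact: integrable_linear_moment.
  + case=> [|j]; first by rewrite mul1r addrAC lerDr addr_ge0.
    by apply: le_trans (kle j) _; rewrite ler_wpM2l // lerDr addr_ge0.
  + by move=> w; rewrite (eta_avgE hP) // mulrC.
  + by rewrite /J /= k0E subrr mulr0.
  + by move=> j.
- by [].
- rewrite /J /cumulant_bound /= s2.
  rewrite [X in `|X|](_ : _ = pi ^+ 2 / L * (kappa 1%N - L / (2 * pi ^+ 2))); last first.
    move: (pi : R) (pi_gt0 R) => p pp; field.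
    by rewrite !gt_eqF.
  rewrite normrM ger0_norm; last by rewrite divr_ge0 // ltW.
  apply: le_trans (ler_wpM2l _ var) _; first by rewrite divr_ge0 // ltW.
  rewrite le_eqVlt; apply/orP; left; apply/eqP.
  move: (pi : R) (pi_gt0 R) c2 => p pp c; field.
  by rewrite !gt_eqF.
- move=> [|[|[|k]]] // _; rewrite /J /cumulant_bound [cum_seq _ _]/= [k.+3.-1]/=.
  rewrite [_ == 1%N]/= [_ == 2%N]/=.
  have powE : L `^ (k.+3%:R / 2 - 1) * L = Num.sqrt L ^+ k.+3.
    rewrite -{2}(powRr1 (ltW L0)) -powRD ?gt_eqF ?implybT // subrK.
    by rewrite -powR12_sqrt ?ltW // -powR_mulrn ?powR_ge0 // -powRrM mulrC.
  have P0 : 0 < L `^ (k.+3%:R / 2 - 1) by exact: powR_gt0.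
  rewrite normrM ler_pdivlMr //.
  have s0 : 0 < s by rewrite sE divr_gt0 ?pi_gt0 ?sqrtr_gt0.
  rewrite ger0_norm ?exprn_ge0 ?(ltW s0) //.
  apply: (@le_trans _ _ (s ^+ k.+3 * (k.+2`!%:R * (c3 * L / pi ^+ 2)) *
      L `^ (k.+3%:R / 2 - 1))).
    rewrite ler_wpM2r ?(ltW P0) // ler_wpM2l ?exprn_ge0 ?(ltW s0) //.
    by apply: le_trans (kle _) _; rewrite ler_wpM2l.
  rewrite [leLHS](_ : _ = s ^+ k.+3 * (L `^ (k.+3%:R / 2 - 1) * L) *
     (k.+2`!%:R * (c3 / pi ^+ 2))); last by ring.
  rewrite powE sE expr_div_n divfK ?mulrA //.
  by rewrite expf_neq0 // gt_eqF // sqrtr_gt0.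
Qed.
End averaged_count.

Theorem proposition1p2 (R : realType)
  (P : probability (config_space R) R) (hP : is_sine_process P)
  (tau : R) (htau : 0 < tau <= 1)
  (d : measure_display) (T : measurableType d) (Q : probability T R)
  (eta : {RV Q >-> R})
  (heta : forall V : set R, measurable V ->
     distribution Q eta V = normal_prob 0 (Num.sqrt (1 / 2)) V) :
  exists (A : nat -> R) (AN : nat -> nat -> R) (C : nat -> R),
    [/\ is_cumulants Q eta A,
        A 1%N = 0 &
        forall N : nat, (2 <= N)%N ->
          [/\ is_cumulants P (eta_avg P tau N) (AN N),
              AN N 1%N = 0,
              `|AN N 2%N - A 2%N| <= C 2%N * (ln N%:R)^-1 &
              forall k : nat, (3 <= k)%N ->
                `|AN N k - A k| <= C k / (ln N%:R) `^ (k%:R / 2 - 1)]].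
Proof.
have /andP[tau0 _] := htau.
have /choice[AN HAN] : forall N : nat, exists J : nat -> R, (2 <= N)%N ->
    [/\ is_cumulants P (eta_avg P tau N) J, J 1%N = 0,
        `|J 2%N - 1 / 2| <= cumulant_bound tau 2 * (ln N%:R)^-1 &
        forall k, (3 <= k)%N ->
          `|J k| <= cumulant_bound tau k / (ln N%:R) `^ (k%:R / 2 - 1)].
  move=> N; have [N2|_] := leqP 2 N; last by exists (fun=> 0).
  by have [J HJ] := averaged_count_cumulants hP tau0 N2; exists J.
exists (half_gaussian_cumulant R), AN, (cumulant_bound tau); split => //.
- exact: gaussian_cumulants.
- move=> N N2; have [H1 H2 H3 H4] := HAN N N2; split=> // k k3.
  by case: k k3 => [|[|[|k]]] // k3; rewrite subr0; exact: H4.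
Qed.
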